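(* Let $W:\mathbb{R}\to\mathbb{R}$ be a smooth $2\pi$-periodic function with zero mean and $W(-x)=W(x)$, with Fourier series $W(x)=\sum_{m\in\mathbb{Z}}w_{2m}e^{imx}$ satisfying $\sum_{m\in\mathbb{Z}}(1+m^2)^s|w_{2m}|^2<\infty$ for all $s>\frac12$, where $w_0=0$ and $w_{2m}=w_{-2m}=\bar w_{2m}$ for all $m\in\mathbb{N}$. Fix $n\in\mathbb{N}$ such that $w_{2n}\ne0$. Let $\omega^2=\frac{n^2}{4}+\epsilon\Omega$ with $|\Omega|<|w_{2n}|$. Let $a(y)=\bar b(y)$ be a reversible homoclinic orbit of the coupled-mode system $$\left\{\begin{array}{l} ina'+\Omega a+w_{2n}b=\sigma(|a|^2+2|b|^2)a,\\ -inb'+\Omega b+w_{2n}a=\sigma(2|a|^2+|b|^2)b.\end{array}\right.$$ Then the nonlinear elliptic problem $$U''(x)+\omega^2U(x)+\epsilon W(x)U(x)=\sigma|U(x)|^2U(x),\qquad x\in\mathbb{R},$$ has a non-trivial solution $U(x)$ of the form $$U(x)=\frac{\sqrt\epsilon}{\sqrt{2\pi}}\int_{\mathbb{R}}\hat U(k)e^{ikx}\,dk,$$ with $\hat U\in L^1_q(\mathbb{R})$ for any $q\ge0$ and sufficiently small $\epsilon$, such that $$\forall\,0<\epsilon<\epsilon_0:\quad\left\|U(x)-\sqrt\epsilon\left[a(\epsilon x)e^{\frac{inx}{2}}+\bar a(\epsilon x)e^{-\frac{inx}{2}}\right]\right\|_{C_b^0(\mathbb{R})}\le C\epsilon^{5/6},$$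 for some sufficiently small $\epsilon_0>0$ and $\epsilon$-independent constant $C>0$. Moreover, the solution $U(x)$ is real-valued, continuous on $x\in\mathbb{R}$, and $\lim_{|x|\to\infty}U(x)=0$.
   Context: $\epsilon,\omega^2,\sigma,\Omega$ are real parameters ($\sigma,\Omega$ fixed independently of $\epsilon$); $(a,b):\mathbb{R}\to\mathbb{C}^2$ and primes in the coupled-mode system are derivatives in $y=\epsilon x$. A solution $(a,b)$ of the coupled-mode system is called a reversible homoclinic orbit if it is (non-trivial and) decays to zero at infinity and satisfies $a(y)=\bar a(-y)=\bar b(y)$. For example, for $\sigma=1$, $w_{2n}>0$ one such orbit is $$a(y)=\bar b(y)=\frac{\sqrt2}{\sqrt3}\frac{\sqrt{w_{2n}^2-\Omega^2}}{\sqrt{w_{2n}-\Omega}\cosh(\kappa y)+i\sqrt{w_{2n}+\Omega}\sinh(\kappa y)},\qquad\kappa=\tfrac1n\sqrt{w_{2n}^2-\Omega^2}.$$ $L^1_q(\mathbb{R})$ is the space of functions with $\|\hat U\|_{L^1_q(\mathbb{R})}=\int_{\mathbb{R}}(1+k^2)^{q/2}|\hat U(k)|\,dk<\infty$. $C_b^0(\mathbb{R})$ is the space of bounded continuous functions with the supremum norm. *)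

(* Defs.v *)
From HB Require Import structures.
From mathcomp Require Import all_boot all_order all_algebra.
From mathcomp Require Import all_classical all_reals all_analysis.
From mathcomp.real_closed Require Export complex.
Set Implicit Arguments.
Unset Strict Implicit.
Unset Printing Implicit Defensive.
Import Order.TTheory GRing.Theory Num.Theory.
Import numFieldNormedType.Exports.

Local Open Scope classical_set_scope.
Local Open Scope ring_scope.
Local Open Scope complex_scope.

Section Defs.
Variable R : realType.
Local Notation mu := (@lebesgue_measure R).
Local Notation Re := (@complex.Re R).
Local Notation Im := (@complex.Im R).
Implicit Types (f : R -> R[i]) (W : R -> R) (w : int -> R[i]).

(* The real-valued modulus: the library's `|z| takes its values in R[i]. *)
Definition cmod (z : R[i]) : R := Re `|z|.

Definition expi (t : R) : R[i] := cos t +i* sin t.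

(* R[i] is not a normed module over R in the library, so differentiation and
   integration of R[i]-valued functions of a real variable are componentwise. *)
Definition cderivable f (x : R) : Prop :=
  derivable (fun t => Re (f t)) x 1 /\ derivable (fun t => Im (f t)) x 1.

Definition cderiv f (x : R) : R[i] :=
  derive1 (fun t => Re (f t)) x +i* derive1 (fun t => Im (f t)) x.

Definition cintegral f : R[i] :=
  Rintegral mu setT (fun x => Re (f x)) +i*
  Rintegral mu setT (fun x => Im (f x)).

(* R[i]^o is R[i] with the topology given by the modulus. *)
Definition ccontinuous f : Prop := continuous (f : R -> R[i]^o).

Definition vanishes_at_infinity f : Prop :=
  ((f x : R[i]^o) @[x --> +oo] --> (0 : R[i]^o)) /\
  ((f x : R[i]^o) @[x --> -oo] --> (0 : R[i]^o)).

Definition in_Cb0 f : Prop :=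
  ccontinuous f /\ exists M : R, forall x, cmod (f x) <= M.

(* Extended-real supremum: an unbounded f gets norm +oo, whereas the real-valued
   sup would return the junk value 0. *)
Definition Cb0_norm f : \bar R := ereal_sup (range (fun x => (cmod (f x))%:E)).

Definition L1q_norm (q : R) f : \bar R :=
  (\int[mu]_(k in setT) ((1 + k ^+ 2) `^ (q / 2) * cmod (f k))%R%:E)%E.

Definition in_L1q (q : R) f : Prop :=
  [/\ measurable_fun setT (fun k => Re (f k)),
      measurable_fun setT (fun k => Im (f k)) &
      (L1q_norm q f < +oo)%E].

Definition smooth W : Prop := forall (j : nat) (x : R), derivable (derive1n j W) x 1.

(* Throughout, w m is the coefficient w_{2m} of exp(i m x). Partial sums are
   symmetric, m = j - N for 0 <= j <= 2N; the order is immaterial for the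
   absolutely convergent series considered in admissible_potential. *)
Definition is_fourier_series w W : Prop :=
  forall x : R,
    ((\sum_(0 <= j < N.*2.+1)
        w (j%:Z - N%:Z) * expi ((j%:Z - N%:Z)%:~R * x) : R[i]^o)
      @[N --> \oo] --> ((W x)%:C : R[i]^o)).

Definition sobolev_sum w (s : R) : \bar R :=
  (\esum_(m in [set: int])
     ((1 + m%:~R ^+ 2) `^ s * cmod (w m) ^+ 2)%R%:E)%E.

Definition admissible_potential W w : Prop :=
  [/\ smooth W,
      periodic W (2 * pi),
      Rintegral mu `[- pi, pi] W = 0 &
      (forall x, W (- x) = W x)] /\
  [/\ is_fourier_series w W,
      (forall s : R, 1 / 2 < s -> (sobolev_sum w s < +oo)%E),
      w 0 = 0 &
      (forall m : int, w m = w (- m) /\ w m = (w m)^*)].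

Definition coupled_mode_solution (n : nat) (Omega sigma : R) (w2n : R[i])
    (a b : R -> R[i]) : Prop :=
  forall y : R,
    [/\ cderivable a y, cderivable b y,
        'i%C * n%:R * cderiv a y + Omega%:C * a y + w2n * b y =
          sigma%:C * (`|a y| ^+ 2 + 2 * `|b y| ^+ 2) * a y &
        - ('i%C * n%:R * cderiv b y) + Omega%:C * b y + w2n * a y =
          sigma%:C * (2 * `|a y| ^+ 2 + `|b y| ^+ 2) * b y].

Definition reversible_homoclinic (n : nat) (Omega sigma : R) (w2n : R[i])
    (a b : R -> R[i]) : Prop :=
  [/\ coupled_mode_solution n Omega sigma w2n a b,
      (exists y, (a y != 0) || (b y != 0)),
      vanishes_at_infinity a,
      vanishes_at_infinity b &
      (forall y, a y = (a (- y))^* /\ a y = (b y)^*)].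

(* Classical (pointwise, twice differentiable) solutions. *)
Definition elliptic_solution (omega2 eps sigma : R) W (U : R -> R[i]) : Prop :=
  forall x : R,
    [/\ cderivable U x, cderivable (cderiv U) x &
        cderiv (cderiv U) x + omega2%:C * U x + (eps * W x)%:C * U x =
          sigma%:C * `|U x| ^+ 2 * U x].

Definition fourier_form (eps : R) (Uhat : R -> R[i]) (x : R) : R[i] :=
  (Num.sqrt eps / Num.sqrt (2 * pi))%:C *
    cintegral (fun k => Uhat k * expi (k * x)).

Definition two_mode_approx (n : nat) (eps : R) (a : R -> R[i]) (x : R) : R[i] :=
  (Num.sqrt eps)%:C *
    (a (eps * x) * expi (n%:R * x / 2) +
     (a (eps * x))^* * expi (- (n%:R * x / 2))).

End Defs.

(* Main.v *)
(** Put y = eps x and U = 2 sqrt(eps) (u cos (n x / 2) - v sin (n x / 2)) with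
    U' = - n sqrt(eps) (u sin (n x / 2) + v cos (n x / 2)).  Then (u, v) solves a
    planar system with slow time y whose coefficients are periodic in the fast
    variable x = y / eps, and whose x-average is the real form of the
    coupled-mode system.  A near-identity change of variables, built from
    bounded x-antiderivatives, turns it into the averaged system plus a
    remainder of order eps.  Reversibility means that u is even and v is odd;
    within this class the linearisation along the homoclinic orbit is
    invertible with exponential weights, because its bounded kernel is spanned
    by the tangent vector, which has the opposite parity.  A contraction gives
    a solution at distance O(eps) of the homoclinic orbit, hence an error
    O(eps^(3/2)) for U, and U decays exponentially with all its derivatives.

    The Fourier representation of U reduces to inversion at 0 of an even
    function F.  On the half-line, F - F(0) (1 + x) exp(-x) is O(x^2) at 0; if g
    is its quotient by x, the sine transform of g is a primitive of the cosine
    transform of F - F(0) (1 + x) exp(-x) and tends to 0 at infinity by the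
    Riemann-Lebesgue lemma, while the transform of (1 + x) exp(-x) is
    2 / (1 + k^2)^2. *)
Require Import Defs.
From mathcomp Require Import all_boot all_order all_algebra.
From mathcomp Require Import all_classical all_reals all_analysis.
From mathcomp.real_closed Require Import complex.
From mathcomp Require Import measurable_realfun ring lra.
From Stdlib Require List.
Set Implicit Arguments.
Unset Strict Implicit.
Unset Printing Implicit Defensive.
Import Order.TTheory GRing.Theory Num.Theory.
Import numFieldNormedType.Exports.
Local Open Scope classical_set_scope.
Local Open Scope ring_scope.

(** * Antiderivatives on the real line *)

Section Antiderivatives.
Variable R : realType.
Implicit Types (F G f g : R -> R) (a b c x y : R).

(** The condition [|Omega| < |w_{2n}|] makes the origin a saddle of the averaged system, with rate
    [kappa = sqrt(w_{2n}^2 - Omega^2) / n]. Corrections to the orbit are sought with the smaller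
    rate [kappa / 2]: forcing that decays at the rate [kappa] itself would resonate with the tangent
    vector, and the bound [frame_rate] degenerates as the two rates meet. The signs of [w_{2n}] and
    [sigma] are free: the sign [tau] of [w_{2n}] is absorbed into the sine ([v] is [tau] times the
    imaginary part of [a]), and the existence of the orbit forces [tau * sigma > 0]. No explicit
    orbit is used; its two-sided exponential bounds come from conservation of energy. The lower
    bound matters as much as the upper one, since reduction of order divides by the squared length
    of the tangent vector. Decay of all derivatives of [U] gives [L^1_q] for every [q]. As [U] is
    even, its transform is a real cosine transform, and inversion at [x] reduces to inversion at 0
    for the average of the translates of [U] by [x] and [-x]. *)

Definition antider F f := forall x, is_derive x 1 F (f x).

Lemma antider_eq F f g : antider F f -> f =1 g -> antider F g.
Proof. by move=> Ff /funext <-. Qed.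

Lemma antider_cst c : antider (fun=> c) (fun=> 0).
Proof. by move=> x; exact: is_derive_cst. Qed.

Lemma antider_id : antider (fun x => x) (fun=> 1).
Proof. by move=> x; exact: is_derive_id. Qed.

Lemma is_derive_add F G x a b :
  is_derive x 1 F a -> is_derive x 1 G b ->
  is_derive x 1 (fun x => F x + G x) (a + b).
Proof. by move=> Ff Gg; have := is_deriveD Ff Gg. Qed.

Lemma is_derive_mul F G x a b :
  is_derive x 1 F a -> is_derive x 1 G b ->
  is_derive x 1 (fun x => F x * G x) (a * G x + F x * b).
Proof.
move=> Ff Gg; suff -> : a * G x + F x * b = F x *: b + G x *: a.
  exact: is_deriveM.
by rewrite /GRing.scale /=; ring.
Qed.

Lemma is_derive_comp F G x a b :
  is_derive x 1 F a -> is_derive (F x) 1 G b ->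
  is_derive x 1 (fun x => G (F x)) (b * a).
Proof. by move=> Ff Gg; have := is_derive1_comp Gg Ff; exact. Qed.

Lemma is_derive_inv F x a : F x != 0 ->
  is_derive x 1 F a -> is_derive x 1 (fun x => (F x)^-1) (- a / F x ^+ 2).
Proof.
move=> F0 Ff; suff -> : - a / F x ^+ 2 = - F x ^- 2 *: a.
  exact: is_deriveV.
by rewrite /GRing.scale /=; ring.
Qed.

Lemma antiderD F G f g : antider F f -> antider G g ->
  antider (fun x => F x + G x) (fun x => f x + g x).
Proof. by move=> Ff Gg x; exact: is_derive_add. Qed.

Lemma antiderM F G f g : antider F f -> antider G g ->
  antider (fun x => F x * G x) (fun x => f x * G x + F x * g x).
Proof. by move=> Ff Gg x; exact: is_derive_mul. Qed.

Lemma antiderN F f : antider F f -> antider (fun x => - F x) (fun x => - f x).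
Proof. by move=> Ff x; have := is_deriveN (Ff x). Qed.

Lemma antiderX F f k : antider F f ->
  antider (fun x => F x ^+ k) (fun x => k%:R * f x * F x ^+ k.-1).
Proof.
move=> Ff; elim: k => [|k IH].
  by apply: antider_eq (antider_cst 1) _ => x; rewrite !mul0r.
rewrite (_ : (fun x => F x ^+ k.+1) = fun x => F x * F x ^+ k); last first.
  by apply/funext => x; rewrite exprS.
apply: antider_eq (antiderM Ff IH) _ => x /=.
case: k {IH} => [|k]/=; first by rewrite !expr0; ring.
by rewrite -[k.+2%:R]natr1 exprS; ring.
Qed.

Lemma antider_comp F G f g : antider F f -> antider G g ->
  antider (fun x => G (F x)) (fun x => g (F x) * f x).
Proof. by move=> Ff Gg x; exact: is_derive_comp. Qed.

Lemma antiderV F f : (forall x, F x != 0) -> antider F f ->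
  antider (fun x => (F x)^-1) (fun x => - f x / F x ^+ 2).
Proof. by move=> F0 Ff x; exact: is_derive_inv. Qed.

Lemma antider_cos : antider cos (fun x => - sin x).
Proof. by move=> x; exact: is_derive_cos. Qed.

Lemma antider_sin : antider sin cos.
Proof. by move=> x; exact: is_derive_sin. Qed.

Lemma antider_exp : antider expR expR.
Proof. by move=> x; exact: is_derive_expR. Qed.

Lemma antider_cvg F f x : antider F f -> {for x, continuous F}.
Proof.
move=> /(_ x) [dF _].
by apply: differentiable_continuous; exact/derivable1_diffP.
Qed.

Lemma antider_continuous F f : antider F f -> continuous F.
Proof. by move=> Ff x; exact: antider_cvg Ff. Qed.

(** Mean value theorem for [G - F]. Derivatives are asked for on the segment only, because
    [ratio_riemann_lebesgue] applies this to a function that is singular at 0. *)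
Lemma le_of_derive_le F G f g a b : a <= b ->
  (forall x, a <= x <= b -> is_derive x 1 F (f x)) ->
  (forall x, a <= x <= b -> is_derive x 1 G (g x)) ->
  (forall x, a <= x <= b -> f x <= g x) ->
  F b - F a <= G b - G a.
Proof.
move=> ab Ff Gg fg.
have D x : a <= x <= b -> is_derive x 1 (fun x => G x - F x) (g x - f x).
  by move=> xab; have := is_deriveB (Gg x xab) (Ff x xab).
have [||c cab E] := @MVT_segment R (fun x => G x - F x) (fun x => g x - f x) a b ab.
- by move=> x; rewrite in_itv/= => /andP[ax xb]; apply: D; rewrite !ltW.
- apply: derivable_within_continuous => x; rewrite in_itv/= => xab.
  by have [] := D x xab.
- rewrite -subr_ge0.
  have -> : G b - G a - (F b - F a) = G b - F b - (G a - F a) by ring.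
  rewrite E mulr_ge0 ?subr_ge0 //.
  by apply: fg; move: cab; rewrite in_itv.
Qed.

Lemma norm_le_of_derive_le F G f g a b : a <= b ->
  (forall x, a <= x <= b -> is_derive x 1 F (f x)) ->
  (forall x, a <= x <= b -> is_derive x 1 G (g x)) ->
  (forall x, a <= x <= b -> `|f x| <= g x) ->
  `|F b - F a| <= G b - G a.
Proof.
move=> ab Ff Gg fg; rewrite ler_norml; apply/andP; split; last first.
  by apply: le_of_derive_le Ff Gg _ => // x /fg; apply: le_trans; exact: ler_norm.
have Fn x : a <= x <= b -> is_derive x 1 (fun x => - F x) (- f x).
  by move=> xab; have := is_deriveN (Ff x xab).
have := le_of_derive_le ab Fn Gg; have -> : - F b - - F a = - (F b - F a) by ring.
rewrite lerNl; apply => x /fg; apply: le_trans; rewrite -normrN; exact: ler_norm.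
Qed.

Lemma antider_uniq F G f : antider F f -> antider G f ->
  forall x y, F x - F y = G x - G y.
Proof.
move=> Ff Gf.
have key a b : a <= b -> F b - F a = G b - G a.
  move=> ab; apply: le_anti; apply/andP.
  by split; apply: (@le_of_derive_le _ _ f f).
move=> x y; have [/key //|/ltW /key e] := leP y x.
by rewrite -opprB e opprB.
Qed.

Lemma antider0 F : antider F (fun=> 0) -> forall x y, F x = F y.
Proof.
move=> F0 x y; apply/eqP; rewrite -subr_eq0; apply/eqP.
rewrite (antider_uniq F0 (antider_cst 0)); ring.
Qed.

Local Notation mu := (@lebesgue_measure R).

Lemma Rintegral_antider f a x : continuous f -> a < x ->
  is_derive x 1 (fun y => Rintegral mu `[a, y] f) (f x).
Proof.
move=> cf ax.
have x1 : x < x + 1 by rewrite ltrDl.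
have inf : mu.-integrable `[a, x + 1] (EFin \o f).
  apply: continuous_compact_integrable; first exact: segment_compact.
  exact: continuous_subspaceT.
have [D <-] := continuous_FTC1_closed x1 inf ax (cf x).
by rewrite derive1E; exact: DeriveDef.
Qed.

(** The integral from [a] is differentiated only to the right of [a]. The base point [- |y| - 1]
    lies to the left of both 0 and [y]; after subtraction of the value at 0 the base point no longer
    matters, so near each point [F] agrees with an integral from one fixed base. *)
Lemma antider_exists f : continuous f -> exists2 F, antider F f & F 0 = 0.
Proof.
move=> cf.
pose P a y := Rintegral mu `[a, y] f.
pose F y := P (- `|y| - 1) y - P (- `|y| - 1) 0.
have inf a b : mu.-integrable `[a, b] (EFin \o f).
  apply: continuous_compact_integrable; first exact: segment_compact.
  exact: continuous_subspaceT.
have shift a b y : a <= b -> b < y -> P a y - P b y = P a b.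
  move=> ab ay; rewrite /P; apply/eqP; rewrite subr_eq addrC -subr_eq; apply/eqP.
  rewrite Rintegral_itvB ?bnd_simp ?(ltW ay) //.
  rewrite Rintegral_itv_obnd_cbnd //.
  by apply: integrableS (inf b y) => //; exact: subset_itv_oc_cc.
have FE a y : a <= - `|y| - 1 -> F y = P a y - P a 0.
  move=> ha; rewrite /F.
  have h1 : - `|y| - 1 < y by have := ler_norm (- y); rewrite normrN => ?; lra.
  have h0 : - `|y| - 1 < 0 by have := normr_ge0 y => ?; lra.
  have := shift _ _ _ ha h1; have := shift _ _ _ ha h0; lra.
exists F; last by rewrite /F subrr.
move=> x.
pose a := - `|x| - 2.
have D : is_derive x 1 (fun y => P a y - P a 0) (f x).
  have ax : a < x by rewrite /a; have := ler_norm (- x); rewrite normrN => ?; lra.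
  have := is_deriveB (Rintegral_antider cf ax) (is_derive_cst (P a 0) x 1).
  by rewrite subr0.
apply: near_eq_is_derive D.
near=> y; symmetry; apply: FE.
have : `|x - y| < 1 by near: y; exact: cvgr_dist_lt.
have := ler_normB x (x - y); rewrite /a opprB addrCA subrr addr0; lra.
Unshelve. all: by end_near. Qed.

(** Chosen rather than integrated, so that later arguments see only the two defining properties;
    meaningful for continuous [f]. *)
Definition prim f : R -> R := get [set F | antider F f /\ F 0 = 0].

Lemma primP f : continuous f -> antider (prim f) f /\ prim f 0 = 0.
Proof.
move=> cf; have [F h1 h2] := antider_exists cf.
by apply: (@getPex _ [set F | antider F f /\ F 0 = 0]); exists F.
Qed.

Lemma prim_antider f : continuous f -> antider (prim f) f.
Proof. by case/primP. Qed.

Lemma prim0 f : continuous f -> prim f 0 = 0.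
Proof. by case/primP. Qed.

Lemma primE f F : antider F f -> continuous f -> forall x, prim f x = F x - F 0.
Proof.
move=> Ff cf x; have [h1 h2] := primP cf.
by have := antider_uniq h1 Ff x 0; rewrite h2 subr0.
Qed.

End Antiderivatives.

(** Differentiates along the syntax of the function and leaves the derivative to unification. In the
    idiom [eapply antider_eq; [der | ...]] the second goal then compares the derivative found with
    the one wanted. *)
Ltac der :=
  lazymatch goal with
  | H : antider ?F _ |- antider ?F _ => exact: H
  | |- antider (fun x => x) _ => exact: antider_id
  | |- antider (fun x => @GRing.add _ (@?f x) (@?g x)) _ =>
      refine (@antiderD _ f g _ _ _ _); der
  | |- antider (fun x => @GRing.mul _ (@?f x) (@?g x)) _ =>
      refine (@antiderM _ f g _ _ _ _); der
  | |- antider (fun x => @GRing.opp _ (@?f x)) _ =>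
      refine (@antiderN _ f _ _); der
  | |- antider (fun x => @GRing.exp _ (@?f x) ?k) _ =>
      refine (@antiderX _ f _ k _); der
  | |- antider (fun x => cos (@?f x)) _ =>
      refine (@antider_comp _ f cos _ _ _ (@antider_cos _)); der
  | |- antider (fun x => sin (@?f x)) _ =>
      refine (@antider_comp _ f sin _ _ _ (@antider_sin _)); der
  | |- antider (fun x => expR (@?f x)) _ =>
      refine (@antider_comp _ f expR _ _ _ (@antider_exp _)); der
  | |- _ => first [exact: antider_cst | eassumption]
  end.

Section ContinuityRules.
Variable R : realType.
Implicit Types (f g : R -> R).

Lemma cont_cst (c : R) : continuous (fun _ : R => c).
Proof. by move=> x; exact: cvg_cst. Qed.

Lemma cont_id : continuous (fun x : R => x).
Proof. by move=> x; exact: cvg_id. Qed.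

Lemma cont_add f g : continuous f -> continuous g -> continuous (fun x => f x + g x).
Proof. by move=> cf cg x; exact: (cvgD (cf x) (cg x)). Qed.

Lemma cont_mul f g : continuous f -> continuous g -> continuous (fun x => f x * g x).
Proof. by move=> cf cg x; exact: (cvgM (cf x) (cg x)). Qed.

Lemma cont_opp f : continuous f -> continuous (fun x => - f x).
Proof. by move=> cf x; exact: (cvgN (cf x)). Qed.

Lemma cont_norm f : continuous f -> continuous (fun x => `|f x|).
Proof. by move=> cf x; exact: (cvg_norm (cf x)). Qed.

Lemma cont_exp f k : continuous f -> continuous (fun x => f x ^+ k).
Proof.
move=> cf; elim: k => [|k IH]; first exact: cont_cst.
rewrite (_ : (fun x => f x ^+ k.+1) = fun x => f x * f x ^+ k); last first.
  by apply/funext => x; rewrite exprS.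
exact: cont_mul.
Qed.

Lemma cont_comp f g : continuous f -> continuous g -> continuous (fun x => g (f x)).
Proof. by move=> cf cg x; exact: (continuous_comp (cf x) (cg (f x))). Qed.

Lemma cont_inv f : (forall x, f x != 0) -> continuous f -> continuous (fun x => (f x)^-1).
Proof. by move=> f0 cf x; exact: (cvgV (f0 x) (cf x)). Qed.

End ContinuityRules.

Ltac cont :=
  lazymatch goal with
  | H : continuous ?f |- continuous ?f => exact H
  | |- continuous (fun x => x) => exact: cont_id
  | |- continuous (fun x => @GRing.add _ (@?f x) (@?g x)) =>
      refine (@cont_add _ f g _ _); cont
  | |- continuous (fun x => @GRing.mul _ (@?f x) (@?g x)) =>
      refine (@cont_mul _ f g _ _); cont
  | |- continuous (fun x => @GRing.opp _ (@?f x)) =>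
      refine (@cont_opp _ f _); cont
  | |- continuous (fun x => @GRing.exp _ (@?f x) ?k) =>
      refine (@cont_exp _ f k _); cont
  | |- continuous (fun x => @Num.norm _ _ (@?f x)) =>
      refine (@cont_norm _ f _); cont
  | |- continuous (fun x => cos (@?f x)) =>
      refine (@cont_comp _ f cos _ (@continuous_cos _)); cont
  | |- continuous (fun x => sin (@?f x)) =>
      refine (@cont_comp _ f sin _ (@continuous_sin _)); cont
  | |- continuous (fun x => expR (@?f x)) =>
      refine (@cont_comp _ f expR _ (@continuous_expR _)); cont
  | |- _ => first [exact: cont_cst | assumption]
  end.

(** * Limits at infinity with exponential rates, and geometric limits *)

Section Limits.
Variable R : realType.
Implicit Types (F G f g : R -> R) (K L x y : R).

(** Completeness of the reals, in the form in which [tail_limit] and [geometric_limit] use it: the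
    intervals there are approximations with their error bars. *)
Lemma nested_point (T : Type) (t0 : T) (lo hi : T -> R) :
  (forall s t, lo s <= hi t) -> exists L, forall t, lo t <= L <= hi t.
Proof.
move=> lh; exists (sup (range lo)) => t; apply/andP; split.
  by apply: ub_le_sup; [exists (hi t) => _ [s _ <-] | exists t].
by apply: ge_sup; [exists (lo t0), t0 | move=> _ [s _ <-]].
Qed.

Lemma expR_small0 l K (c : R) : 0 < l ->
  (forall y, 0 <= y -> `|c| <= K * expR (- (l * y))) -> c = 0.
Proof.
move=> l0 h; apply/eqP; apply/negPn/negP => c0.
have c1 : 0 < `|c| by rewrite normr_gt0.
have K0 : 0 < K.
  have := h 0 (lexx _); rewrite mulr0 oppr0 expR0 mulr1; exact: lt_le_trans.
(* With this [y], [|c| (1 + l y) = |c| + K], which would have to be at most [K]. *)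
pose y := K / (`|c| * l).
have y0 : 0 <= y by rewrite divr_ge0 ?mulr_ge0 // ltW.
have := h y y0; rewrite expRN ler_pdivlMr ?expR_gt0 // => e1.
have : `|c| * (1 + l * y) <= K.
  by apply: le_trans e1; rewrite ler_pM2l // expR_ge1Dx.
have -> : `|c| * (1 + l * y) = `|c| + K by rewrite /y; field; rewrite (gt_eqF c1) (gt_eqF l0).
by rewrite gerDr leNgt c1.
Qed.

Lemma exp_bound_ge0 (l K : R) f : (forall y, 0 <= y -> `|f y| <= K * expR (- (l * y))) -> 0 <= K.
Proof. by move=> /(_ 0 (lexx _)); rewrite mulr0 oppr0 expR0 mulr1; apply: le_trans. Qed.

(** A limit at infinity that carries an exponential rate. Every function met on the half-line
    converges in this way, and the rate makes uniqueness and the algebra of limits elementary. *)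
Definition elim_at F L := exists l K, 0 < l /\
  forall y, 0 <= y -> `|F y - L| <= K * expR (- (l * y)).

Lemma expR_mono_rate l l' y : l <= l' -> 0 <= y -> expR (- (l' * y)) <= expR (- (l * y)).
Proof. by move=> ll y0; rewrite ler_expR lerN2 ler_wpM2r. Qed.

Lemma elim_atP2 F L G L' : elim_at F L -> elim_at G L' ->
  exists l K, [/\ 0 < l, 0 <= K & forall y, 0 <= y ->
    `|F y - L| <= K * expR (- (l * y)) /\ `|G y - L'| <= K * expR (- (l * y))].
Proof.
move=> [l1 [K1 [l1p h1]]] [l2 [K2 [l2p h2]]].
have K10 : 0 <= K1 by exact: exp_bound_ge0 h1.
have K20 : 0 <= K2 by exact: exp_bound_ge0 h2.
exists (Num.min l1 l2), (K1 + K2); split; first by rewrite lt_min l1p.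
  exact: addr_ge0.
move=> y y0; split.
  apply: (le_trans (h1 y y0)); apply: ler_pM; rewrite ?expR_ge0 ?lerDl //.
  by apply: expR_mono_rate => //; rewrite ge_min lexx.
apply: (le_trans (h2 y y0)); apply: ler_pM; rewrite ?expR_ge0 ?lerDr //.
by apply: expR_mono_rate => //; rewrite ge_min lexx orbT.
Qed.

Lemma elim_at_uniq F L L' : elim_at F L -> elim_at F L' -> L = L'.
Proof.
move=> h1 h2; have [l [K [lp K0 h]]] := elim_atP2 h1 h2.
apply/eqP; rewrite -subr_eq0; apply/eqP; apply: (@expR_small0 l (K + K)) => // y y0.
have [a b] := h y y0; have -> : L - L' = (F y - L') - (F y - L) by ring.
by rewrite mulrDl (le_trans (ler_normB _ _)) // lerD.
Qed.

Lemma elim_at_add F L G L' : elim_at F L -> elim_at G L' ->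
  elim_at (fun x => F x + G x) (L + L').
Proof.
move=> h1 h2; have [l [K [lp K0 h]]] := elim_atP2 h1 h2.
exists l, (K + K); split=> // y y0; have [a b] := h y y0.
have -> : F y + G y - (L + L') = (F y - L) + (G y - L') by ring.
by rewrite mulrDl (le_trans (ler_normD _ _)) // lerD.
Qed.

Lemma elim_at_scale F L (c : R) : elim_at F L -> elim_at (fun x => c * F x) (c * L).
Proof.
move=> [l [K [lp h]]]; exists l, (`|c| * K); split=> // y y0.
by rewrite -mulrBr normrM -mulrA ler_wpM2l // h.
Qed.

Lemma elim_at_cst (c : R) : elim_at (fun=> c) c.
Proof.
exists 1, 0; split => // y y0; rewrite subrr normr0 mul0r; exact: lexx.
Qed.

Lemma elim_at_eq F G L : elim_at F L -> (forall y, 0 <= y -> F y = G y) -> elim_at G L.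
Proof. by move=> [l [K [lp h]]] e; exists l, K; split => // y y0; rewrite -e // h. Qed.

Lemma elim_at_shift F L (a : R) : continuous F -> elim_at F L -> elim_at (fun x => F (a + x)) L.
Proof.
move=> cF [l [K [lp h]]].
have [a0|a0] := leP 0 a.
  exists l, K; split=> // y y0; apply: (le_trans (h _ _)); first exact: addr_ge0.
  have K0 : 0 <= K by exact: exp_bound_ge0 h.
  by rewrite ler_wpM2l // ler_expR lerN2 ler_wpM2l ?(ltW lp) // lerDr.
have K0 : 0 <= K by exact: exp_bound_ge0 h.
(* A shift to the left brings in the compact stretch from [a] to 0, where the rate says nothing; the
   maximum of [|F - L|] there is added to the constant. *)
have [|M Mi MF] := @EVT_max R (fun x => `|F x - L|) a 0 (ltW a0).
  by apply: continuous_subspaceT; cont.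
exists l, ((K + `|F M - L|) * expR (- (l * a))); split=> // y y0.
rewrite -mulrA -expRD.
have -> : - (l * a) + - (l * y) = - (l * (a + y)) by ring.
have [ay|ay] := leP 0 (a + y).
  by rewrite (le_trans (h _ ay)) // ler_wpM2r ?expR_ge0 // lerDl.
have h1 : `|F (a + y) - L| <= `|F M - L|.
  by apply: MF; rewrite in_itv/= (ltW ay) lerDl y0.
apply: (le_trans h1); rewrite -[leLHS]mulr1; apply: ler_pM => //.
  by rewrite lerDr.
apply: (@le_trans _ _ (1 - l * (a + y))); last exact: expR_ge1Dx.
by rewrite lerDl oppr_ge0 mulr_ge0_le0 ?(ltW lp) // ltW.
Qed.

Lemma antider_expN (l : R) : l != 0 ->
  antider (fun y => - expR (- (l * y)) / l) (fun y => expR (- (l * y))).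
Proof. by move=> l0; eapply antider_eq; [der | move=> y /=; field]. Qed.

Lemma antider_expP (l : R) : l != 0 ->
  antider (fun y => expR (l * y) / l) (fun y => expR (l * y)).
Proof. by move=> l0; eapply antider_eq; [der | move=> y /=; field]. Qed.

Lemma tail_diff F f K l a b : 0 < l -> antider F f ->
  (forall y, 0 <= y -> `|f y| <= K * expR (- (l * y))) -> 0 <= a -> a <= b ->
  `|F b - F a| <= K / l * (expR (- (l * a)) - expR (- (l * b))).
Proof.
move=> l0 Ff h a0 ab; have ln0 : l != 0 by rewrite gt_eqF.
have H : antider (fun y => K * (- expR (- (l * y)) / l)) (fun y => K * expR (- (l * y))).
  have E := antider_expN ln0; eapply antider_eq; first der.
  by move=> y /=; ring.
have := @norm_le_of_derive_le R F _ f _ a b ab (fun x _ => Ff x) (fun x _ => H x).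
have -> : K * (- expR (- (l * b)) / l) - K * (- expR (- (l * a)) / l) =
  K / l * (expR (- (l * a)) - expR (- (l * b))) by field.
by apply=> x /andP[ax _]; apply: h; exact: le_trans ax.
Qed.

(** The integral of the bound on [f] over the tail is [K / l * exp (- l t)], so the intervals of
    that radius around [F t] have a common point. *)
Lemma tail_limit F f K l : 0 < l -> antider F f ->
  (forall y, 0 <= y -> `|f y| <= K * expR (- (l * y))) ->
  exists L, forall y, 0 <= y -> `|F y - L| <= K / l * expR (- (l * y)).
Proof.
move=> l0 Ff h.
have K0 : 0 <= K by exact: exp_bound_ge0 h.
have Kl : 0 <= K / l by rewrite divr_ge0 // ltW.
pose T := {y : R | 0 <= y}.
pose lo (t : T) := F (sval t) - K / l * expR (- (l * sval t)).
pose hi (t : T) := F (sval t) + K / l * expR (- (l * sval t)).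
have [||L HL] := @nested_point T _ lo hi.
- by exists 0.
- move=> [s s0] [t t0]; rewrite /lo /hi /=.
  have es := mulr_ge0 Kl (expR_ge0 (- (l * s))).
  have et := mulr_ge0 Kl (expR_ge0 (- (l * t))).
  have [st|/ltW ts] := leP s t.
    have := tail_diff l0 Ff h s0 st; rewrite mulrBr ler_norml => /andP[a b]; lra.
  have := tail_diff l0 Ff h t0 ts; rewrite mulrBr ler_norml => /andP[a b]; lra.
exists L => y y0; have := HL (exist _ y y0); rewrite /lo /hi /= => /andP[a b].
by rewrite ler_norml; apply/andP; split; lra.
Qed.

Lemma tail_bound F f K l L : 0 < l -> antider F f ->
  (forall y, 0 <= y -> `|f y| <= K * expR (- (l * y))) -> elim_at F L ->
  forall y, 0 <= y -> `|F y - L| <= K / l * expR (- (l * y)).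
Proof.
move=> l0 Ff h HL; have [L' HL'] := tail_limit l0 Ff h.
have <- // : L' = L by apply: elim_at_uniq HL; exists l, (K / l).
Qed.

(** Counterpart of [tail_bound] for growing integrands, which have to be integrated from 0 instead
    of from infinity. *)
Lemma growth_bound F f K l : 0 < l -> antider F f -> F 0 = 0 ->
  (forall y, 0 <= y -> `|f y| <= K * expR (l * y)) ->
  forall y, 0 <= y -> `|F y| <= K / l * expR (l * y).
Proof.
move=> l0 Ff F0 h y y0; have ln0 : l != 0 by rewrite gt_eqF.
have K0 : 0 <= K.
  by have := h 0 (lexx _); rewrite mulr0 expR0 mulr1; apply: le_trans.
have H : antider (fun y => K * (expR (l * y) / l)) (fun y => K * expR (l * y)).
  have E := antider_expP ln0; eapply antider_eq; first der.
  by move=> z /=; ring.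
have := @norm_le_of_derive_le R F _ f _ 0 y y0 (fun x _ => Ff x) (fun x _ => H x).
rewrite F0 subr0 mulr0 expR0 => /(_ _)/le_trans; apply; last first.
  by rewrite mulrAC -mulrA gerBl mulr_ge0 // divr_ge0 // ?ler01 // ltW.
by move=> x /andP[ax _]; apply: h.
Qed.

(** The factor 2 is the sum of the geometric series. The weight [w] passes to the limit, so decay
    survives; [w <= 1] makes the convergence uniform, hence the limit continuous. *)
Lemma geometric_limit (f : nat -> R -> R) (C : R) (w : R -> R) :
  0 <= C -> (forall y, 0 <= w y <= 1) ->
  (forall k, continuous (f k)) ->
  (forall k y, `|f k.+1 y - f k y| <= C * 2^-1 ^+ k * w y) ->
  exists2 g : R -> R, continuous g &
    forall k y, `|g y - f k y| <= 2 * C * 2^-1 ^+ k * w y.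
Proof.
move=> C0 w01 cf df.
have key y : exists L, forall k, `|L - f k y| <= 2 * C * 2^-1 ^+ k * w y.
  (* The tail of the series: [r k - r k.+1] is exactly the allowed increment, so the intervals of
     radius [r k] around [f k y] are nested. *)
  pose r k : R := 2 * C * 2^-1 ^+ k * w y.
  have r0 k : 0 <= r k.
    by have /andP[? _] := w01 y; rewrite /r !mulr_ge0 // exprn_ge0 // invr_ge0 ler0n.
  have rS k : r k - r k.+1 = C * 2^-1 ^+ k * w y.
    by rewrite /r exprS; field.
  have lo k j : f k y - r k <= f (k + j)%N y - r (k + j)%N.
    elim: j => [|j IH]; first by rewrite addn0.
    rewrite addnS; apply: (le_trans IH); have := df (k + j)%N y; rewrite -rS ler_norml => /andP[a b].
    lra.
  have hi k j : f (k + j)%N y + r (k + j)%N <= f k y + r k.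
    elim: j => [|j IH]; first by rewrite addn0.
    rewrite addnS; apply: le_trans IH; have := df (k + j)%N y; rewrite -rS ler_norml => /andP[a b].
    lra.
  have [|L HL] := @nested_point nat 0%N (fun k => f k y - r k) (fun k => f k y + r k).
    move=> s t; apply: (le_trans (lo s t)); apply: le_trans (hi t s).
    by rewrite addnC; have := r0 (t + s)%N; lra.
  exists L => k; have /andP[a b] := HL k; rewrite ler_norml -/(r k).
  by apply/andP; split; lra.
exists (fun y => xget 0 [set L | forall k, `|L - f k y| <= 2 * C * 2^-1 ^+ k * w y]); last first.
  by move=> k y; exact: (xgetPex 0 (key y) k).
set g := (fun y => _).
have gf k y : `|g y - f k y| <= 2 * C * 2^-1 ^+ k * w y.
  exact: (xgetPex 0 (key y) k).
move=> x; apply/cvgrPdist_lt => e e0.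
have [k kP] : exists k, 2 * C * 2^-1 ^+ k < e / 4.
  have e1 : 0 < e / (8 * (C + 1)) by rewrite divr_gt0 // mulr_gt0 //; lra.
  have : (2^-1 : R) ^+ k @[k --> \oo] --> 0.
    by apply: cvg_expr; rewrite ger0_norm ?invr_ge0 //; lra.
  move=> /cvgrPdist_lt /(_ _ e1) [k _ /(_ k (leqnn k))] /=.
  rewrite sub0r normrN => hk; exists k.
  rewrite ger0_norm in hk; last by rewrite exprn_ge0 // invr_ge0 ler0n.
  rewrite ltr_pdivlMr in hk; last by rewrite mulr_gt0 //; lra.
  have := exprn_ge0 k (_ : 0 <= 2^-1 :> R); rewrite invr_ge0 ler0n => /(_ isT).
  move: (2^-1 ^+ k) hk => u hk u0.
  have e2 : u * (8 * (C + 1)) = 4 * (2 * C * u) + 8 * u by ring.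
  rewrite e2 in hk; rewrite ltr_pdivlMr //; apply: le_lt_trans hk.
  by rewrite mulrC lerDl mulr_ge0.
have gf' y : `|g y - f k y| <= e / 4.
  apply: (le_trans (gf k y)); have /andP[a b] := w01 y.
  apply: le_trans (ltW kP); rewrite ler_piMr ?b //.
  by rewrite !mulr_ge0 // exprn_ge0 // invr_ge0 ler0n.
near=> y.
have h : `|f k x - f k y| < e / 4.
  by near: y; have /cvgrPdist_lt /(_ (e / 4)) := cf k x; apply; rewrite divr_gt0.
have -> : g x - g y = (g x - f k x) + (f k x - f k y) - (g y - f k y) by ring.
apply: (le_lt_trans (ler_normB _ _)); have := gf' y.
have := ler_normD (g x - f k x) (f k x - f k y); have := gf' x; lra.
Unshelve. all: by end_near. Qed.

End Limits.

(** * The homoclinic orbit of the averaged system *)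

Section Homoclinic.
Variable R : realType.
Implicit Types (n alpha gamma beta kappa : R) (u v : R -> R).

(** Real form of the coupled-mode system on [b = conj a]: [u] is the real part of [a], [v] is [tau]
    times its imaginary part, [alpha] and [gamma] are [tau (w_{2n} -+ Omega)], and [beta] is
    [3 tau sigma], as [|a|^2 + 2 |b|^2 = 3 |a|^2]. *)
Definition averaged_orbit n alpha gamma beta u v :=
  antider u (fun y => (alpha + beta * (u y ^+ 2 + v y ^+ 2)) * v y / n) /\
  antider v (fun y => (gamma - beta * (u y ^+ 2 + v y ^+ 2)) * u y / n).

(** The level set of the conserved Hamiltonian that contains the origin. *)
Definition zero_energy alpha gamma beta u v := forall y,
  gamma * u y ^+ 2 - alpha * v y ^+ 2 = beta / 2 * (u y ^+ 2 + v y ^+ 2) ^+ 2.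

Lemma energy_zero n alpha gamma beta u v :
  0 < n -> 0 < alpha -> 0 < gamma ->
  averaged_orbit n alpha gamma beta u v ->
  (forall e, 0 < e -> exists y, `|u y| < e /\ `|v y| < e) ->
  zero_energy alpha gamma beta u v.
Proof.
move=> n0 al0 ga0 [du dv] lim0.
have nn0 : n != 0 by rewrite gt_eqF.
pose H y := gamma * u y ^+ 2 - alpha * v y ^+ 2 - beta / 2 * (u y ^+ 2 + v y ^+ 2) ^+ 2.
have HE : antider H (fun=> 0).
  by eapply antider_eq; [rewrite /H; der | move=> y /=; field].
suff H0 y : H y = 0.
  by move=> y; apply/eqP; rewrite -subr_eq0; apply/eqP; exact: H0.
(* When [|u|] and [|v|] are below [e1 <= 1], their squares are at most [e1] and [(u^2 + v^2)^2] is
   at most [4 e1], so [|H| <= M e1]. *)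
pose M := gamma + alpha + 2 * `|beta|.
have M0 : 0 < M by rewrite /M ltr_wpDr ?mulr_ge0 // addr_gt0.
apply/eqP; rewrite -normr_eq0; apply/eqP/le_anti; rewrite normr_ge0 andbT.
apply/ler_addgt0Pr => e e0; rewrite add0r.
pose e1 := Num.min 1 (e / M).
have e10 : 0 < e1 by rewrite lt_min ltr01 divr_gt0.
have e11 : e1 <= 1 by rewrite ge_min lexx.
have e1M : M * e1 <= e by rewrite mulrC -ler_pdivlMr // ge_min lexx orbT.
have [z [uz vz]] := lim0 e1 e10.
rewrite (antider0 HE y z); apply: le_trans e1M.
have sq x : `|x| < e1 -> 0 <= x ^+ 2 <= e1.
  move=> xe; rewrite sqr_ge0 -real_normK ?num_real //=.
  have := normr_ge0 x; rewrite expr2; nra.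
have /andP[a1 a2] := sq _ uz; have /andP[b1 b2] := sq _ vz.
rewrite /H; move: (u z ^+ 2) (v z ^+ 2) a1 a2 b1 b2 => a b a1 a2 b1 b2.
have c1 : 0 <= (a + b) ^+ 2 <= 4 * e1 by rewrite sqr_ge0 /= expr2; nra.
have /andP[c2 c3] := c1; move: ((a + b) ^+ 2) c2 c3 => c c2 c3.
have i1 : 0 <= gamma * a <= gamma * e1 by rewrite mulr_ge0 ?(ltW ga0) ?ler_wpM2l // ltW.
have i2 : 0 <= alpha * b <= alpha * e1 by rewrite mulr_ge0 ?(ltW al0) ?ler_wpM2l // ltW.
have i3 : `|beta * c| <= `|beta| * (4 * e1) by rewrite normrM (ger0_norm c2) ler_wpM2l.
move: i3; rewrite ler_norml => /andP[i3 i4].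
rewrite ler_norml /M; lra.
Qed.

(** The terms in [beta] cancel in the derivative of [r = u^2 + v^2], which leaves [2 C u v] with
    [C = (alpha + gamma) / n]. Hence [|r'| <= C r], and [r] times [exp (C y)] or [exp (- C y)] is
    monotone. *)
Lemma radius_gt0 n alpha gamma beta u v y0 :
  0 < n -> 0 < alpha -> 0 < gamma ->
  averaged_orbit n alpha gamma beta u v ->
  0 < u y0 ^+ 2 + v y0 ^+ 2 -> forall y, 0 < u y ^+ 2 + v y ^+ 2.
Proof.
move=> n0 al0 ga0 [du dv]; have nn0 : n != 0 by rewrite gt_eqF.
pose r y := u y ^+ 2 + v y ^+ 2; rewrite -/(r y0) => r0.
suff : forall y, 0 < r y by [].
pose C := (alpha + gamma) / n.
have dr : antider r (fun y => 2 * C * u y * v y).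
  by eapply antider_eq; [rewrite /r; der | move=> y /=; rewrite /r /C; field].
have bd y : `|2 * C * u y * v y| <= C * r y.
  have C0 : 0 <= C by rewrite /C divr_ge0 ?(ltW n0) //; lra.
  have -> : 2 * C * u y * v y = C * (2 * u y * v y) by ring.
  rewrite normrM (ger0_norm C0) ler_wpM2l // ler_norml /r.
  have := sqr_ge0 (u y + v y); have := sqr_ge0 (u y - v y); lra.
have d1 : antider (fun y => r y * expR (C * y)) (fun y => (2 * C * u y * v y + C * r y) * expR (C * y)).
  by eapply antider_eq; [der | move=> y /=; ring].
have d2 : antider (fun y => r y * expR (- (C * y))) (fun y => (2 * C * u y * v y - C * r y) * expR (- (C * y))).
  by eapply antider_eq; [der | move=> y /=; ring].
move=> y; have [yy|/ltW yy] := leP y0 y.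
  rewrite -(pmulr_lgt0 _ (expR_gt0 (C * y))).
  apply: (@lt_le_trans _ _ (r y0 * expR (C * y0))); first by rewrite mulr_gt0 // expR_gt0.
  have := le_of_derive_le yy (fun x _ => antider_cst 0 x) (fun x _ => d1 x).
  rewrite subrr subr_ge0; apply=> x _; rewrite mulr_ge0 ?expR_ge0 //.
  have := bd x; rewrite ler_norml => /andP[]; lra.
rewrite -(pmulr_lgt0 _ (expR_gt0 (- (C * y)))).
apply: (@lt_le_trans _ _ (r y0 * expR (- (C * y0)))); first by rewrite mulr_gt0 // expR_gt0.
have := le_of_derive_le yy (fun x _ => d2 x) (fun x _ => antider_cst 0 x).
rewrite subrr subr_le0; apply=> x _; rewrite mulr_le0_ge0 ?expR_ge0 //.
have := bd x; rewrite ler_norml => /andP[]; lra.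
Qed.

(** Eliminating [u^2] from the energy relation gives [(alpha + gamma) v^2 = (gamma - beta r / 2) r],
    whose left side is nonnegative. *)
Lemma radius_le alpha gamma beta u v y :
  0 < alpha -> 0 < gamma -> 0 < beta -> zero_energy alpha gamma beta u v ->
  0 < u y ^+ 2 + v y ^+ 2 -> beta * (u y ^+ 2 + v y ^+ 2) <= 2 * gamma.
Proof.
move=> al0 ga0 be0 /(_ y); have := sqr_ge0 (v y).
set b := v y ^+ 2; set r := _ + b => b0 e r0.
have {}e : (alpha + gamma) * b = (gamma - beta / 2 * r) * r.
  have uE : u y ^+ 2 = r - b by rewrite /r; ring.
  rewrite uE in e.
  by move: e => /eqP; rewrite -subr_eq0 => /eqP h; apply/eqP; rewrite -subr_eq0 -oppr_eq0; apply/eqP; rewrite -h; ring.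
have : 0 <= (gamma - beta / 2 * r) * r by rewrite -e mulr_ge0 // addr_ge0 // ltW.
rewrite pmulr_lge0 // => h; lra.
Qed.

(* The reciprocal of u + iv solves a linear system with eigenvalues +-kappa. *)
Lemma radius_bounds n alpha gamma beta kappa u v :
  0 < n -> 0 < alpha -> 0 < gamma -> 0 < kappa ->
  (n * kappa) ^+ 2 = alpha * gamma ->
  averaged_orbit n alpha gamma beta u v -> zero_energy alpha gamma beta u v ->
  (forall y, 0 < u y ^+ 2 + v y ^+ 2) -> v 0 = 0 ->
  exists c K, [/\ 0 < c, 0 < K & forall y, 0 <= y ->
    c * expR (- (2 * kappa * y)) <= u y ^+ 2 + v y ^+ 2 <=
    K * expR (- (2 * kappa * y))].
Proof.
move=> n0 al0 ga0 ka0 kaE [du dv] energy r_gt0 v0.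
have nn0 : n != 0 by rewrite gt_eqF.
pose r y := u y ^+ 2 + v y ^+ 2; have {}r_gt0 y : 0 < r y by exact: r_gt0.
have rn0 y : r y != 0 by rewrite gt_eqF.
(* Real and imaginary parts of [1 / (u + iv)]. The energy relation, in the forms [eu] and [ev],
   cancels the cubic terms in their derivatives. *)
pose mr y := u y / r y; pose mi y := - v y / r y.
have dr : antider r (fun y => 2 * ((alpha + gamma) / n) * u y * v y).
  by eapply antider_eq; [rewrite /r; der | move=> y /=; rewrite /r; field].
have drV := antiderV rn0 dr.
have eu y : (alpha + gamma) * u y ^+ 2 = alpha * r y + beta / 2 * r y ^+ 2.
  by rewrite -energy /r; ring.
have ev y : (alpha + gamma) * v y ^+ 2 = gamma * r y - beta / 2 * r y ^+ 2.
  by rewrite -energy /r; ring.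
have dmr : antider mr (fun y => alpha / n * mi y).
  eapply antider_eq; [rewrite /mr; der | move=> y /=; rewrite /mi].
  have e := eu y; have e0 := rn0 y; rewrite -/(r y) in e0 *.
  apply: (mulIf (_ : n * r y ^+ 2 != 0)); first by rewrite mulf_neq0 // expf_neq0.
  transitivity (v y * (alpha * r y + beta * r y ^+ 2 - 2 * ((alpha + gamma) * u y ^+ 2))).
    by field; rewrite e0.
  by rewrite e; field; rewrite e0.
have dmi : antider mi (fun y => gamma / n * mr y).
  eapply antider_eq; [rewrite /mi; der | move=> y /=; rewrite /mr].
  have e := ev y; have e0 := rn0 y; rewrite -/(r y) in e0 *.
  apply: (mulIf (_ : n * r y ^+ 2 != 0)); first by rewrite mulf_neq0 // expf_neq0.
  transitivity (- u y * (gamma * r y - beta * r y ^+ 2 - 2 * ((alpha + gamma) * v y ^+ 2))).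
    by field; rewrite e0.
  by rewrite e; field; rewrite e0.
pose sa := Num.sqrt alpha; pose sg := Num.sqrt gamma.
have saE : sa ^+ 2 = alpha by rewrite sqr_sqrtr // ltW.
have sgE : sg ^+ 2 = gamma by rewrite sqr_sqrtr // ltW.
have sa0 : 0 < sa by rewrite sqrtr_gt0.
have sg0 : 0 < sg by rewrite sqrtr_gt0.
have kE : n * kappa = sa * sg.
  apply/eqP; rewrite -(@eqrXn2 _ 2) // ?mulr_ge0 // ?ltW //.
  by rewrite kaE exprMn saE sgE.
have kE' : kappa = sa * sg / n by rewrite -kE mulrAC mulfV ?mul1r.
(* The combinations [sg mr + sa mi] and [sg mr - sa mi] are the eigenvectors for [kappa] and
   [- kappa]; since [v 0 = 0], both start from [sg m0]. *)
have dX : antider (fun y => (sg * mr y + sa * mi y) * expR (- (kappa * y))) (fun=> 0).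
  eapply antider_eq; first der.
  by move=> y /=; rewrite kE' -saE -sgE; field.
have dY : antider (fun y => (sg * mr y - sa * mi y) * expR (kappa * y)) (fun=> 0).
  eapply antider_eq; first der.
  by move=> y /=; rewrite kE' -saE -sgE; field.
have mi0 : mi 0 = 0 by rewrite /mi v0 oppr0 mul0r.
pose m0 := mr 0.
have XE y : sg * mr y + sa * mi y = sg * m0 * expR (kappa * y).
  have := antider0 dX y 0; rewrite /= mi0 !mulr0 oppr0 expR0 addr0 mulr1 -/m0 => <-.
  by rewrite -mulrA -expRD addNr expR0 mulr1.
have YE y : sg * mr y - sa * mi y = sg * m0 * expR (- (kappa * y)).
  have := antider0 dY y 0; rewrite /= mi0 !mulr0 expR0 subr0 mulr1 -/m0 => <-.
  by rewrite -mulrA -expRD subrr expR0 mulr1.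
have m00 : m0 != 0.
  rewrite /m0 /mr mulf_neq0 ?invr_eq0 ?rn0 //; apply/eqP => u0.
  by have := r_gt0 0; rewrite /r u0 v0 expr0n /= addr0 ltxx.
have sq0 : 0 < gamma * m0 ^+ 2 by rewrite mulr_gt0 // lt0r sqr_ge0 expf_neq0.
have m2 y : mr y ^+ 2 + mi y ^+ 2 = (r y)^-1.
  by rewrite /mr /mi /r; field; exact: rn0.
(* A quadratic form in the reciprocal, known exactly. It lies between the minimum and the maximum of
   [alpha], [gamma] times [1 / r], which turns it into two-sided bounds on [r]. *)
have T y : 2 * (gamma * mr y ^+ 2 + alpha * mi y ^+ 2) =
    gamma * m0 ^+ 2 * (expR (2 * kappa * y) + expR (- (2 * kappa * y))).
  transitivity ((sg * mr y + sa * mi y) ^+ 2 + (sg * mr y - sa * mi y) ^+ 2).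
    by rewrite -saE -sgE; ring.
  rewrite XE YE !exprMn sgE -!expRM_natl.
  have -> : 2%:R * (kappa * y) = 2 * kappa * y by ring.
  have -> : 2%:R * - (kappa * y) = - (2 * kappa * y) by ring.
  ring.
pose mn := Num.min alpha gamma; pose mx := Num.max alpha gamma.
have mn0 : 0 < mn by rewrite lt_min al0.
have mx0 : 0 < mx by rewrite lt_max al0.
exists (mn / (gamma * m0 ^+ 2)), (2 * mx / (gamma * m0 ^+ 2)); split.
- by rewrite divr_gt0.
- by rewrite divr_gt0 // mulr_gt0.
move=> y y0.
have ry : 0 < r y := r_gt0 y; rewrite -/(r y); have Ty := T y; have m2y := m2 y.
have E1 : expR (- (2 * kappa * y)) <= expR (2 * kappa * y).
  by rewrite ler_expR ge0_cp // ?oppr_le0 !mulr_ge0 // ltW.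
have E0 := expR_gt0 (2 * kappa * y).
have E0' := expR_gt0 (- (2 * kappa * y)).
have lo : mn * (r y)^-1 <= gamma * mr y ^+ 2 + alpha * mi y ^+ 2.
  rewrite -m2y mulrDr lerD // ler_wpM2r ?sqr_ge0 // ge_min lexx ?orbT //.
have hi : gamma * mr y ^+ 2 + alpha * mi y ^+ 2 <= mx * (r y)^-1.
  rewrite -m2y mulrDr lerD // ler_wpM2r ?sqr_ge0 // le_max lexx ?orbT //.
have e2 : expR (- (2 * kappa * y)) = (expR (2 * kappa * y))^-1 by rewrite expRN.
set E := expR (2 * kappa * y) in E0 E1 Ty e2.
set E' := expR _ in E0' E1 Ty e2 *.
have EE : E * E' = 1 by rewrite e2 mulfV // gt_eqF.
set q := gamma * m0 ^+ 2 in sq0 Ty *.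
have ri0 : 0 < (r y)^-1 by rewrite invr_gt0.
have lo2 : mn * (r y)^-1 <= q * E.
  apply: (le_trans lo); have : q * E' <= q * E by rewrite ler_wpM2l // ltW.
  lra.
have hi2 : q * E <= 2 * mx * (r y)^-1.
  have := mulr_gt0 sq0 E0'; lra.
apply/andP; split.
- rewrite mulrAC ler_pdivrMr // -(@ler_pM2r _ (E * (r y)^-1)) ?mulr_gt0 //.
  have -> : mn * E' * (E * (r y)^-1) = mn * (r y)^-1 * (E * E') by ring.
  have -> : r y * q * (E * (r y)^-1) = q * E by field.
  by rewrite EE mulr1.
- rewrite mulrAC ler_pdivlMr // -(@ler_pM2r _ (E * (r y)^-1)) ?mulr_gt0 //.
  have -> : 2 * mx * E' * (E * (r y)^-1) = 2 * mx * (r y)^-1 * (E * E') by ring.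
  have -> : r y * q * (E * (r y)^-1) = q * E by field.
  by rewrite EE mulr1.
Qed.

End Homoclinic.

(** * The linearisation along the homoclinic orbit *)

Section LinearTheory.
Variable R : realType.

(** One decaying solution of a trace-free planar system determines the rest by reduction of order,
    at the price of dividing by its squared length; hence the lower bound [frame_lb]. The solution
    is odd and even in its components, opposite to the solutions sought. *)
Record decaying_frame (phi1 phi2 a11 a12 a21 : R -> R) (kappa K c : R) : Prop := {
  frame_kappa : 0 < kappa; frame_K : 0 < K; frame_c : 0 < c;
  frame_d1 : antider phi1 (fun y => a11 y * phi1 y + a12 y * phi2 y);
  frame_d2 : antider phi2 (fun y => a21 y * phi1 y - a11 y * phi2 y);
  frame_odd : forall y, phi1 (- y) = - phi1 y;
  frame_even : forall y, phi2 (- y) = phi2 y;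
  frame_ca11 : continuous a11; frame_ca12 : continuous a12;
  frame_ca21 : continuous a21;
  frame_a11 : forall y, a11 (- y) = - a11 y;
  frame_a12 : forall y, a12 (- y) = a12 y;
  frame_a21 : forall y, a21 (- y) = a21 y;
  frame_ub : forall y, 0 <= y ->
    `|phi1 y| <= K * expR (- (kappa * y)) /\ `|phi2 y| <= K * expR (- (kappa * y));
  frame_lb : forall y, 0 <= y ->
    c * expR (- (2 * kappa * y)) <= phi1 y ^+ 2 + phi2 y ^+ 2;
  frame_ab : forall y, 0 <= y -> [/\ `|a11 y| <= K, `|a12 y| <= K & `|a21 y| <= K] }.

(** Parity belongs to the definition because it excludes multiples of the tangent vector. *)
Definition linear_solution (a11 a12 a21 f1 f2 z1 z2 : R -> R) :=
  [/\ antider z1 (fun y => a11 y * z1 y + a12 y * z2 y + f1 y),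
      antider z2 (fun y => a21 y * z1 y - a11 y * z2 y + f2 y),
      (forall y, z1 (- y) = z1 y) & (forall y, z2 (- y) = - z2 y)].

(** Bound for the inverse of the linearisation between spaces weighted by [exp (mu y)]. The first
    summand comes from the coordinate [p] along the frame, the second from the transversal
    coordinate [q], for which [|q|] has the constant [2 K / kappa]. *)
Definition frame_rate (kappa K c mu : R) : R :=
  (4 * K * (2 * K / kappa) / c + 2 * K / c) / (kappa - mu) * K +
  2 * K / kappa * K / c.

Section Frame.
Variables (phi1 phi2 a11 a12 a21 : R -> R) (kappa K c : R).
Hypothesis F : decaying_frame phi1 phi2 a11 a12 a21 kappa K c.
Local Notation Delta y := (phi1 y ^+ 2 + phi2 y ^+ 2).
Local Notation coupling y :=
  ((- 4 * a11 y * phi1 y * phi2 y +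
    (a12 y + a21 y) * (phi1 y ^+ 2 - phi2 y ^+ 2)) / Delta y ^+ 2).

Lemma frame_gt0 y : 0 < Delta y.
Proof.
have key t : 0 <= t -> 0 < Delta t.
  move=> t0; apply: lt_le_trans (frame_lb F t0).
  by rewrite mulr_gt0 ?expR_gt0 // (frame_c F).
have [|/ltW] := leP 0 y; first exact: key.
rewrite -oppr_ge0 => /key.
by rewrite (frame_odd F) (frame_even F) sqrrN.
Qed.

(** In the coordinates [z = p phi + q J phi / Delta], with [J] the quarter turn, the system is
    triangular. The derivative of [q] decays at the rate [kappa + mu], so [q] is controlled from
    infinity. Division by [Delta] lets the derivative of [p] grow at the rate [kappa - mu], so [p]
    is controlled from 0; the factor [phi] brings [p phi] back to the decay rate [mu]. *)
Lemma frame_coordinates_bound (f1 f2 p q : R -> R) (mu d : R) :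
  0 < mu -> mu < kappa ->
  antider q (fun y => phi1 y * f2 y - phi2 y * f1 y) ->
  antider p (fun y => coupling y * q y +
    (phi1 y * f1 y + phi2 y * f2 y) / Delta y) ->
  p 0 = 0 -> elim_at q 0 ->
  (forall y, 0 <= y -> `|f1 y| <= d * expR (- (mu * y)) /\
                       `|f2 y| <= d * expR (- (mu * y))) ->
  forall y, 0 <= y ->
    `|p y * phi1 y - q y * phi2 y / Delta y| <=
       frame_rate kappa K c mu * d * expR (- (mu * y)) /\
    `|p y * phi2 y + q y * phi1 y / Delta y| <=
       frame_rate kappa K c mu * d * expR (- (mu * y)).
Proof.
move=> mu0 muk dq dp p0 q0 fb.
have k0 := frame_kappa F; have K0 := frame_K F; have c0 := frame_c F.
have d0 : 0 <= d.
  have [] := fb 0 (lexx _); rewrite mulr0 oppr0 expR0 mulr1 => + _.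
  exact: le_trans.
have K0' := ltW K0; have c0' := ltW c0.
set Q := 2 * K / kappa.
have Q0 : 0 < Q by rewrite /Q divr_gt0 // mulr_gt0.
have Q0' := ltW Q0.
have fb' y : 0 <= y ->
    (`|phi1 y| * `|f2 y| <= K * d * expR (- ((kappa + mu) * y)) /\
     `|phi2 y| * `|f1 y| <= K * d * expR (- ((kappa + mu) * y))) /\
    (`|phi1 y| * `|f1 y| <= K * d * expR (- ((kappa + mu) * y)) /\
     `|phi2 y| * `|f2 y| <= K * d * expR (- ((kappa + mu) * y))).
  move=> y0; have [a1 a2] := frame_ub F y0; have [b1 b2] := fb y y0.
  have -> : - ((kappa + mu) * y) = - (kappa * y) + - (mu * y) by ring.
  rewrite expRD.
  have -> : K * d * (expR (- (kappa * y)) * expR (- (mu * y))) =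
    (K * expR (- (kappa * y))) * (d * expR (- (mu * y))) by ring.
  by split; split; apply: ler_pM.
have qb y : 0 <= y -> `|q y| <= Q * d * expR (- ((kappa + mu) * y)).
  move=> y0.
  have km : 0 < kappa + mu by rewrite addr_gt0.
  have := @tail_bound R q _ (2 * K * d) (kappa + mu) 0 km dq _ q0 y y0.
  rewrite subr0 => /(_ _)/le_trans; apply.
    move=> t t0; have [[h1 h2] _] := fb' t t0.
    apply: (le_trans (ler_normB _ _)); rewrite !normrM; lra.
  rewrite ler_wpM2r ?expR_ge0 // /Q mulrAC ler_wpM2r // ler_wpM2l ?mulr_ge0 ?(ltW K0) //.
  by rewrite lef_pV2 ?posrE // lerDl ltW.
have Dinv y : 0 <= y -> (Delta y)^-1 <= c^-1 * expR (2 * kappa * y).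
  move=> y0; have Dp := frame_gt0 y.
  rewrite -[expR _]invrK -expRN -invfM lef_pV2 ?posrE //.
    exact: (frame_lb F y0).
  by rewrite mulr_gt0 ?expR_gt0.
(* Both [2 |phi1 phi2|] and [|phi1^2 - phi2^2|] are at most [Delta], so one power of [Delta]
   cancels. *)
have cb y : 0 <= y -> `|coupling y| <= 4 * K * (c^-1 * expR (2 * kappa * y)).
  move=> y0; have Dp := frame_gt0 y; have [h1 h2 h3] := frame_ab F y0.
  apply: (@le_trans _ _ (4 * K * (Delta y)^-1)); last first.
    by rewrite ler_wpM2l ?Dinv ?mulr_ge0 ?(ltW K0).
  rewrite normrM normfV (ger0_norm (_ : 0 <= Delta y ^+ 2)) ?exprn_ge0 ?(ltW Dp) //.
  have -> : 4 * K * (Delta y)^-1 = (4 * K * Delta y) / Delta y ^+ 2.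
    by field; rewrite gt_eqF.
  rewrite ler_wpM2r ?invr_ge0 ?exprn_ge0 ?(ltW Dp) //.
  apply: (le_trans (ler_normD _ _)).
  have -> : - 4 * a11 y * phi1 y * phi2 y = (- 2 * a11 y) * (2 * phi1 y * phi2 y) by ring.
  have -> : 4 * K * Delta y = (2 * K) * Delta y + (2 * K) * Delta y by ring.
  apply: lerD; rewrite normrM; apply: ler_pM => //.
  - by rewrite normrM normrN (ger0_norm (_ : 0 <= 2 :> R)) // ler_wpM2l.
  - rewrite ler_norml; have := sqr_ge0 (phi1 y + phi2 y).
    have := sqr_ge0 (phi1 y - phi2 y); lra.
  - by rewrite (le_trans (ler_normD _ _)) // mulr_natl mulr2n lerD.
  - rewrite ler_norml; have := sqr_ge0 (phi1 y); have := sqr_ge0 (phi2 y); lra.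
have eE y : expR (2 * kappa * y) * expR (- ((kappa + mu) * y)) = expR ((kappa - mu) * y).
  by rewrite -expRD; congr expR; ring.
set P := (4 * K * Q / c + 2 * K / c) / (kappa - mu).
have km : 0 < kappa - mu by rewrite subr_gt0.
have P0 : 0 <= P.
  apply: divr_ge0; last exact: ltW.
  apply: addr_ge0; apply: divr_ge0 => //; last exact: mulr_ge0.
  by apply: mulr_ge0 => //; exact: mulr_ge0.
have pb y : 0 <= y -> `|p y| <= P * d * expR ((kappa - mu) * y).
  move=> y0; rewrite /P [_ / (kappa - mu) * d]mulrAC.
  apply: (growth_bound km dp p0) => // t t0.
  have [_ [h1 h2]] := fb' t t0.
  apply: (le_trans (ler_normD _ _)).
  have -> : (4 * K * Q / c + 2 * K / c) * d * expR ((kappa - mu) * t) =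
    4 * K * (c^-1 * expR (2 * kappa * t)) * (Q * d * expR (- ((kappa + mu) * t))) +
    (2 * (K * d * expR (- ((kappa + mu) * t)))) * (c^-1 * expR (2 * kappa * t)).
    by rewrite -eE; ring.
  apply: lerD; rewrite normrM; apply: ler_pM => //.
  - exact: cb.
  - exact: qb.
  - by apply: (le_trans (ler_normD _ _)); rewrite !normrM; lra.
  - by rewrite normfV ger0_norm ?Dinv // ltW // frame_gt0.
have fin (phi : R -> R) y : 0 <= y -> `|phi y| <= K * expR (- (kappa * y)) ->
   `|p y * phi y| <= P * K * d * expR (- (mu * y)).
  move=> y0 h; rewrite normrM.
  have -> : P * K * d * expR (- (mu * y)) =
    (P * d * expR ((kappa - mu) * y)) * (K * expR (- (kappa * y))).
    have -> : - (mu * y) = (kappa - mu) * y + - (kappa * y) by ring.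
    by rewrite expRD; ring.
  by apply: ler_pM => //; exact: pb.
have fin2 (phi : R -> R) y : 0 <= y -> `|phi y| <= K * expR (- (kappa * y)) ->
   `|q y * phi y / Delta y| <= Q * K / c * d * expR (- (mu * y)).
  move=> y0 h; rewrite !normrM.
  have -> : Q * K / c * d * expR (- (mu * y)) =
    (Q * d * expR (- ((kappa + mu) * y))) * (K * expR (- (kappa * y))) * (c^-1 * expR (2 * kappa * y)).
    have -> : - (mu * y) = - ((kappa + mu) * y) + - (kappa * y) + 2 * kappa * y by ring.
    by rewrite !expRD; ring.
  apply: ler_pM; rewrite ?mulr_ge0 //; first by apply: ler_pM => //; exact: qb.
  by rewrite normfV ger0_norm ?Dinv // ltW // frame_gt0.
move=> y y0; have [u1 u2] := frame_ub F y0.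
have -> : frame_rate kappa K c mu * d * expR (- (mu * y)) =
  P * K * d * expR (- (mu * y)) + Q * K / c * d * expR (- (mu * y)).
  by rewrite /frame_rate -/Q -/P; ring.
split.
  by apply: (le_trans (ler_normB _ _)); apply: lerD; [exact: fin | exact: fin2].
by apply: (le_trans (ler_normD _ _)); apply: lerD; [exact: fin | exact: fin2].
Qed.

Lemma frame_dDelta : antider (fun y => Delta y) (fun y =>
  2 * a11 y * (phi1 y ^+ 2 - phi2 y ^+ 2) + 2 * (a12 y + a21 y) * phi1 y * phi2 y).
Proof.
have d1 := frame_d1 F; have d2 := frame_d2 F.
by eapply antider_eq; [der | move=> y /=; ring].
Qed.

(** The bound [D] does not reach the conclusion: it only makes [q] tend to 0. With [d = 0] the
    statement says that no nonzero bounded solution of the homogeneous system has this parity. *)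
Lemma linear_solution_bound (f1 f2 z1 z2 : R -> R) (mu d D : R) :
  0 < mu -> mu < kappa -> linear_solution a11 a12 a21 f1 f2 z1 z2 ->
  (forall y, 0 <= y -> `|z1 y| <= D /\ `|z2 y| <= D) ->
  (forall y, 0 <= y -> `|f1 y| <= d * expR (- (mu * y)) /\
                       `|f2 y| <= d * expR (- (mu * y))) ->
  forall y, 0 <= y ->
    `|z1 y| <= frame_rate kappa K c mu * d * expR (- (mu * y)) /\
    `|z2 y| <= frame_rate kappa K c mu * d * expR (- (mu * y)).
Proof.
move=> mu0 muk [dz1 dz2 ez1 oz2] zb fb.
have d1 := frame_d1 F; have d2 := frame_d2 F.
have Dn y : Delta y != 0 by rewrite gt_eqF // frame_gt0.
pose q y := phi1 y * z2 y - phi2 y * z1 y.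
pose p y := (phi1 y * z1 y + phi2 y * z2 y) * (Delta y)^-1.
have dq : antider q (fun y => phi1 y * f2 y - phi2 y * f1 y).
  by eapply antider_eq; [rewrite /q; der | move=> y /=; ring].
have dV := antiderV Dn frame_dDelta.
have dp : antider p (fun y => coupling y * q y +
    (phi1 y * f1 y + phi2 y * f2 y) / Delta y).
  eapply antider_eq; [rewrite /p; der | move=> y /=; rewrite /q; field; exact: Dn].
(* At 0 parity annihilates [phi1] and [z2], one factor in each product. *)
have p0 : p 0 = 0.
  have odd0 (t : R) : t = - t -> t = 0 by move=> ?; lra.
  have := frame_odd F 0; have := oz2 0; rewrite oppr0 /p => /odd0 -> /odd0 ->.
  by rewrite mul0r mulr0 addr0 mul0r.
have q0 : elim_at q 0.
  exists kappa, (2 * (K * D)); split; first exact: frame_kappa F.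
  move=> y y0; have [u1 u2] := frame_ub F y0; have [b1 b2] := zb y y0.
  rewrite subr0; apply: (le_trans (ler_normB _ _)); rewrite !normrM.
  have -> : 2 * (K * D) * expR (- (kappa * y)) =
    (K * expR (- (kappa * y))) * D + (K * expR (- (kappa * y))) * D by ring.
  by apply: lerD; apply: ler_pM.
move=> y y0; have := frame_coordinates_bound mu0 muk dq dp p0 q0 fb y0.
have -> : p y * phi1 y - q y * phi2 y / Delta y = z1 y.
  by rewrite /p /q; field; exact: Dn.
have -> // : p y * phi2 y + q y * phi1 y / Delta y = z2 y.
by rewrite /p /q; field; exact: Dn.
Qed.

Lemma prim_odd_even (f : R -> R) : continuous f -> (forall y, f (- y) = - f y) ->
  forall y, prim f (- y) = prim f y.
Proof.
move=> cf ff y.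
have df := prim_antider cf.
have d : antider (fun y => prim f (- y)) f.
  have id : antider (fun y : R => - y) (fun=> - 1) by der.
  apply: antider_eq (antider_comp id df) _ => x /=; rewrite ff; ring.
by have := antider_uniq d df y 0; rewrite oppr0; lra.
Qed.

Lemma prim_even_odd (f : R -> R) : continuous f -> (forall y, f (- y) = f y) ->
  forall y, prim f (- y) = - prim f y.
Proof.
move=> cf ff y.
have df := prim_antider cf.
have d : antider (fun y => - prim f (- y)) f.
  have id : antider (fun y : R => - y) (fun=> - 1) by der.
  by apply: antider_eq (antiderN (antider_comp id df)) _ => x /=; rewrite ff; ring.
by have := antider_uniq d df y 0; rewrite oppr0 prim0 //; lra.
Qed.

(** Variation of constants with [q] integrated from infinity and [p] from 0. This makes [q] even and
    [p] odd, and with the parities of the frame it gives [z1] even and [z2] odd. *)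
Lemma linear_solution_exists (f1 f2 : R -> R) (mu d : R) : 0 < mu -> mu < kappa ->
  continuous f1 -> continuous f2 ->
  (forall y, f1 (- y) = - f1 y) -> (forall y, f2 (- y) = f2 y) ->
  (forall y, 0 <= y -> `|f1 y| <= d * expR (- (mu * y)) /\
                       `|f2 y| <= d * expR (- (mu * y))) ->
  exists z1 z2, linear_solution a11 a12 a21 f1 f2 z1 z2 /\
    forall y, 0 <= y ->
      `|z1 y| <= frame_rate kappa K c mu * d * expR (- (mu * y)) /\
      `|z2 y| <= frame_rate kappa K c mu * d * expR (- (mu * y)).
Proof.
move=> mu0 muk cf1 cf2 of1 ef2 fb.
have k0 := frame_kappa F; have K0 := frame_K F.
have d1 := frame_d1 F; have d2 := frame_d2 F.
have o1 := frame_odd F; have e2 := frame_even F.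
have c1 := antider_continuous d1; have c2 := antider_continuous d2.
have ca11 := frame_ca11 F; have ca12 := frame_ca12 F; have ca21 := frame_ca21 F.
have Dn y : Delta y != 0 by rewrite gt_eqF // frame_gt0.
have cq : continuous (fun y => phi1 y * f2 y - phi2 y * f1 y) by cont.
have dq := prim_antider cq; set q0 := prim _ in dq.
have [L HL] : exists L, elim_at q0 L.
  have km : 0 < kappa + mu by rewrite addr_gt0.
  have [|L HL] := @tail_limit R q0 _ (2 * K * d) _ km dq; last first.
    by exists L, (kappa + mu), (2 * K * d / (kappa + mu)).
  move=> t t0; have [a1 a2] := frame_ub F t0; have [b1 b2] := fb t t0.
  apply: (le_trans (ler_normB _ _)); rewrite !normrM.
  have -> : 2 * K * d * expR (- ((kappa + mu) * t)) =
    (K * expR (- (kappa * t))) * (d * expR (- (mu * t))) +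
    (K * expR (- (kappa * t))) * (d * expR (- (mu * t))).
    have -> : - ((kappa + mu) * t) = - (kappa * t) + - (mu * t) by ring.
    by rewrite expRD; ring.
  by apply: lerD; apply: ler_pM.
(* Subtracting the limit amounts to integrating from infinity. *)
pose q y := q0 y - L.
have dq' : antider q (fun y => phi1 y * f2 y - phi2 y * f1 y).
  by eapply antider_eq; [rewrite /q; der | move=> y /=; ring].
have lq : elim_at q 0.
  by rewrite -(subrr L); exact: elim_at_add HL (elim_at_cst (- L)).
have qe y : q (- y) = q y.
  rewrite /q /q0 prim_odd_even // => t; rewrite o1 e2 of1 ef2; ring.
have cq' := antider_continuous dq'.
have cDV : continuous (fun y => (Delta y)^-1) by apply: cont_inv Dn _; cont.
have cp : continuous (fun y => coupling y * q y +
    (phi1 y * f1 y + phi2 y * f2 y) / Delta y).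
  have e y : coupling y = (- 4 * a11 y * phi1 y * phi2 y +
    (a12 y + a21 y) * (phi1 y ^+ 2 - phi2 y ^+ 2)) * (Delta y)^-1 ^+ 2.
    by rewrite exprVn.
  rewrite (_ : (fun y => _) = fun y => (- 4 * a11 y * phi1 y * phi2 y +
    (a12 y + a21 y) * (phi1 y ^+ 2 - phi2 y ^+ 2)) * (Delta y)^-1 ^+ 2 * q y +
    (phi1 y * f1 y + phi2 y * f2 y) * (Delta y)^-1); last first.
    by apply/funext => y; rewrite e.
  by cont.
have dp := prim_antider cp; have p0 := prim0 cp.
have po : forall y, prim (fun y => coupling y * q y +
    (phi1 y * f1 y + phi2 y * f2 y) / Delta y) (- y) = - prim (fun y => coupling y * q y +
    (phi1 y * f1 y + phi2 y * f2 y) / Delta y) y.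
  apply: (prim_even_odd cp) => y.
  rewrite qe !o1 !e2 of1 ef2 (frame_a11 F) (frame_a12 F) (frame_a21 F) !sqrrN.
  by congr (_ / _ * _ + _ / _); ring.
set p := prim _ in dp p0 po.
exists (fun y => p y * phi1 y - q y * phi2 y * (Delta y)^-1).
exists (fun y => p y * phi2 y + q y * phi1 y * (Delta y)^-1).
split; last exact: (frame_coordinates_bound mu0 muk dq' dp p0 lq fb).
have dV := antiderV Dn frame_dDelta.
split.
- by eapply antider_eq; [der | move=> y /=; field; exact: Dn].
- by eapply antider_eq; [der | move=> y /=; field; exact: Dn].
- by move=> y; rewrite po qe o1 e2 sqrrN; ring.
- by move=> y; rewrite po qe o1 e2 sqrrN; ring.
Qed.

End Frame.
End LinearTheory.

(** * Averaging *)

Section UniformLipschitz.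
Variable R : realType.
Implicit Types (f g : R -> R -> R -> R -> R).

(** The uniformity in [x] and in small [e] is essential, as [x = y / e] runs over the whole line.
    Since the property is closed under the algebraic operations, [ulip] derives it from the shape of
    an expression. *)
Definition unif_lipschitz (M : R) f := exists e1 B : R, [/\ 0 < e1, 0 <= B &
  forall e x u v u' v', 0 < e < e1 ->
    `|u| <= M -> `|v| <= M -> `|u'| <= M -> `|v'| <= M ->
    `|f e x u v| <= B /\
    `|f e x u v - f e x u' v'| <= B * (`|u - u'| + `|v - v'|)].

Variable M : R.

Lemma ulip_coef (a : R -> R) (B : R) : (forall x, `|a x| <= B) ->
  unif_lipschitz M (fun _ x _ _ => a x).
Proof.
move=> h; have B0 : 0 <= B by apply: le_trans (h 0).
exists 1, B; split=> // e x u v u' v' _ _ _ _ _; split; first exact: h.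
by rewrite subrr normr0 mulr_ge0 // addr_ge0.
Qed.

Lemma ulip_cst (k : R) : unif_lipschitz M (fun _ _ _ _ => k).
Proof. exact: (@ulip_coef (fun=> k) `|k|). Qed.

Lemma ulip_eps : unif_lipschitz M (fun e _ _ _ => e).
Proof.
exists 1, 1; split=> // e x u v u' v' /andP[e0 e1] _ _ _ _; split.
  by rewrite gtr0_norm // ltW.
by rewrite subrr normr0 mulr_ge0 // addr_ge0.
Qed.

Lemma ulip_u : 0 <= M -> unif_lipschitz M (fun _ _ u _ => u).
Proof.
move=> M0; exists 1, (M + 1); split=> //; first by rewrite addr_ge0.
move=> e x u v u' v' _ hu hv hu' hv'; split; first by rewrite (le_trans hu) // lerDl.
rewrite -[leLHS]mul1r; apply: ler_pM => //; last by rewrite lerDl.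
by rewrite lerDr.
Qed.

Lemma ulip_v : 0 <= M -> unif_lipschitz M (fun _ _ _ v => v).
Proof.
move=> M0; exists 1, (M + 1); split=> //; first by rewrite addr_ge0.
move=> e x u v u' v' _ hu hv hu' hv'; split; first by rewrite (le_trans hv) // lerDl.
rewrite -[leLHS]mul1r; apply: ler_pM => //; last by rewrite lerDr.
by rewrite lerDr.
Qed.

Lemma ulip_add f g : unif_lipschitz M f -> unif_lipschitz M g ->
  unif_lipschitz M (fun e x u v => f e x u v + g e x u v).
Proof.
move=> [e1 [B1 [e10 B10 h1]]] [e2 [B2 [e20 B20 h2]]].
exists (Num.min e1 e2), (B1 + B2); split; first by rewrite lt_min e10.
  exact: addr_ge0.
move=> e x u v u' v' /andP[e0]; rewrite lt_min => /andP[he1 he2] hu hv hu' hv'.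
have he1' : 0 < e < e1 by rewrite e0.
have he2' : 0 < e < e2 by rewrite e0.
have [b1 l1] := h1 e x u v u' v' he1' hu hv hu' hv'.
have [b2 l2] := h2 e x u v u' v' he2' hu hv hu' hv'.
split; first by apply: (le_trans (ler_normD _ _)); exact: lerD.
have -> : f e x u v + g e x u v - (f e x u' v' + g e x u' v') =
  (f e x u v - f e x u' v') + (g e x u v - g e x u' v') by ring.
by apply: (le_trans (ler_normD _ _)); rewrite [leRHS]mulrDl; exact: lerD.
Qed.

Lemma ulip_opp f : unif_lipschitz M f -> unif_lipschitz M (fun e x u v => - f e x u v).
Proof.
move=> [e1 [B1 [e10 B10 h1]]]; exists e1, B1; split=> // e x u v u' v' he hu hv hu' hv'.
have [b l] := h1 e x u v u' v' he hu hv hu' hv'.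
by rewrite normrN -opprD normrN.
Qed.

Lemma ulip_mul f g : unif_lipschitz M f -> unif_lipschitz M g ->
  unif_lipschitz M (fun e x u v => f e x u v * g e x u v).
Proof.
move=> [e1 [B1 [e10 B10 h1]]] [e2 [B2 [e20 B20 h2]]].
have B12 : 0 <= B1 * B2 by exact: mulr_ge0.
exists (Num.min e1 e2), (B1 * B2 + B1 * B2); split; first by rewrite lt_min e10.
  exact: addr_ge0.
move=> e x u v u' v' /andP[e0]; rewrite lt_min => /andP[he1 he2] hu hv hu' hv'.
have he1' : 0 < e < e1 by rewrite e0.
have he2' : 0 < e < e2 by rewrite e0.
have [b1 l1] := h1 e x u v u' v' he1' hu hv hu' hv'.
have [b2 l2] := h2 e x u v u' v' he2' hu hv hu' hv'.
have [b1' _] := h1 e x u' v' u' v' he1' hu' hv' hu' hv'.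
split; first by rewrite normrM (le_trans (ler_pM _ _ b1 b2)) // lerDl.
set L := `|u - u'| + `|v - v'| in l1 l2 *.
have -> : f e x u v * g e x u v - f e x u' v' * g e x u' v' =
  (f e x u v - f e x u' v') * g e x u v + f e x u' v' * (g e x u v - g e x u' v') by ring.
have -> : (B1 * B2 + B1 * B2) * L = (B1 * L) * B2 + B1 * (B2 * L) by ring.
by apply: (le_trans (ler_normD _ _)); apply: lerD; rewrite normrM; apply: ler_pM.
Qed.

Lemma ulip_exp f k : unif_lipschitz M f -> unif_lipschitz M (fun e x u v => f e x u v ^+ k).
Proof.
move=> hf; elim: k => [|k IH]; first exact: ulip_cst.
rewrite (_ : (fun e x u v => f e x u v ^+ k.+1) =
  fun e x u v => f e x u v * f e x u v ^+ k); first exact: ulip_mul.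
by do 4!apply/funext => ?; rewrite exprS.
Qed.

Lemma unif_near_one f : unif_lipschitz M f -> exists2 e1 : R, 0 < e1 &
  forall e x u v, 0 < e < e1 -> `|u| <= M -> `|v| <= M -> 2^-1 <= 1 + e * f e x u v.
Proof.
move=> [e1 [B1 [e10 B10 h1]]].
have hB : 0 < (2 * (B1 + 1))^-1 by rewrite invr_gt0 mulr_gt0 //; lra.
exists (Num.min e1 (2 * (B1 + 1))^-1); first by rewrite lt_min e10.
move=> e x u v /andP[e0]; rewrite lt_min => /andP[he1 he2] hu hv.
have he1' : 0 < e < e1 by rewrite e0.
have [b _] := h1 e x u v u v he1' hu hv hu hv.
have : `|e * f e x u v| <= 2^-1.
  rewrite normrM gtr0_norm //; apply: (@le_trans _ _ ((2 * (B1 + 1))^-1 * (B1 + 1))).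
    by apply: ler_pM; rewrite ?(ltW e0) ?(ltW he2) // (le_trans b) // lerDl.
  by rewrite le_eqVlt; apply/orP; left; apply/eqP; field; rewrite gt_eqF //; lra.
rewrite ler_norml => /andP[]; lra.
Qed.

(** For small [e] the denominators are at least 1/2, so inverses are at most 2 and their difference
    costs a factor 4. *)
Lemma ulip_inv f : unif_lipschitz M f ->
  unif_lipschitz M (fun e x u v => (1 + e * f e x u v)^-1).
Proof.
move=> hf; have [e1 e10 h1] := unif_near_one hf.
have [e2 [B2 [e20 B20 h2]]] := hf.
exists (Num.min (Num.min e1 e2) 1), (2 + 4 * B2); split.
- by rewrite !lt_min e10 e20 ltr01.
- by rewrite addr_ge0 // mulr_ge0.
move=> e x u v u' v' /andP[e0]; rewrite !lt_min => /andP[/andP[he1 he2] he3] hu hv hu' hv'.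
have he1' : 0 < e < e1 by rewrite e0.
have he2' : 0 < e < e2 by rewrite e0.
have [_ l2] := h2 e x u v u' v' he2' hu hv hu' hv'.
have a := h1 e x u v he1' hu hv; have a' := h1 e x u' v' he1' hu' hv'.
have inv_bound (t : R) : 2^-1 <= t -> `|t^-1| <= 2.
  move=> ht; have t0 : 0 < t by apply: lt_le_trans ht; rewrite invr_gt0.
  by rewrite gtr0_norm ?invr_gt0 // -[leRHS]invrK lef_pV2 // posrE invr_gt0.
have i1 := inv_bound _ a; have i2 := inv_bound _ a'.
have nz (t : R) : 2^-1 <= t -> t != 0.
  by move=> ht; rewrite gt_eqF //; apply: lt_le_trans ht; rewrite invr_gt0.
split; first by rewrite (le_trans i1) // lerDl mulr_ge0.
have -> : (1 + e * f e x u v)^-1 - (1 + e * f e x u' v')^-1 =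
  - (e * (f e x u v - f e x u' v')) * ((1 + e * f e x u v)^-1 * (1 + e * f e x u' v')^-1).
  by field; rewrite (nz _ a) (nz _ a').
set L := `|u - u'| + `|v - v'| in l2 *; have L0 : 0 <= L by rewrite addr_ge0.
apply: (@le_trans _ _ ((B2 * L) * (2 * 2))); last by rewrite mulrDl; have := mulr_ge0 B20 L0; lra.
rewrite normrM normrN; apply: ler_pM => //.
  by rewrite normrM gtr0_norm // -[leRHS]mul1r; apply: ler_pM; rewrite // ltW.
by rewrite normrM; apply: ler_pM.
Qed.

End UniformLipschitz.

Ltac ulip :=
  repeat first
    [ eassumption | exact: ulip_cst | exact: ulip_eps | exact: ulip_u | exact: ulip_v
    | apply: ulip_add | apply: ulip_opp | apply: ulip_mul | apply: ulip_exp
    | apply: ulip_inv ].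

(** * The near-identity change of variables *)

Section Averaging.
Variable R : realType.

(** The fast profiles are kept abstract, so that the averaging identities become rational identities
    in opaque symbols. [fs], [fc] stand for the sine and cosine of half the frequency; the [fA]
    serve the linear terms, the [fK] the quartic monomials in [fs], [fc] created by the cubic
    term. *)
Record fast_data := FastData {
  fn : R; fOm : R; fsig : R; fwn : R;
  fs : R -> R; fc : R -> R; fW : R -> R;
  fA1 : R -> R; fA2 : R -> R; fA3 : R -> R;
  fK1 : R -> R; fK2 : R -> R; fK3 : R -> R; fK4 : R -> R; fK5 : R -> R }.

Implicit Types k : fast_data.
Implicit Types (e x u v y : R).

(* The exact slow field is (slow1, slow2); its mean over the fast variable x is
   (mean1, mean2); (corr1, corr2) is an x-antiderivative of the difference. *)
Definition carrier k x u v := u * fc k x - v * fs k x.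
(** Since [U = 2 sqrt(e) g] with [g] the carrier, the factors 2 and 8 come from [U] and [U^3]. *)
Definition forcing k x g := 2 * (fOm k + fW k x) * g - 8 * fsig k * g ^+ 3.
Definition slow1 k x u v := fs k x * forcing k x (carrier k x u v) / fn k.
Definition slow2 k x u v := fc k x * forcing k x (carrier k x u v) / fn k.
(** The means 3/8 of [fs^4], [fc^4] and 1/8 of [fs^2 fc^2] turn [8 fsig] into [3 fsig]; the
    potential contributes its mean [fwn] against the cosine of the full frequency. *)
Definition mean1 k u v :=
  (fwn k - fOm k + 3 * fsig k * (u ^+ 2 + v ^+ 2)) * v / fn k.
Definition mean2 k u v :=
  (fwn k + fOm k - 3 * fsig k * (u ^+ 2 + v ^+ 2)) * u / fn k.
Definition corr1 k x u v := (fA1 k x * u + fA2 k x * v - 8 * fsig k *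
  (fK1 k x * u ^+ 3 - 3 * fK2 k x * u ^+ 2 * v + 3 * fK3 k x * u * v ^+ 2 -
   fK4 k x * v ^+ 3)) / fn k.
Definition corr2 k x u v := (fA3 k x * u - fA1 k x * v - 8 * fsig k *
  (fK5 k x * u ^+ 3 - 3 * fK1 k x * u ^+ 2 * v + 3 * fK2 k x * u * v ^+ 2 -
   fK3 k x * v ^+ 3)) / fn k.
(** Here begin the four entries of the Jacobian of [(corr1, corr2)] in [(u, v)]. *)
Definition corr1u k x u v := (fA1 k x - 8 * fsig k *
  (3 * fK1 k x * u ^+ 2 - 6 * fK2 k x * u * v + 3 * fK3 k x * v ^+ 2)) / fn k.
Definition corr1v k x u v := (fA2 k x - 8 * fsig k *
  (- 3 * fK2 k x * u ^+ 2 + 6 * fK3 k x * u * v - 3 * fK4 k x * v ^+ 2)) / fn k.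
Definition corr2u k x u v := (fA3 k x - 8 * fsig k *
  (3 * fK5 k x * u ^+ 2 - 6 * fK1 k x * u * v + 3 * fK2 k x * v ^+ 2)) / fn k.
Definition corr2v k x u v := (- fA1 k x - 8 * fsig k *
  (- 3 * fK1 k x * u ^+ 2 + 6 * fK2 k x * u * v - 3 * fK3 k x * v ^+ 2)) / fn k.

(* With z = w + e corr(w), the remainder (rem1, rem2) is the one for which
   w' = mean(w) + e rem(w) is equivalent to z' = slow(z). *)
Definition dforcing k e x u v :=
  let g := carrier k x u v in
  let gp := carrier k x (corr1 k x u v) (corr2 k x u v) in
  let gz := g + e * gp in
  2 * (fOm k + fW k x) * gp - 8 * fsig k * gp * (gz ^+ 2 + gz * g + g ^+ 2).
Definition defect1 k e x u v := fs k x * dforcing k e x u v / fn k -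
  (corr1u k x u v * mean1 k u v + corr1v k x u v * mean2 k u v).
Definition defect2 k e x u v := fc k x * dforcing k e x u v / fn k -
  (corr2u k x u v * mean1 k u v + corr2v k x u v * mean2 k u v).
(** [1 + e ddet] is the determinant of the identity plus [e] times the Jacobian of the
    correction. *)
Definition ddet k e x u v := corr1u k x u v + corr2v k x u v +
  e * (corr1u k x u v * corr2v k x u v - corr1v k x u v * corr2u k x u v).
(** Cramer's rule: [(rem1, rem2)] solves the linear system with that Jacobian matrix and right side
    [(defect1, defect2)]. *)
Definition rem1 k e x u v :=
  ((1 + e * corr2v k x u v) * defect1 k e x u v - e * corr1v k x u v * defect2 k e x u v) *
  (1 + e * ddet k e x u v)^-1.
Definition rem2 k e x u v :=
  ((1 + e * corr1u k x u v) * defect2 k e x u v - e * corr2u k x u v * defect1 k e x u v) *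
  (1 + e * ddet k e x u v)^-1.

(** The constants subtracted from the derivatives are the means of the respective products; without
    them the antiderivatives could not be bounded on the line. *)
Record fast_spec k (nu B : R) : Prop := {
  fast_n : 0 < fn k;
  fast_cs : forall x, fc k x ^+ 2 + fs k x ^+ 2 = 1;
  fast_ds : antider (fs k) (fun x => nu / 2 * fc k x);
  fast_dc : antider (fc k) (fun x => - (nu / 2) * fs k x);
  fast_cW : continuous (fW k);
  fast_dA1 : antider (fA1 k) (fun x => 2 * (fOm k + fW k x) * fs k x * fc k x);
  fast_dA2 : antider (fA2 k) (fun x => - 2 * (fOm k + fW k x) * fs k x ^+ 2 - (fwn k - fOm k));
  fast_dA3 : antider (fA3 k) (fun x => 2 * (fOm k + fW k x) * fc k x ^+ 2 - (fwn k + fOm k));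
  fast_dK1 : antider (fK1 k) (fun x => fs k x * fc k x ^+ 3);
  fast_dK2 : antider (fK2 k) (fun x => fs k x ^+ 2 * fc k x ^+ 2 - 8^-1);
  fast_dK3 : antider (fK3 k) (fun x => fs k x ^+ 3 * fc k x);
  fast_dK4 : antider (fK4 k) (fun x => fs k x ^+ 4 - 3 / 8);
  fast_dK5 : antider (fK5 k) (fun x => fc k x ^+ 4 - 3 / 8);
  fast_bd : forall f, List.In f [:: fs k; fc k; fW k; fA1 k; fA2 k; fA3 k;
     fK1 k; fK2 k; fK3 k; fK4 k; fK5 k] -> forall x, `|f x| <= B;
  fast_even : forall f, List.In f [:: fc k; fW k; fA1 k; fK1 k; fK3 k] ->
     forall x, f (- x) = f x;
  fast_odd : forall f, List.In f [:: fs k; fA2 k; fA3 k; fK2 k; fK4 k; fK5 k] ->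
     forall x, f (- x) = - f x }.

Section Spec.
Variables (k : fast_data) (nu B : R).
Hypothesis S : fast_spec k nu B.

Let nn0 : fn k != 0. Proof. by rewrite gt_eqF // (fast_n S). Qed.

Ltac in_list := by rewrite /=; repeat first [by left | right].
Ltac use_bd := apply: (@ulip_coef _ _ _ B); apply: (fast_bd S); in_list.
Ltac ulip' := repeat first [progress ulip | use_bd].

Lemma rem_lipschitz M : 0 <= M ->
  [/\ unif_lipschitz M (rem1 k), unif_lipschitz M (rem2 k),
      unif_lipschitz M (fun _ x u v => corr1 k x u v),
      unif_lipschitz M (fun _ x u v => corr2 k x u v) &
      unif_lipschitz M (ddet k)].
Proof.
move=> M0.
have c1 : unif_lipschitz M (fun _ x u v => corr1 k x u v) by rewrite /corr1; ulip'.
have c2 : unif_lipschitz M (fun _ x u v => corr2 k x u v) by rewrite /corr2; ulip'.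
have c1u : unif_lipschitz M (fun _ x u v => corr1u k x u v) by rewrite /corr1u; ulip'.
have c1v : unif_lipschitz M (fun _ x u v => corr1v k x u v) by rewrite /corr1v; ulip'.
have c2u : unif_lipschitz M (fun _ x u v => corr2u k x u v) by rewrite /corr2u; ulip'.
have c2v : unif_lipschitz M (fun _ x u v => corr2v k x u v) by rewrite /corr2v; ulip'.
have m1 : unif_lipschitz M (fun _ x u v => mean1 k u v) by rewrite /mean1; ulip'.
have m2 : unif_lipschitz M (fun _ x u v => mean2 k u v) by rewrite /mean2; ulip'.
have df : unif_lipschitz M (dforcing k) by rewrite /dforcing /carrier; ulip'.
have d1 : unif_lipschitz M (defect1 k) by rewrite /defect1; ulip'.
have d2 : unif_lipschitz M (defect2 k) by rewrite /defect2; ulip'.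
have dd : unif_lipschitz M (ddet k) by rewrite /ddet; ulip'.
by split=> //; [rewrite /rem1 | rewrite /rem2]; ulip'.
Qed.

(** Combined with the Lipschitz bound, this makes the remainder along the orbit decay as fast as the
    orbit itself. *)
Lemma rem_zero e x : rem1 k e x 0 0 = 0 /\ rem2 k e x 0 0 = 0.
Proof.
have d1 : dforcing k e x 0 0 = 0.
  by rewrite /dforcing /carrier /corr1 /corr2; ring.
by split; rewrite /rem1 /rem2 /defect1 /defect2 d1 /mean1 /mean2; ring.
Qed.

Lemma corr_parity x u v : corr1 k (- x) u (- v) = corr1 k x u v /\
  corr2 k (- x) u (- v) = - corr2 k x u v.
Proof.
have ev f h := fast_even S (f := f) h; have od f h := fast_odd S (f := f) h.
rewrite /corr1 /corr2 !(ev (fA1 k)) ?(ev (fK1 k)) ?(ev (fK3 k)) ?(od (fA2 k))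
  ?(od (fA3 k)) ?(od (fK2 k)) ?(od (fK4 k)) ?(od (fK5 k)); try in_list.
by split; ring.
Qed.

(** The reversibility [(x, u, v) -> (-x, u, -v)] survives the change of variables, so the fixed
    point problem can be posed among even [u] and odd [v]. *)
Lemma rem_parity e x u v : rem1 k e (- x) u (- v) = - rem1 k e x u v /\
  rem2 k e (- x) u (- v) = rem2 k e x u v.
Proof.
have ev f h := fast_even S (f := f) h; have od f h := fast_odd S (f := f) h.
have [p1 p2] := corr_parity x u v.
have Es : fs k (- x) = - fs k x by apply: od; in_list.
have Ec : fc k (- x) = fc k x by apply: ev; in_list.
have EW : fW k (- x) = fW k x by apply: ev; in_list.
have df : dforcing k e (- x) u (- v) = dforcing k e x u v.
  by rewrite /dforcing /= p1 p2 /carrier Es Ec EW; ring.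
have [d1 [d2 [d3 d4]]] : corr1u k (- x) u (- v) = corr1u k x u v /\
  corr1v k (- x) u (- v) = - corr1v k x u v /\
  corr2u k (- x) u (- v) = - corr2u k x u v /\
  corr2v k (- x) u (- v) = corr2v k x u v.
  rewrite /corr1u /corr1v /corr2u /corr2v !(ev (fA1 k)) ?(ev (fK1 k)) ?(ev (fK3 k)) ?(od (fA2 k))
    ?(od (fA3 k)) ?(od (fK2 k)) ?(od (fK4 k)) ?(od (fK5 k)); try in_list.
  by split; [|split; [|split]]; ring.
have m1 : mean1 k u (- v) = - mean1 k u v by rewrite /mean1; ring.
have m2 : mean2 k u (- v) = mean2 k u v by rewrite /mean2; ring.
have dd : ddet k e (- x) u (- v) = ddet k e x u v by rewrite /ddet d1 d2 d3 d4; ring.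
have e1 : defect1 k e (- x) u (- v) = - defect1 k e x u v.
  by rewrite /defect1 df d1 d2 m1 m2 Es; ring.
have e2 : defect2 k e (- x) u (- v) = defect2 k e x u v.
  by rewrite /defect2 df d3 d4 m1 m2 Ec; ring.
by split; rewrite /rem1 /rem2 dd e1 e2 ?d1 ?d2 ?d3 ?d4; ring.
Qed.

Lemma corr_zero x : corr1 k x 0 0 = 0 /\ corr2 k x 0 0 = 0.
Proof. by split; rewrite /corr1 /corr2; ring. Qed.

Lemma rem_continuous e (w1 w2 : R -> R) : continuous w1 -> continuous w2 ->
  (forall y, 1 + e * ddet k e (y / e) (w1 y) (w2 y) != 0) ->
  continuous (fun y => rem1 k e (y / e) (w1 y) (w2 y)) /\
  continuous (fun y => rem2 k e (y / e) (w1 y) (w2 y)).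
Proof.
move=> cw1 cw2 det0.
have sc (f : R -> R) : continuous f -> continuous (fun y => f (y / e)).
  by move=> cf; apply: (cont_comp (f := fun y => y / e)) => //; cont.
have := sc _ (fast_cW S).
have := sc _ (antider_continuous (fast_ds S)).
have := sc _ (antider_continuous (fast_dc S)).
have := sc _ (antider_continuous (fast_dA1 S)).
have := sc _ (antider_continuous (fast_dA2 S)).
have := sc _ (antider_continuous (fast_dA3 S)).
have := sc _ (antider_continuous (fast_dK1 S)).
have := sc _ (antider_continuous (fast_dK2 S)).
have := sc _ (antider_continuous (fast_dK3 S)).
have := sc _ (antider_continuous (fast_dK4 S)).
have := sc _ (antider_continuous (fast_dK5 S)).
move=> h1 h2 h3 h4 h5 h6 h7 h8 h9 h10 h11.
have c1 : continuous (fun y => corr1 k (y / e) (w1 y) (w2 y)) by rewrite /corr1; cont.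
have c2 : continuous (fun y => corr2 k (y / e) (w1 y) (w2 y)) by rewrite /corr2; cont.
have c1u : continuous (fun y => corr1u k (y / e) (w1 y) (w2 y)) by rewrite /corr1u; cont.
have c1v : continuous (fun y => corr1v k (y / e) (w1 y) (w2 y)) by rewrite /corr1v; cont.
have c2u : continuous (fun y => corr2u k (y / e) (w1 y) (w2 y)) by rewrite /corr2u; cont.
have c2v : continuous (fun y => corr2v k (y / e) (w1 y) (w2 y)) by rewrite /corr2v; cont.
have m1 : continuous (fun y => mean1 k (w1 y) (w2 y)) by rewrite /mean1; cont.
have m2 : continuous (fun y => mean2 k (w1 y) (w2 y)) by rewrite /mean2; cont.
have df : continuous (fun y => dforcing k e (y / e) (w1 y) (w2 y)).
  by rewrite /dforcing /carrier; cont.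
have d1 : continuous (fun y => defect1 k e (y / e) (w1 y) (w2 y)) by rewrite /defect1; cont.
have d2 : continuous (fun y => defect2 k e (y / e) (w1 y) (w2 y)) by rewrite /defect2; cont.
have dd : continuous (fun y => ddet k e (y / e) (w1 y) (w2 y)) by rewrite /ddet; cont.
have dV : continuous (fun y => (1 + e * ddet k e (y / e) (w1 y) (w2 y))^-1).
  by apply: (cont_inv det0); cont.
by split; rewrite /rem1 /rem2; cont.
Qed.

Lemma antider_scaled (F f : R -> R) e : antider F f ->
  antider (fun y => F (y / e)) (fun y => f (y / e) / e).
Proof.
move=> dF; have id : antider (fun y : R => y / e) (fun=> e^-1).
  by eapply antider_eq; [der | move=> y /=; ring].
exact: antider_comp id dF.
Qed.

(** In the derivative of [w + e corr (y / e, w)] the factor [e] cancels the [1 / e] from the fast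
    variable, and the [x]-derivative of [corr] replaces the mean field by the exact one at [w]. What
    is left has order [e], and [rem] is chosen to match it. *)
Lemma slow_equation e (w1 w2 : R -> R) : e != 0 ->
  (forall y, 1 + e * ddet k e (y / e) (w1 y) (w2 y) != 0) ->
  antider w1 (fun y => mean1 k (w1 y) (w2 y) + e * rem1 k e (y / e) (w1 y) (w2 y)) ->
  antider w2 (fun y => mean2 k (w1 y) (w2 y) + e * rem2 k e (y / e) (w1 y) (w2 y)) ->
  let z1 y := w1 y + e * corr1 k (y / e) (w1 y) (w2 y) in
  let z2 y := w2 y + e * corr2 k (y / e) (w1 y) (w2 y) in
  antider z1 (fun y => slow1 k (y / e) (z1 y) (z2 y)) /\
  antider z2 (fun y => slow2 k (y / e) (z1 y) (z2 y)).
Proof.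
move=> e0 det0 dw1 dw2 z1 z2.
have dA1 := antider_scaled e (fast_dA1 S); have dA2 := antider_scaled e (fast_dA2 S).
have dA3 := antider_scaled e (fast_dA3 S); have dK1 := antider_scaled e (fast_dK1 S).
have dK2 := antider_scaled e (fast_dK2 S); have dK3 := antider_scaled e (fast_dK3 S).
have dK4 := antider_scaled e (fast_dK4 S); have dK5 := antider_scaled e (fast_dK5 S).
have Er1 y : (1 + e * corr1u k (y / e) (w1 y) (w2 y)) * rem1 k e (y / e) (w1 y) (w2 y) +
   e * corr1v k (y / e) (w1 y) (w2 y) * rem2 k e (y / e) (w1 y) (w2 y) = defect1 k e (y / e) (w1 y) (w2 y).
  move: (det0 y); rewrite /rem1 /rem2 /ddet => h; field; exact: h.
have Er2 y : e * corr2u k (y / e) (w1 y) (w2 y) * rem1 k e (y / e) (w1 y) (w2 y) +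
   (1 + e * corr2v k (y / e) (w1 y) (w2 y)) * rem2 k e (y / e) (w1 y) (w2 y) = defect2 k e (y / e) (w1 y) (w2 y).
  move: (det0 y); rewrite /rem1 /rem2 /ddet => h; field; exact: h.
have cube (Q s8 g gp : R) : Q * (g + e * gp) - s8 * (g + e * gp) ^+ 3 =
   Q * g - s8 * g ^+ 3 + e * (Q * gp - s8 * gp * ((g + e * gp) ^+ 2 + (g + e * gp) * g + g ^+ 2)).
  by ring.
have car y : carrier k (y / e) (z1 y) (z2 y) = carrier k (y / e) (w1 y) (w2 y) +
    e * carrier k (y / e) (corr1 k (y / e) (w1 y) (w2 y)) (corr2 k (y / e) (w1 y) (w2 y)).
  by rewrite /carrier /z1 /z2; ring.
have fE y : forcing k (y / e) (carrier k (y / e) (z1 y) (z2 y)) =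
    forcing k (y / e) (carrier k (y / e) (w1 y) (w2 y)) + e * dforcing k e (y / e) (w1 y) (w2 y).
  by rewrite car /forcing cube /dforcing.
split.
- eapply antider_eq; first by rewrite /z1 /corr1; der.
  move=> y; rewrite /slow1 fE.
  move: (rem1 k e _ _ _) (rem2 k e _ _ _) (Er1 y) => r1 r2.
  rewrite /defect1; move: (dforcing k e _ _ _) => D h.
  (* Mean field, plus [x]-derivative of the correction, plus the terms of order [e], which the
     equation [Er1] identifies with the defect. *)
  transitivity (mean1 k (w1 y) (w2 y) +
     (slow1 k (y / e) (w1 y) (w2 y) - mean1 k (w1 y) (w2 y)) +
     e * ((1 + e * corr1u k (y / e) (w1 y) (w2 y)) * r1 + e * corr1v k (y / e) (w1 y) (w2 y) * r2 +
     (corr1u k (y / e) (w1 y) (w2 y) * mean1 k (w1 y) (w2 y) +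
      corr1v k (y / e) (w1 y) (w2 y) * mean2 k (w1 y) (w2 y)))); last first.
    by rewrite h /slow1; ring.
  rewrite /slow1 /forcing /carrier /mean1 /mean2 /corr1u /corr1v.
  have := nn0; move: (w1 y) (w2 y) (fs k _) (fc k _) (fW k _) (fA1 k _) (fA2 k _)
    (fK1 k _) (fK2 k _) (fK3 k _) (fK4 k _) (fn k) (fOm k) (fwn k) (fsig k).
  move=> u v s c W A1 A2 K1 K2 K3 K4 n Om wn sg N.
  by field; rewrite N e0.
- eapply antider_eq; first by rewrite /z2 /corr2; der.
  move=> y; rewrite /slow2 fE.
  move: (rem1 k e _ _ _) (rem2 k e _ _ _) (Er2 y) => r1 r2.
  rewrite /defect2; move: (dforcing k e _ _ _) => D h.
  transitivity (mean2 k (w1 y) (w2 y) +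
     (slow2 k (y / e) (w1 y) (w2 y) - mean2 k (w1 y) (w2 y)) +
     e * (e * corr2u k (y / e) (w1 y) (w2 y) * r1 + (1 + e * corr2v k (y / e) (w1 y) (w2 y)) * r2 +
     (corr2u k (y / e) (w1 y) (w2 y) * mean1 k (w1 y) (w2 y) +
      corr2v k (y / e) (w1 y) (w2 y) * mean2 k (w1 y) (w2 y)))); last first.
    by rewrite h /slow2; ring.
  rewrite /slow2 /forcing /carrier /mean1 /mean2 /corr2u /corr2v.
  have := nn0; move: (w1 y) (w2 y) (fs k _) (fc k _) (fW k _) (fA1 k _) (fA3 k _)
    (fK1 k _) (fK2 k _) (fK3 k _) (fK5 k _) (fn k) (fOm k) (fwn k) (fsig k).
  move=> u v s c W A1 A3 K1 K2 K3 K5 n Om wn sg N.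
  by field; rewrite N e0.
Qed.

End Spec.
End Averaging.

(** * Contraction *)

Section Contraction.
Variable R : realType.

Lemma half_pow_small (x C : R) : (forall k : nat, `|x| <= C * 2^-1 ^+ k) -> x = 0.
Proof.
move=> h; apply/eqP; rewrite -normr_eq0; apply/eqP/le_anti; rewrite normr_ge0 andbT.
have C0 : 0 <= C by have := h 0%N; rewrite expr0 mulr1; apply: le_trans.
apply/ler_addgt0Pr => e e0; rewrite add0r.
have : (2^-1 : R) ^+ k @[k --> \oo] --> 0.
  by apply: cvg_expr; rewrite ger0_norm ?invr_ge0 //; lra.
have e1 : 0 < e / (C + 1) by rewrite divr_gt0 //; lra.
move=> /cvgrPdist_lt /(_ _ e1) [k _ /(_ k (leqnn k))] /=.
rewrite sub0r normrN => hk; apply: (le_trans (h k)).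
rewrite ger0_norm in hk; last by rewrite exprn_ge0 // invr_ge0 ler0n.
move: hk; rewrite ltr_pdivlMr; last by lra.
have := exprn_ge0 k (_ : 0 <= 2^-1 :> R); rewrite invr_ge0 ler0n => /(_ isT).
move: (2^-1 ^+ k) => t t0; rewrite mulrDr mulr1 mulrC => h1; lra.
Qed.

Lemma antider_sub (F G f g : R -> R) : antider F f -> antider G g ->
  antider (fun x => F x - G x) (fun x => f x - g x).
Proof. by move=> dF dG; exact: antiderD dF (antiderN dG). Qed.

Lemma even_norm_bound (z : R -> R) (C mu : R) :
  (forall y, `|z (- y)| = `|z y|) ->
  (forall y, 0 <= y -> `|z y| <= C * expR (- (mu * y))) ->
  forall y, `|z y| <= C * expR (- (mu * `|y|)).
Proof.
move=> ez h y; have [y0|y0] := leP 0 y; first by rewrite (ger0_norm y0) h.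
by rewrite (ltr0_norm y0) -ez; apply: h; rewrite oppr_ge0 ltW.
Qed.

Lemma expR_weight_bounds (mu : R) : 0 < mu -> forall y : R, 0 <= expR (- (mu * `|y|)) <= 1.
Proof.
by move=> mu0 y; rewrite expR_ge0 /= expR_le1 oppr_le0 mulr_ge0 // ltW.
Qed.

Variables (phi1 phi2 a11 a12 a21 : R -> R) (kappa K c : R).
Hypothesis F : decaying_frame phi1 phi2 a11 a12 a21 kappa K c.

Lemma linear_solutionB (f1 f2 z1 z2 g1 g2 y1 y2 : R -> R) :
  linear_solution a11 a12 a21 f1 f2 z1 z2 ->
  linear_solution a11 a12 a21 g1 g2 y1 y2 ->
  linear_solution a11 a12 a21 (fun y => f1 y - g1 y) (fun y => f2 y - g2 y)
    (fun y => z1 y - y1 y) (fun y => z2 y - y2 y).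
Proof.
move=> [h1 h2 h3 h4] [k1 k2 k3 k4]; split.
- by apply: antider_eq (antider_sub h1 k1) _ => y /=; ring.
- by apply: antider_eq (antider_sub h2 k2) _ => y /=; ring.
- by move=> y; rewrite h3 k3.
- by move=> y; rewrite h4 k4; ring.
Qed.

(** Picard iteration in the ball of radius [delta] for the weight [exp (mu |y|)]. The two hypotheses
    on [frame_rate] give contraction by 1/2 and invariance of the ball; the 2 in [2 * l] accounts
    for the two components. *)
Lemma fixed_point (f1 f2 : R -> R -> R -> R) (mu d0 l delta : R) :
  0 < mu -> mu < kappa -> 0 < delta -> 0 <= l ->
  frame_rate kappa K c mu * (2 * l) <= 2^-1 ->
  frame_rate kappa K c mu * (d0 + 2 * l * delta) <= delta ->
  (forall y a b, f1 (- y) a (- b) = - f1 y a b) ->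
  (forall y a b, f2 (- y) a (- b) = f2 y a b) ->
  (forall y, 0 <= y -> `|f1 y 0 0| <= d0 * expR (- (mu * y)) /\
                       `|f2 y 0 0| <= d0 * expR (- (mu * y))) ->
  (forall y a b a' b', `|a| <= delta -> `|b| <= delta ->
     `|a'| <= delta -> `|b'| <= delta ->
     `|f1 y a b - f1 y a' b'| <= l * (`|a - a'| + `|b - b'|) /\
     `|f2 y a b - f2 y a' b'| <= l * (`|a - a'| + `|b - b'|)) ->
  (forall z1 z2, continuous z1 -> continuous z2 ->
     (forall y, `|z1 y| <= delta /\ `|z2 y| <= delta) ->
     continuous (fun y => f1 y (z1 y) (z2 y)) /\
     continuous (fun y => f2 y (z1 y) (z2 y))) ->
  exists z1 z2, linear_solution a11 a12 a21
    (fun y => f1 y (z1 y) (z2 y)) (fun y => f2 y (z1 y) (z2 y)) z1 z2 /\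
    forall y, `|z1 y| <= delta * expR (- (mu * `|y|)) /\
              `|z2 y| <= delta * expR (- (mu * `|y|)).
Proof.
move=> mu0 muk de0 l0 contr inv pf1 pf2 fb0 flip fcont.
set Lam := frame_rate kappa K c mu in contr inv *.
pose good (z : (R -> R) * (R -> R)) := [/\ continuous z.1, continuous z.2,
  (forall y, z.1 (- y) = z.1 y), (forall y, z.2 (- y) = - z.2 y) &
  forall y, `|z.1 y| <= delta * expR (- (mu * `|y|)) /\
            `|z.2 y| <= delta * expR (- (mu * `|y|))].
pose sol z z' := linear_solution a11 a12 a21
  (fun y => f1 y (z.1 y) (z.2 y)) (fun y => f2 y (z.1 y) (z.2 y)) z'.1 z'.2.
have w01 := expR_weight_bounds mu0.
have gb z : good z -> forall y, `|z.1 y| <= delta /\ `|z.2 y| <= delta.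
  move=> [_ _ _ _ h] y; have [h1 h2] := h y; have /andP[w0 w1] := w01 y.
  by split; [apply: (le_trans h1)|apply: (le_trans h2)]; rewrite ler_piMr // ltW.
have step z : good z -> exists z', good z' /\ sol z z'.
  move=> gz; have bz := gb _ gz; have [cz1 cz2 ez oz hz] := gz.
  have [cf1 cf2] := fcont _ _ cz1 cz2 bz.
  have [||| z1 [z2 [sz bz']]] := @linear_solution_exists R phi1 phi2 a11 a12 a21
      kappa K c F _ _ mu (d0 + 2 * l * delta) mu0 muk cf1 cf2.
  - by move=> y; rewrite ez oz pf1.
  - by move=> y; rewrite ez oz pf2.
  - move=> y y0; have [h1 h2] := hz y; have [b1 b2] := bz y.
    have [g1 g2] := fb0 y y0.
    have de0' := ltW de0.
    have n0 : `|0 : R| <= delta by rewrite normr0.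
    have [e1 e2] := flip y _ _ 0 0 b1 b2 n0 n0.
    rewrite (ger0_norm y0) in h1 h2; rewrite !subr0 in e1 e2.
    have hl : l * (`|z.1 y| + `|z.2 y|) <= 2 * l * delta * expR (- (mu * y)).
      apply: (@le_trans _ _ (l * (delta * expR (- (mu * y)) + delta * expR (- (mu * y))))).
        by rewrite ler_wpM2l // lerD.
      by rewrite le_eqVlt; apply/orP; left; apply/eqP; ring.
    rewrite mulrDl; split.
      rewrite -[f1 _ _ _](subrK (f1 y 0 0)) (le_trans (ler_normD _ _)) // addrC lerD //.
      exact: le_trans hl.
    rewrite -[f2 _ _ _](subrK (f2 y 0 0)) (le_trans (ler_normD _ _)) // addrC lerD //.
    exact: le_trans hl.
  exists (z1, z2); split; last exact: sz.
  have [dz1 dz2 ez' oz'] := sz.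
  have bd y : 0 <= y -> `|z1 y| <= delta * expR (- (mu * y)) /\ `|z2 y| <= delta * expR (- (mu * y)).
    move=> y0; have [h1 h2] := bz' y y0.
    by split; [apply: (le_trans h1)|apply: (le_trans h2)]; rewrite ler_wpM2r ?expR_ge0.
  split => //=; [exact: antider_continuous dz1 | exact: antider_continuous dz2 |].
  move=> y; split.
    by apply: even_norm_bound => [t|t /bd[]]; rewrite ?ez'.
  by apply: even_norm_bound => [t|t /bd[]]; rewrite ?oz' ?normrN.
(* Contraction for arbitrary solutions, not for a chosen one: [linear_solution_bound] applies to the
   difference, with [delta + delta] as its a priori bound. *)
have diff z z' y y' D : good z -> good z' -> good y -> good y' -> sol z z' -> sol y y' ->
    (forall t, `|z.1 t - y.1 t| <= D * expR (- (mu * `|t|)) /\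
               `|z.2 t - y.2 t| <= D * expR (- (mu * `|t|))) ->
    forall t, `|z'.1 t - y'.1 t| <= D / 2 * expR (- (mu * `|t|)) /\
              `|z'.2 t - y'.2 t| <= D / 2 * expR (- (mu * `|t|)).
  move=> gz gz' gy gy' sz sy h.
  have D0 : 0 <= D.
    have [+ _] := h 0; rewrite normr0 mulr0 oppr0 expR0 mulr1; exact: le_trans.
  have s := linear_solutionB sz sy.
  have bd t : 0 <= t -> `|z'.1 t - y'.1 t| <= D / 2 * expR (- (mu * t)) /\
                        `|z'.2 t - y'.2 t| <= D / 2 * expR (- (mu * t)).
    move=> t0; have := @linear_solution_bound R phi1 phi2 a11 a12 a21 kappa K c F
      _ _ _ _ mu (2 * l * D) (delta + delta) mu0 muk s _ _ t t0.
    have LD : Lam * (2 * l * D) * expR (- (mu * t)) <= D / 2 * expR (- (mu * t)).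
      rewrite ler_wpM2r ?expR_ge0 //.
      have -> : Lam * (2 * l * D) = Lam * (2 * l) * D by ring.
      by rewrite mulrC ler_wpM2l.
    case=> [r r0|r r0|h1 h2].
    - have [b1 b2] := gb _ gz' r; have [b3 b4] := gb _ gy' r.
      by split; apply: (le_trans (ler_normB _ _)); exact: lerD.
    - have [b1 b2] := gb _ gz r; have [b3 b4] := gb _ gy r.
      have [e1 e2] := flip r _ _ _ _ b1 b2 b3 b4.
      have [h1 h2] := h r; rewrite (ger0_norm r0) in h1 h2.
      have hl : l * (`|z.1 r - y.1 r| + `|z.2 r - y.2 r|) <= 2 * l * D * expR (- (mu * r)).
        apply: (@le_trans _ _ (l * (D * expR (- (mu * r)) + D * expR (- (mu * r))))).
          by rewrite ler_wpM2l // lerD.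
        by rewrite le_eqVlt; apply/orP; left; apply/eqP; ring.
      by split; [apply: (le_trans e1)|apply: (le_trans e2)].
    by split; [apply: le_trans h1 _|apply: le_trans h2 _].
  have [_ _ ez oz] := s; move=> t; split.
    by apply: (@even_norm_bound (fun t => z'.1 t - y'.1 t)) => [r|r /bd[]]; rewrite ?ez.
  by apply: (@even_norm_bound (fun t => z'.2 t - y'.2 t)) => [r|r /bd[]]; rewrite ?oz ?normrN.
(* The solution map is a choice; [diff] holds for whichever solutions are chosen. *)
pose T z := get [set z' | good z' /\ sol z z'].
have TP z : good z -> good (T z) /\ sol z (T z).
  move=> /step [z' h]; exact: (@getPex _ [set z' | good z' /\ sol z z'] (ex_intro _ z' h)).
pose zz k := iter k T (fun=> 0, fun=> 0).
have good0 : good (fun=> 0, fun=> 0).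
  split => //=; rewrite ?oppr0 //; try exact: cont_cst.
  by move=> y; rewrite normr0 mulr_ge0 ?expR_ge0 // ltW.
have gzz k : good (zz k) by elim: k => [//|k IH]; rewrite /zz iterS; have [] := TP _ IH.
have szz k : sol (zz k) (zz k.+1) by rewrite /zz iterS; have [] := TP _ (gzz k).
have dzz k t : `|(zz k.+1).1 t - (zz k).1 t| <= delta * 2^-1 ^+ k * expR (- (mu * `|t|)) /\
               `|(zz k.+1).2 t - (zz k).2 t| <= delta * 2^-1 ^+ k * expR (- (mu * `|t|)).
  elim: k t => [|k IH] t.
    rewrite expr0 mulr1 [(zz 0%N).1 _]/= [(zz 0%N).2 _]/= !subr0.
    by have [_ _ _ _] := gzz 1%N.
  rewrite exprS [_ * (2^-1 * _)]mulrCA [2^-1 * _]mulrC.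
  exact: (diff _ _ _ _ _ (gzz _) (gzz _) (gzz _) (gzz _) (szz _) (szz _) IH t).
have [g1 cg1 hg1] := @geometric_limit R (fun k => (zz k).1) delta
  (fun t => expR (- (mu * `|t|))) (ltW de0) w01 (fun k => let: And5 h _ _ _ _ := gzz k in h)
  (fun k y => (dzz k y).1).
have [g2 cg2 hg2] := @geometric_limit R (fun k => (zz k).2) delta
  (fun t => expR (- (mu * `|t|))) (ltW de0) w01 (fun k => let: And5 _ h _ _ _ := gzz k in h)
  (fun k y => (dzz k y).2).
pose g := (g1, g2).
have lim0 (x C w : R) : 0 <= w <= 1 -> 0 <= C -> (forall k : nat, `|x| <= C * 2^-1 ^+ k * w) -> x = 0.
  move=> /andP[w0 w1] C0 h; apply: (@half_pow_small _ C) => k; apply: (le_trans (h k)).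
  by rewrite ler_piMr // mulr_ge0 // exprn_ge0 // invr_ge0 ler0n.
have dbl (a b : R) w (C : R) p : `|a| <= 2 * C * p * w -> `|b| <= 2 * C * p * w ->
    `|a - b| <= (2 * C + 2 * C) * p * w.
  move=> ha hb; apply: (le_trans (ler_normB _ _)).
  have -> : (2 * C + 2 * C) * p * w = 2 * C * p * w + 2 * C * p * w by ring.
  exact: lerD.
have gg : good g.
  split => //=.
  - move=> y; apply/eqP; rewrite -subr_eq0; apply/eqP.
    apply: (lim0 _ (2 * delta + 2 * delta) _ (w01 y)); first by rewrite addr_ge0 // mulr_ge0 // ltW.
    move=> k; have [_ _ ez _ _] := gzz k; have := hg1 k y; have := hg1 k (- y); rewrite ez normrN => a1 a2.
    have -> : g1 (- y) - g1 y = (g1 (- y) - (zz k).1 y) - (g1 y - (zz k).1 y) by ring.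
    exact: dbl.
  - move=> y; apply/eqP; rewrite -subr_eq0; apply/eqP.
    apply: (lim0 _ (2 * delta + 2 * delta) _ (w01 y)); first by rewrite addr_ge0 // mulr_ge0 // ltW.
    move=> k; have [_ _ _ ez _] := gzz k; have := hg2 k y; have := hg2 k (- y); rewrite ez normrN => a1 a2.
    have -> : g2 (- y) - - g2 y = (g2 (- y) - - (zz k).2 y) - (- (g2 y - (zz k).2 y)) by ring.
    by apply: dbl => //; rewrite normrN.
  - move=> y; have key (x w : R) : (forall k : nat, exists2 t, `|t| <= delta * w &
        `|x - t| <= 2 * delta * 2^-1 ^+ k * w) -> 0 <= w <= 1 -> `|x| <= delta * w.
      move=> h w01'; rewrite -subr_le0 leNgt; apply/negP => lt0.
      have := @lim0 (`|x| - delta * w) (2 * delta) w w01'.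
      move=> E; move: (lt0); rewrite E ?ltxx // ?mulr_ge0 ?(ltW de0) //.
      move=> k; have [t t1 t2] := h k; rewrite gtr0_norm //.
      apply: le_trans t2; have := ler_normD (x - t) t; rewrite subrK; lra.
    by split; apply: key (w01 y) => k; [exists ((zz k).1 y) | exists ((zz k).2 y)] => //;
      have [_ _ _ _ /(_ y) []] := gzz k.
(* An image of the limit is compared with the iterates. By [diff] they also converge to [g'], so
   [g' = g] and [g] solves the equation. *)
have [g' [gg' sg]] := step _ gg.
have e k t : `|g'.1 t - (zz k.+1).1 t| <= 2 * delta * 2^-1 ^+ k / 2 * expR (- (mu * `|t|)) /\
             `|g'.2 t - (zz k.+1).2 t| <= 2 * delta * 2^-1 ^+ k / 2 * expR (- (mu * `|t|)).
  by apply: diff gg gg' (gzz k) (gzz _) sg (szz k) _ t => r; split; [exact: hg1|exact: hg2].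
have eqk (x t : R) : (forall k : nat, `|x| <= (2 * delta * 2^-1 ^+ k / 2 + 2 * delta * 2^-1 ^+ k.+1) * expR (- (mu * `|t|))) -> x = 0.
  move=> h; apply: (lim0 _ (2 * delta) _ (w01 t)) => [|k]; first by rewrite mulr_ge0 // ltW.
  apply: (le_trans (h k)); rewrite ler_wpM2r ?expR_ge0 // exprS le_eqVlt.
  by apply/orP; left; apply/eqP; field.
have E1 : g'.1 = g1.
  apply/funext => t; apply/eqP; rewrite -subr_eq0; apply/eqP/(eqk _ t) => k.
  have -> : g'.1 t - g1 t = (g'.1 t - (zz k.+1).1 t) - (g1 t - (zz k.+1).1 t) by ring.
  by apply: (le_trans (ler_normB _ _)); rewrite [leRHS]mulrDl; apply: lerD; [exact: (e k t).1 | exact: hg1].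
have E2 : g'.2 = g2.
  apply/funext => t; apply/eqP; rewrite -subr_eq0; apply/eqP/(eqk _ t) => k.
  have -> : g'.2 t - g2 t = (g'.2 t - (zz k.+1).2 t) - (g2 t - (zz k.+1).2 t) by ring.
  by apply: (le_trans (ler_normB _ _)); rewrite [leRHS]mulrDl; apply: lerD; [exact: (e k t).2 | exact: hg2].
exists g1, g2; split; last by have [_ _ _ _] := gg.
by move: sg; rewrite /sol E1 E2.
Qed.

End Contraction.

(** * Fourier coefficients of the potential *)

Section FastData.
Variable R : realType.

Lemma periodic_bounded (F : R -> R) (T : R) : 0 < T -> continuous F ->
  (forall x, F (x + T) = F x) -> exists M, forall x, `|F x| <= M.
Proof.
move=> T0 cF pF.
have [|a Ia Ma] := @EVT_max R (fun x => `|F x|) 0 T (ltW T0).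
  by apply: continuous_subspaceT; cont.
exists `|F a| => x.
have key (N : nat) : forall y, - (N%:R * T) <= y <= N%:R * T + T -> `|F y| <= `|F a|.
  elim: N => [|N IH] y.
    by rewrite mul0r oppr0 add0r => h; apply: Ma; rewrite in_itv.
  rewrite -natr1 mulrDl mul1r => /andP[y1 y2].
  have [yT|yT] := leP T y.
    rewrite -[y](subrK T) pF; apply: IH; apply/andP; split; last by lra.
    have : 0 <= N%:R * T by rewrite mulr_ge0 // ltW.
    lra.
  have [y0|y0] := leP 0 y; first by apply: Ma; rewrite in_itv /= y0 ltW.
  have NT : 0 <= N%:R * T by rewrite mulr_ge0 // ltW.
  by rewrite -pF; apply: IH; apply/andP; split; lra.
have := archi_boundP (_ : 0 <= `|x| / T); rewrite divr_ge0 ?(ltW T0) // => /(_ isT).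
rewrite ltr_pdivrMr // => h; apply: (key (Num.bound (`|x| / T))).
move: (_ * T) h => s; rewrite ltr_norml => /andP[h1 h2]; apply/andP; split; lra.
Qed.

(** Zero mean over a period is what keeps the antiderivative periodic, hence bounded. *)
Lemma prim_periodic (f : R -> R) (T : R) : continuous f ->
  (forall x, f (x + T) = f x) -> prim f T = 0 -> forall x, prim f (x + T) = prim f x.
Proof.
move=> cf pf fT x; have df := prim_antider cf.
have id : antider (fun y : R => y + T) (fun=> 1).
  by eapply antider_eq; [der | move=> y /=; ring].
have d : antider (fun y => prim f (y + T)) f.
  by apply: antider_eq (antider_comp id df) _ => y /=; rewrite pf mulr1.
by have := antider_uniq d df x 0; rewrite add0r fT prim0 // !subr0.
Qed.

Lemma prim_bounded (f : R -> R) (T : R) : 0 < T -> continuous f ->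
  (forall x, f (x + T) = f x) -> prim f T = 0 -> exists M, forall x, `|prim f x| <= M.
Proof.
move=> T0 cf pf fT; apply: (periodic_bounded T0); last exact: prim_periodic.
exact: antider_continuous (prim_antider cf).
Qed.

Lemma antider_cos_lin (c : R) : antider (fun x => cos (c * x)) (fun x => - c * sin (c * x)).
Proof. by eapply antider_eq; [der | move=> y /=; ring]. Qed.

Lemma antider_sin_lin (c : R) : antider (fun x => sin (c * x)) (fun x => c * cos (c * x)).
Proof. by eapply antider_eq; [der | move=> y /=; ring]. Qed.

(** The frequency [nu] may be negative. The [K] are explicit trigonometric polynomials; the [A] are
    assembled, through the double-angle formulas, from antiderivatives of [W], of [W cos - wn] and
    of [W sin], each of zero mean. *)
Lemma exists_fast_data (n nu Om sg wn : R) (W : R -> R) :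
  0 < n -> nu != 0 -> continuous W ->
  (forall x, W (x + 2 * pi) = W x) -> (forall x, W (- x) = W x) ->
  (forall x, cos (nu * (x + 2 * pi)) = cos (nu * x)) ->
  (forall x, sin (nu * (x + 2 * pi)) = sin (nu * x)) ->
  prim W (2 * pi) = 0 ->
  prim (fun x => W x * cos (nu * x)) (2 * pi) = 2 * pi * wn ->
  prim (fun x => W x * sin (nu * x)) (2 * pi) = 0 ->
  exists k B, [/\ fast_spec k nu B,
    [/\ fn k = n, fOm k = Om, fsig k = sg & fwn k = wn] &
    [/\ fs k = (fun x => sin (nu / 2 * x)), fc k = (fun x => cos (nu / 2 * x)) & fW k = W]].
Proof.
move=> n0 nu0 cW pW eW pc ps iW iWc iWs.
have pi0 : 0 < 2 * pi :> R by rewrite mulr_gt0 // pi_gt0.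
pose s x : R := sin (nu / 2 * x); pose c x : R := cos (nu / 2 * x).
have ds : antider s (fun x => nu / 2 * c x) by exact: antider_sin_lin.
have dc : antider c (fun x => - (nu / 2) * s x) by exact: antider_cos_lin.
have cs x : c x ^+ 2 + s x ^+ 2 = 1 by exact: cos2Dsin2.
have se x : s (- x) = - s x by rewrite /s mulrN sinN.
have ce x : c (- x) = c x by rewrite /c mulrN cosN.
have c2 x : cos (nu * x) = c x ^+ 2 - s x ^+ 2.
  have -> : nu * x = nu / 2 * x + nu / 2 * x by field.
  by rewrite cosD !expr2.
have s2 x : sin (nu * x) = 2 * s x * c x.
  have -> : nu * x = nu / 2 * x + nu / 2 * x by field.
  by rewrite sinD -/(s x) -/(c x); ring.
have ccos : continuous (fun x => cos (nu * x)) by cont.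
have csin : continuous (fun x => sin (nu * x)) by cont.
have c2' : continuous (fun x => W x * cos (nu * x) - wn) by cont.
have c3' : continuous (fun x => W x * sin (nu * x)) by cont.
have c2'' : continuous (fun x => W x * cos (nu * x)) by cont.
have dp1 := prim_antider cW; have dp2 := prim_antider c2'; have dp3 := prim_antider c3'.
have i2 : prim (fun x => W x * cos (nu * x) - wn) (2 * pi) = 0.
  have d := prim_antider c2''.
  have d' : antider (fun x => prim (fun x => W x * cos (nu * x)) x - wn * x)
      (fun x => W x * cos (nu * x) - wn).
    by eapply antider_eq; [der | move=> y /=; ring].
  by rewrite (primE d' c2') prim0 // iWc; ring.
have [M1 hM1] := prim_bounded pi0 cW pW iW.
have [M2 hM2] := prim_bounded pi0 c2' (fun x => congr2 (fun a b => a * b - wn) (pW x) (pc x)) i2.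
have [M3 hM3] := prim_bounded pi0 c3' (fun x => congr2 (fun a b => a * b) (pW x) (ps x)) iWs.
have [M4 hM4] := periodic_bounded pi0 cW pW.
have o1 := prim_even_odd cW eW.
have o2 : forall x, prim (fun x => W x * cos (nu * x) - wn) (- x) =
  - prim (fun x => W x * cos (nu * x) - wn) x.
  by apply: (prim_even_odd c2') => x; rewrite eW mulrN cosN.
have o3 : forall x, prim (fun x => W x * sin (nu * x)) (- x) =
  prim (fun x => W x * sin (nu * x)) x.
  by apply: (prim_odd_even c3') => x; rewrite eW !mulrN sinN; ring.
pose p1 := prim W; pose p2 := prim (fun x => W x * cos (nu * x) - wn).
pose p3 := prim (fun x => W x * sin (nu * x)).
rewrite -/p1 in hM1 o1 dp1; rewrite -/p2 in hM2 o2 dp2; rewrite -/p3 in hM3 o3 dp3.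
(* From [2 s c = sin (nu x)], [2 s^2 = 1 - cos (nu x)] and [2 c^2 = 1 + cos (nu x)]. *)
pose A1 x := p3 x - Om / nu * cos (nu * x).
pose A2 x := - p1 x + p2 x + Om / nu * sin (nu * x).
pose A3 x := p1 x + p2 x + Om / nu * sin (nu * x).
pose K1 x := - c x ^+ 4 / (2 * nu).
pose K2 x := - (s x * c x * (c x ^+ 2 - s x ^+ 2)) / (4 * nu).
pose K3 x := s x ^+ 4 / (2 * nu).
pose K4 x := - (s x * c x) / nu + s x * c x * (c x ^+ 2 - s x ^+ 2) / (4 * nu).
pose K5 x := s x * c x / nu + s x * c x * (c x ^+ 2 - s x ^+ 2) / (4 * nu).
pose k := FastData n Om sg wn s c W A1 A2 A3 K1 K2 K3 K4 K5.
have bm1 (a b : R) A B : `|a| <= A -> `|b| <= B -> `|a * b| <= A * B.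
  by move=> ha hb; rewrite normrM; apply: ler_pM.
have bs x : `|s x| <= 1 by exact: sin_max.
have bc x : `|c x| <= 1 by exact: cos_max.
have bS x : `|sin (nu * x)| <= 1 by exact: sin_max.
have bC x : `|cos (nu * x)| <= 1 by exact: cos_max.
have bcos2 x : `|c x ^+ 2 - s x ^+ 2| <= 1 by rewrite -c2.
have bsc x : `|s x * c x| <= 1 by rewrite -[leRHS]mulr1; apply: bm1.
have bscc x : `|s x * c x * (c x ^+ 2 - s x ^+ 2)| <= 1 by rewrite -[leRHS]mulr1; apply: bm1.
have b4 (t : R) : `|t| <= 1 -> `|t ^+ 4| <= 1 by move=> h; rewrite normrX exprn_ile1.
have bd (a b : R) : `|a| <= 1 -> `|a / b| <= `|b^-1|.
  by move=> h; rewrite -[leRHS]mul1r; apply: bm1.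
pose B := 1 + `|M1| + `|M2| + `|M3| + `|M4| + `|Om / nu| + `|(2 * nu)^-1| + `|(4 * nu)^-1| + `|nu^-1|.
have P0 := normr_ge0.
have le_abs (a M : R) : `|a| <= M -> `|a| <= `|M| by move=> h; rewrite (le_trans h) // ler_norm.
have hO (t : R) : `|t| <= 1 -> `|Om / nu * t| <= `|Om / nu|.
  by move=> h; rewrite -[leRHS]mulr1; apply: bm1.
have hn1 x := le_abs _ _ (hM1 x); have hn2 x := le_abs _ _ (hM2 x).
have hn3 x := le_abs _ _ (hM3 x); have hn4 x := le_abs _ _ (hM4 x).
have n1 := P0 _ _ M1; have n2 := P0 _ _ M2; have n3 := P0 _ _ M3; have n4 := P0 _ _ M4.
have n5 := P0 _ _ (Om / nu); have n6 := P0 _ _ (2 * nu)^-1; have n7 := P0 _ _ (4 * nu)^-1.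
have n8 := P0 _ _ nu^-1.
exists k, B; split; [|by split|by split].
split; [exact: n0 | exact: cs | exact: ds | exact: dc | exact: cW | rewrite /= ..].
- by eapply antider_eq; [rewrite /A1; der | move=> x /=; rewrite s2; field].
- by eapply antider_eq; [rewrite /A2; der | move=> x /=; rewrite c2;
    have := cs x; move: (c x) (s x) => a b h; have -> : a ^+ 2 = 1 - b ^+ 2; [rewrite -h; ring|field]].
- by eapply antider_eq; [rewrite /A3; der | move=> x /=; rewrite c2;
    have := cs x; move: (c x) (s x) => a b h; have -> : b ^+ 2 = 1 - a ^+ 2; [rewrite -h; ring|field]].
- by eapply antider_eq; [rewrite /K1; der | move=> x /=; field].
- eapply antider_eq; [rewrite /K2; der | move=> x /=].
  have := cs x; move: (c x) (s x) => a b h; have e : b ^+ 2 = 1 - a ^+ 2 by rewrite -h; ring.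
  transitivity (- (a ^+ 2 * (a ^+ 2 - b ^+ 2) - b ^+ 2 * (a ^+ 2 - b ^+ 2) - 4 * a ^+ 2 * b ^+ 2) / 8); first by field.
  by rewrite e; field.
- by eapply antider_eq; [rewrite /K3; der | move=> x /=; field].
- eapply antider_eq; [rewrite /K4; der | move=> x /=].
  have := cs x; move: (c x) (s x) => a b h; have e : b ^+ 2 = 1 - a ^+ 2 by rewrite -h; ring.
  transitivity (- (a ^+ 2 - b ^+ 2) / 2 + (a ^+ 2 * (a ^+ 2 - b ^+ 2) - b ^+ 2 * (a ^+ 2 - b ^+ 2) - 4 * a ^+ 2 * b ^+ 2) / 8); first by field.
  have -> : b ^+ 4 = (b ^+ 2) ^+ 2 by ring.
  by rewrite e; field.
- eapply antider_eq; [rewrite /K5; der | move=> x /=].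
  have := cs x; move: (c x) (s x) => a b h; have e : b ^+ 2 = 1 - a ^+ 2 by rewrite -h; ring.
  transitivity ((a ^+ 2 - b ^+ 2) / 2 + (a ^+ 2 * (a ^+ 2 - b ^+ 2) - b ^+ 2 * (a ^+ 2 - b ^+ 2) - 4 * a ^+ 2 * b ^+ 2) / 8); first by field.
  by rewrite e; field.
- move=> f; do !(case; [move=> <- x | ]); last by [].
  + by apply: (le_trans (bs x)); rewrite /B; clear -n1 n2 n3 n4 n5 n6 n7 n8; lra.
  + by apply: (le_trans (bc x)); rewrite /B; clear -n1 n2 n3 n4 n5 n6 n7 n8; lra.
  + by apply: (le_trans (hn4 x)); rewrite /B; clear -n1 n2 n3 n4 n5 n6 n7 n8; lra.
  + apply: (le_trans (ler_normB _ _)); have := hn3 x; have := hO _ (bC x); rewrite /B; clear -n1 n2 n3 n4 n5 n6 n7 n8; lra.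
  + apply: (le_trans (ler_normD _ _)); have := hO _ (bS x).
    have := ler_normD (- p1 x) (p2 x); rewrite normrN; have := hn1 x; have := hn2 x; rewrite /B; clear -n1 n2 n3 n4 n5 n6 n7 n8; lra.
  + apply: (le_trans (ler_normD _ _)); have := hO _ (bS x).
    have := ler_normD (p1 x) (p2 x); have := hn1 x; have := hn2 x; rewrite /B; clear -n1 n2 n3 n4 n5 n6 n7 n8; lra.
  + have := bd (- c x ^+ 4) (2 * nu); rewrite normrN => /(_ (b4 _ (bc x))); rewrite /K1 /B; clear -n1 n2 n3 n4 n5 n6 n7 n8; lra.
  + have := bd (- (s x * c x * (c x ^+ 2 - s x ^+ 2))) (4 * nu); rewrite normrN => /(_ (bscc x)); rewrite /K2 /B; clear -n1 n2 n3 n4 n5 n6 n7 n8; lra.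
  + have := bd (s x ^+ 4) (2 * nu) (b4 _ (bs x)); rewrite /K3 /B; clear -n1 n2 n3 n4 n5 n6 n7 n8; lra.
  + have := bd (- (s x * c x)) nu; rewrite normrN => /(_ (bsc x)).
    have := bd (s x * c x * (c x ^+ 2 - s x ^+ 2)) (4 * nu) (bscc x).
    rewrite /K4 => h1 h2; apply: (le_trans (ler_normD _ _)); move: h1 h2; rewrite /B; clear -n1 n2 n3 n4 n5 n6 n7 n8; lra.
  + have := bd (s x * c x) nu (bsc x).
    have := bd (s x * c x * (c x ^+ 2 - s x ^+ 2)) (4 * nu) (bscc x).
    rewrite /K5 => h1 h2; apply: (le_trans (ler_normD _ _)); move: h1 h2; rewrite /B; clear -n1 n2 n3 n4 n5 n6 n7 n8; lra.
- move=> f; do !(case; [move=> <- x | ]); last by [].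
  + exact: ce.
  + exact: eW.
  + by rewrite /A1 o3 mulrN cosN.
  + by rewrite /K1 ce.
  + by rewrite /K3 se; congr (_ / _); ring.
- move=> f; do !(case; [move=> <- x | ]); last by [].
  + exact: se.
  + by rewrite /A2 o1 o2 mulrN sinN; ring.
  + by rewrite /A3 o1 o2 mulrN sinN; ring.
  + by rewrite /K2 se ce; ring.
  + by rewrite /K4 se ce; ring.
  + by rewrite /K5 se ce; ring.
Qed.

End FastData.

(** * Means of the potential against trigonometric functions, read off its series *)

Section FourierCoefficients.
Variable R : realType.

Definition cos_sum (c : nat -> R) (N : nat) (x : R) : R :=
  c 0%N + \sum_(1 <= m < N.+1) 2 * c m * cos (m%:R * x).

Lemma cos_sumS c N x : cos_sum c N.+1 x = cos_sum c N x + 2 * c N.+1 * cos (N.+1%:R * x).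
Proof. by rewrite /cos_sum big_nat_recr //= addrA. Qed.

Lemma cos_sum_continuous c N : continuous (cos_sum c N).
Proof.
elim: N => [|N IH].
  rewrite (_ : cos_sum c 0 = fun=> c 0%N); first exact: cont_cst.
  by apply/funext => x; rewrite /cos_sum big_geq // addr0.
rewrite (_ : cos_sum c N.+1 = fun x => cos_sum c N x + 2 * c N.+1 * cos (N.+1%:R * x)).
  by cont.
by apply/funext => x; exact: cos_sumS.
Qed.

(** Telescoping: [1 / (1 + (N + 1)^2) <= 1 / N - 1 / (N + 1)]. *)
Lemma cos_sum_tail (c : nat -> R) (A : R) (M j : nat) (x : R) :
  (0 < M)%N -> (forall m, `|c m| <= A / (1 + m%:R ^+ 2)) ->
  `|cos_sum c (M + j) x - cos_sum c M x| <= 2 * A * (M%:R^-1 - (M + j)%:R^-1).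
Proof.
move=> M0 hc.
have A0 : 0 <= A.
  by have := hc 0%N; rewrite expr0n /= addr0 divr1; apply: le_trans.
elim: j => [|j IH]; first by rewrite addn0 !subrr normr0 mulr0.
rewrite addnS cos_sumS.
set N := (M + j)%N in IH *.
have N0 : 0 < N%:R :> R by rewrite ltr0n /N addn_gt0 M0.
have h : `|2 * c N.+1 * cos (N.+1%:R * x)| <= 2 * A * (N%:R^-1 - N.+1%:R^-1).
  rewrite !normrM (ger0_norm (_ : 0 <= 2 :> R)) //.
  apply: (@le_trans _ _ (2 * `|c N.+1|)); first by rewrite ler_piMr ?mulr_ge0 // cos_max.
  rewrite -mulrA ler_wpM2l // (le_trans (hc _)) // ler_wpM2l //.
  have -> : N%:R^-1 - N.+1%:R^-1 = (N%:R * N.+1%:R)^-1 :> R.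
    by rewrite -natr1; field; rewrite !gt_eqF // addr_gt0.
  rewrite lef_pV2 ?posrE.
  - rewrite -[N.+1%:R]natr1; move: (N%:R) N0 => t t0.
    have -> : 1 + (t + 1) ^+ 2 = t * (t + 1) + (t + 2) by ring.
    rewrite lerDl; lra.
  - by rewrite ltr_wpDr // sqr_ge0.
  - by rewrite mulr_gt0 // ltr0n.
have -> : cos_sum c N x + 2 * c N.+1 * cos (N.+1%:R * x) - cos_sum c M x =
  (cos_sum c N x - cos_sum c M x) + 2 * c N.+1 * cos (N.+1%:R * x) by ring.
apply: (le_trans (ler_normD _ _)); apply: (le_trans (lerD IH h)).
by rewrite -mulrDr addrA subrK.
Qed.

(** The bound does not depend on [x]: pointwise convergence becomes uniform, which justifies
    integration term by term. *)
Lemma cos_sum_unif (c : nat -> R) (A : R) (W : R -> R) (M : nat) (x : R) :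
  (0 < M)%N -> (forall m, `|c m| <= A / (1 + m%:R ^+ 2)) ->
  cos_sum c N x @[N --> \oo] --> W x ->
  `|W x - cos_sum c M x| <= 2 * A / M%:R.
Proof.
move=> M0 hc hW.
have A0 : 0 <= A.
  by have := hc 0%N; rewrite expr0n /= addr0 divr1; apply: le_trans.
apply/ler_addgt0Pr => e e0.
move/cvgrPdist_lt: hW => /(_ _ e0) [N _ hN].
have h1 : `|W x - cos_sum c (M + N) x| < e by apply: hN; rewrite /= leq_addl.
have h2 := cos_sum_tail N x M0 hc.
have -> : W x - cos_sum c M x = (cos_sum c (M + N) x - cos_sum c M x) + (W x - cos_sum c (M + N) x) by ring.
apply: (le_trans (ler_normD _ _)); apply: lerD; last exact: ltW.
by apply: (le_trans h2); rewrite ler_wpM2l ?mulr_ge0 // lerBlDr lerDl invr_ge0.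
Qed.

Lemma prim_add (f g : R -> R) x : continuous f -> continuous g ->
  prim (fun x => f x + g x) x = prim f x + prim g x.
Proof.
move=> cf cg; have d := antiderD (prim_antider cf) (prim_antider cg).
by rewrite (primE d) ?prim0 ?addr0 ?subr0 //; exact: cont_add.
Qed.

Lemma prim_scale (a : R) (f : R -> R) x : continuous f ->
  prim (fun x => a * f x) x = a * prim f x.
Proof.
move=> cf; have df := prim_antider cf.
have d : antider (fun x => a * prim f x) (fun x => a * f x).
  by eapply antider_eq; [der | move=> y /=; ring].
by rewrite (primE d) ?prim0 ?mulr0 ?subr0 //; cont.
Qed.

(** A single statement for the test functions 1, cosine and sine: only the value [q] of the pairing
    with the mode [n] differs. The truncation error is at most [2 A / M * T]. *)
Lemma fourier_coefficient (c : nat -> R) (A q T : R) (W t : R -> R) (n : nat) :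
  0 < T -> (0 < n)%N -> c 0%N = 0 ->
  continuous W -> continuous t -> (forall x, `|t x| <= 1) ->
  (forall m, `|c m| <= A / (1 + m%:R ^+ 2)) ->
  (forall x, cos_sum c N x @[N --> \oo] --> W x) ->
  (forall m, (0 < m)%N -> prim (fun x => cos (m%:R * x) * t x) T = if m == n then q else 0) ->
  prim (fun x => W x * t x) T = 2 * c n * q.
Proof.
move=> T0 n0 c0 cW ct ht hc hW hq.
have A0 : 0 <= A.
  by have := hc 0%N; rewrite expr0n /= addr0 divr1; apply: le_trans.
have cS M := @cos_sum_continuous c M.
have val M : prim (fun x => cos_sum c M x * t x) T = if (n <= M)%N then 2 * c n * q else 0.
  elim: M => [|M IH].
    rewrite leqn0 eqn0Ngt n0 /=.
    rewrite (_ : (fun x => _) = fun=> 0).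
      by rewrite (primE (antider_cst 0)) ?subrr //; exact: cont_cst.
    by apply/funext => x; rewrite /cos_sum big_geq // addr0 c0 mul0r.
  rewrite (_ : (fun x => _) = fun x : R => cos_sum c M x * t x + 2 * c M.+1 * (cos (M.+1%:R * x) * t x)); last first.
    by apply/funext => x; rewrite cos_sumS; ring.
  have cc : continuous (fun x : R => cos (M.+1%:R * x) * t x) by cont.
  have cSM := cS M.
  rewrite prim_add; [|by cont|by cont].
  rewrite prim_scale // IH hq //.
  have [<-|ne] := eqVneq M.+1 n; first by rewrite ltnn leqnn add0r.
  by rewrite mulr0 addr0 [in RHS]leq_eqVlt eq_sym (negbTE ne) ltnS.
apply/eqP; rewrite -subr_eq0 -normr_eq0; apply/eqP/le_anti; rewrite normr_ge0 andbT.
have key M : (n <= M)%N -> `|prim (fun x => W x * t x) T - 2 * c n * q| <= 2 * A / M%:R * T.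
  move=> nM; have M0 : (0 < M)%N by exact: leq_trans nM.
  have cWt : continuous (fun x => W x * t x) by cont.
  have cSM := cS M.
  have cSt : continuous (fun x => cos_sum c M x * t x) by cont.
  have d1 := prim_antider cWt; have d2 := prim_antider cSt.
  have d : antider (fun x => prim (fun x => W x * t x) x - prim (fun x => cos_sum c M x * t x) x)
     (fun x => (W x - cos_sum c M x) * t x).
    by eapply antider_eq; [der | move=> y /=; ring].
  have d3 : antider (fun x => 2 * A / M%:R * x) (fun=> 2 * A / M%:R).
    by eapply antider_eq; [der | move=> y /=; ring].
  have := norm_le_of_derive_le (ltW T0) (fun x _ => d x) (fun x _ => d3 x).
  rewrite val nM !prim0 // mulr0 !subr0; apply=> x _.
  rewrite normrM -[leRHS]mulr1; apply: ler_pM => //.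
  exact: cos_sum_unif.
apply/ler_addgt0Pr => e e0; rewrite add0r.
have [M hM] : exists M : nat, 2 * A * T / e < M%:R.
  exists (Num.bound (2 * A * T / e)); apply: archi_boundP.
  by rewrite divr_ge0 ?mulr_ge0 // ltW.
apply: (le_trans (key (maxn n M) (leq_maxl _ _))).
have M0 : 0 < (maxn n M)%:R :> R by rewrite ltr0n (leq_trans n0) // leq_maxl.
rewrite mulrAC ler_pdivrMr // [leRHS]mulrC -ler_pdivrMr //.
by apply: (le_trans (ltW hM)); rewrite ler_nat leq_maxr.
Qed.

Lemma trig_2pin (m : nat) : cos (m%:R * (2 * pi)) = 1 :> R /\ sin (m%:R * (2 * pi)) = 0 :> R.
Proof.
elim: m => [|m [IH1 IH2]]; first by rewrite mul0r cos0 sin0.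
have e : m.+1%:R * (2 * pi) = m%:R * (2 * pi) + pi *+ 2 :> R.
  by rewrite -natr1 mulrDl mul1r [2 * pi]mulr_natl.
rewrite e (cosD (m%:R * (2 * pi))) (sinD (m%:R * (2 * pi))) IH1 IH2 cos2pi sin2pi.
by split; ring.
Qed.

Lemma prim_cos_cos (m n : nat) : (0 < m)%N -> (0 < n)%N ->
  prim (fun x : R => cos (m%:R * x) * cos (n%:R * x)) (2 * pi) = if m == n then pi else 0.
Proof.
move=> m0 n0.
have [cm sm] := trig_2pin m; have [cn sn] := trig_2pin n.
have cc : continuous (fun x : R => cos (m%:R * x) * cos (n%:R * x)) by cont.
have n0' : n%:R != 0 :> R by rewrite pnatr_eq0 -lt0n.
case: eqVneq => [e|ne].
  rewrite e in cc *.
  have d : antider (fun x : R => x / 2 + sin (n%:R * x) * cos (n%:R * x) / (2 * n%:R))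
      (fun x => cos (n%:R * x) * cos (n%:R * x)).
    eapply antider_eq; [der | move=> y /=].
    have := cos2Dsin2 (n%:R * y : R); move: (cos _) (sin _) => a b h.
    have e2 : b ^+ 2 = 1 - a ^+ 2 by rewrite -h; ring.
    transitivity (2^-1 + (a ^+ 2 - b ^+ 2) / 2); first by field.
    by rewrite e2; field.
  by rewrite (primE d cc) sn !mulr0 sin0; field.
have D0 : m%:R ^+ 2 - n%:R ^+ 2 != 0 :> R.
  by rewrite subr_eq0 -!natrX eqr_nat eqn_exp2r.
have d : antider (fun x : R => (m%:R * sin (m%:R * x) * cos (n%:R * x) - n%:R * cos (m%:R * x) * sin (n%:R * x)) / (m%:R ^+ 2 - n%:R ^+ 2))
      (fun x => cos (m%:R * x) * cos (n%:R * x)).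
  by eapply antider_eq; [der | move=> y /=; field].
by rewrite (primE d cc) sn sm !mulr0 sin0; ring.
Qed.

Lemma prim_cos_sin (m n : nat) : (0 < m)%N -> (0 < n)%N ->
  prim (fun x : R => cos (m%:R * x) * sin (n%:R * x)) (2 * pi) = 0.
Proof.
move=> m0 n0.
have [cm sm] := trig_2pin m; have [cn sn] := trig_2pin n.
have cc : continuous (fun x : R => cos (m%:R * x) * sin (n%:R * x)) by cont.
have n0' : n%:R != 0 :> R by rewrite pnatr_eq0 -lt0n.
case: (eqVneq m n) => [e|ne].
  rewrite e in cc *.
  have d : antider (fun x : R => sin (n%:R * x) ^+ 2 / (2 * n%:R))
      (fun x => cos (n%:R * x) * sin (n%:R * x)).
    by eapply antider_eq; [der | move=> y /=; field].
  by rewrite (primE d cc) sn !mulr0 sin0; ring.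
have D0 : m%:R ^+ 2 - n%:R ^+ 2 != 0 :> R.
  by rewrite subr_eq0 -!natrX eqr_nat eqn_exp2r.
have d : antider (fun x : R => (m%:R * sin (m%:R * x) * sin (n%:R * x) + n%:R * cos (m%:R * x) * cos (n%:R * x)) / (m%:R ^+ 2 - n%:R ^+ 2))
      (fun x => cos (m%:R * x) * sin (n%:R * x)).
  by eapply antider_eq; [der | move=> y /=; field].
by rewrite (primE d cc) sn sm cn cm !mulr0 sin0 cos0; ring.
Qed.

Lemma prim_cos (m : nat) : (0 < m)%N ->
  prim (fun x : R => cos (m%:R * x) * 1) (2 * pi) = 0.
Proof.
move=> m0; have [cm sm] := trig_2pin m.
have m0' : m%:R != 0 :> R by rewrite pnatr_eq0 -lt0n.
have cc : continuous (fun x : R => cos (m%:R * x) * 1) by cont.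
have d : antider (fun x : R => sin (m%:R * x) / m%:R) (fun x => cos (m%:R * x) * 1).
  by eapply antider_eq; [der | move=> y /=; field].
by rewrite (primE d cc) sm !mulr0 sin0; ring.
Qed.

End FourierCoefficients.

(** * Fourier inversion for even functions *)

Section HalfLineIntegral.
Variable R : realType.
Implicit Types (f g F G : R -> R).

Definition exp_decay (l : R) f := exists K, forall y, 0 <= y -> `|f y| <= K * expR (- (l * y)).

(** Improper integral over the half-line, taken as the limit of the primitive, so that integration
    by parts is algebra of antiderivatives. It is meaningful when the primitive converges
    exponentially; [Rintegral_primitive] returns to the Lebesgue integral. *)
Definition half_integral f : R := get [set L | elim_at (prim f) L].

Lemma half_integralP l f : 0 < l -> continuous f -> exp_decay l f ->
  elim_at (prim f) (half_integral f).
Proof.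
move=> l0 cf [K hK]; apply: (@getPex _ [set L | elim_at (prim f) L]).
have [L HL] := tail_limit l0 (prim_antider cf) hK.
by exists L; exists l, (K / l).
Qed.

Lemma half_integralE F f L : antider F f -> continuous f -> elim_at F L ->
  half_integral f = L - F 0.
Proof.
move=> dF cf hL.
have h : elim_at (prim f) (L - F 0).
  apply: (@elim_at_eq _ (fun x => F x + - F 0)) => [|y _]; last by rewrite (primE dF cf).
  exact: elim_at_add hL (elim_at_cst (- F 0)).
have h' : elim_at (prim f) (half_integral f).
  by apply: (@getPex _ [set L | elim_at (prim f) L]); exists (L - F 0).
exact: elim_at_uniq h' h.
Qed.

Lemma half_integral_add l f g : 0 < l -> continuous f -> continuous g ->
  exp_decay l f -> exp_decay l g ->
  half_integral (fun x => f x + g x) = half_integral f + half_integral g.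
Proof.
move=> l0 cf cg ef eg.
rewrite (half_integralE (antiderD (prim_antider cf) (prim_antider cg)) (cont_add cf cg)
  (elim_at_add (half_integralP l0 cf ef) (half_integralP l0 cg eg))).
by rewrite !prim0 // addr0 subr0.
Qed.

Lemma half_integral_scale l f (a : R) : 0 < l -> continuous f -> exp_decay l f ->
  half_integral (fun x => a * f x) = a * half_integral f.
Proof.
move=> l0 cf ef; have df := prim_antider cf.
have d : antider (fun x => a * prim f x) (fun x => a * f x).
  by eapply antider_eq; [der | move=> y /=; ring].
have c : continuous (fun x => a * f x) by cont.
rewrite (half_integralE d c (elim_at_scale a (half_integralP l0 cf ef))).
by rewrite prim0 // mulr0 subr0.
Qed.

Lemma half_integral_bound l K f : 0 < l -> continuous f ->
  (forall y, 0 <= y -> `|f y| <= K * expR (- (l * y))) -> `|half_integral f| <= K / l.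
Proof.
move=> l0 cf hK.
have h := half_integralP l0 cf (ex_intro _ K hK).
have := tail_bound l0 (prim_antider cf) hK h (lexx _).
by rewrite prim0 // sub0r normrN mulr0 oppr0 expR0 mulr1.
Qed.

Lemma exp_decay_mul_bounded l f g (B : R) : exp_decay l f -> (forall y, 0 <= y -> `|g y| <= B) ->
  exp_decay l (fun x => f x * g x).
Proof.
move=> [K hK] hB; exists (K * B) => y y0.
by rewrite normrM mulrAC; apply: ler_pM => //; [exact: hK | exact: hB].
Qed.

Lemma exp_decay_elim l f : 0 < l -> exp_decay l f -> elim_at f 0.
Proof. by move=> l0 [K hK]; exists l, K; split=> // y y0; rewrite subr0 hK. Qed.

Lemma exp_decay_opp l f : exp_decay l f -> exp_decay l (fun x => - f x).
Proof. by move=> [K hK]; exists K => y y0; rewrite normrN hK. Qed.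

Lemma exp_decay_add l f g : exp_decay l f -> exp_decay l g -> exp_decay l (fun x => f x + g x).
Proof.
move=> [K hK] [K' hK']; exists (K + K') => y y0.
by apply: (le_trans (ler_normD _ _)); rewrite mulrDl; apply: lerD; [exact: hK|exact: hK'].
Qed.

Lemma exp_decay_scale l f (a : R) : exp_decay l f -> exp_decay l (fun x => a * f x).
Proof.
move=> [K hK]; exists (`|a| * K) => y y0.
by rewrite normrM -mulrA ler_wpM2l // hK.
Qed.

(** Half of the exponential pays for the factor [x]. *)
Lemma mul_exp_le (l x : R) : 0 < l -> 0 <= x -> x * expR (- (l * x)) <= 2 / l * expR (- (l / 2 * x)).
Proof.
move=> l0 x0.
have -> : - (l * x) = - (l / 2 * x) + - (l / 2 * x) by field.
rewrite expRD mulrA ler_wpM2r ?expR_ge0 //.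
rewrite expRN ler_pdivrMr ?expR_gt0 //.
have h := expR_ge1Dx (l / 2 * x).
have e : x = 2 / l * (l / 2 * x) by field; rewrite gt_eqF.
rewrite [leLHS]e ler_wpM2l ?divr_ge0 ?(ltW l0) //; lra.
Qed.

Lemma exp_decay_mulx l f : 0 < l -> exp_decay l f -> exp_decay (l / 2) (fun x => x * f x).
Proof.
move=> l0 [K hK]; exists (K * (2 / l)) => y y0.
have K0 : 0 <= K by exact: exp_bound_ge0 hK.
rewrite normrM (ger0_norm y0).
apply: (@le_trans _ _ (y * (K * expR (- (l * y))))); first by rewrite ler_wpM2l // hK.
by rewrite mulrCA -mulrA ler_wpM2l // mul_exp_le.
Qed.

Lemma exp_decay_weaken l l' f : l' <= l -> exp_decay l f -> exp_decay l' f.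
Proof.
move=> ll [K hK]; exists K => y y0; apply: (le_trans (hK y y0)).
have K0 : 0 <= K by exact: exp_bound_ge0 hK.
by rewrite ler_wpM2l // expR_mono_rate.
Qed.

(** Decay is asked for on the half-line only; for even and odd functions this controls the whole
    line. *)
Fixpoint decaying_derivatives (l : R) (j : nat) f : Prop :=
  continuous f /\ exp_decay l f /\
  if j is j'.+1 then exists2 f', antider f f' & decaying_derivatives l j' f' else True.

Lemma derive_unique f (x a b : R) : is_derive x 1 f a -> is_derive x 1 f b -> a = b.
Proof. by move=> ha hb; rewrite -(@derive_val _ _ _ _ _ _ _ ha) (@derive_val _ _ _ _ _ _ _ hb). Qed.

Lemma antider_reflect F f : antider F f -> antider (fun x => F (- x)) (fun x => - f (- x)).
Proof.
move=> dF; have id : antider (fun y : R => - y) (fun=> - 1) by der.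
by apply: antider_eq (antider_comp id dF) _ => x /=; rewrite mulrN1.
Qed.

Lemma antider_even F f : antider F f -> (forall x, F (- x) = F x) -> forall x, f (- x) = - f x.
Proof.
move=> dF eF x; have := antider_reflect dF x.
rewrite (_ : (fun x => F (- x)) = F); last by apply/funext.
by move=> h; rewrite (derive_unique (dF x) h) opprK.
Qed.

Lemma antider_odd F f : antider F f -> (forall x, F (- x) = - F x) -> forall x, f (- x) = f x.
Proof.
move=> dF eF x; have := antider_reflect dF x.
rewrite (_ : (fun x => F (- x)) = fun x => - F x); last by apply/funext.
by move=> h; have := derive_unique (antiderN dF x) h; move/oppr_inj.
Qed.

Lemma trig_decay l f (k : R) : continuous f -> exp_decay l f ->
  [/\ continuous (fun x => f x * cos (k * x)), continuous (fun x => f x * sin (k * x)),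
      exp_decay l (fun x => f x * cos (k * x)) & exp_decay l (fun x => f x * sin (k * x))].
Proof.
move=> cf ef; split; [by cont|by cont| |].
- by apply: (@exp_decay_mul_bounded _ _ _ 1) => // y _; exact: cos_max.
- by apply: (@exp_decay_mul_bounded _ _ _ 1) => // y _; exact: sin_max.
Qed.

(** Each integration by parts gains a power of [k] and exchanges cosine and sine along with parity.
    The boundary term at 0 vanishes with the sine in one case and with the odd function in the
    other, hence the simultaneous induction. *)
Lemma decaying_transform (l : R) (j : nat) f : 0 < l -> decaying_derivatives l j f ->
  ((forall x, f (- x) = f x) -> exists C, forall k, `|k| ^+ j * `|half_integral (fun x => f x * cos (k * x))| <= C) /\
  ((forall x, f (- x) = - f x) -> exists C, forall k, `|k| ^+ j * `|half_integral (fun x => f x * sin (k * x))| <= C).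
Proof.
move=> l0; elim: j f => [|j IH] f /=.
  move=> [cf [[K hK] _]]; split=> _; exists (K / l) => k; rewrite expr0 mul1r;
  apply: half_integral_bound => //; try cont.
  - move=> y y0; rewrite normrM -[leRHS]mulr1; apply: ler_pM => //; [exact: hK|exact: cos_max].
  - move=> y y0; rewrite normrM -[leRHS]mulr1; apply: ler_pM => //; [exact: hK|exact: sin_max].
move=> [cf [ef [f' df hf']]].
have [IHe IHo] := IH _ hf'.
have [cf' [ef' _]] : continuous f' /\ exp_decay l f' /\ True by case: (j) hf' => [|i] /= [? [? _]].
split=> pf.
- have [C hC] := IHo (antider_even df pf); exists C => k.
  have [c1 c2 e1 e2] := trig_decay k cf ef; have [c1' c2' e1' e2'] := trig_decay k cf' ef'.
  have d : antider (fun x => f x * sin (k * x)) (fun x => k * (f x * cos (k * x)) + f' x * sin (k * x)).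
    by eapply antider_eq; [der | move=> y /=; ring].
  have c : continuous (fun x => k * (f x * cos (k * x))) by cont.
  have := half_integralE d (cont_add c c2') (exp_decay_elim l0 e2).
  rewrite (half_integral_add l0) ?(half_integral_scale _ l0) //; last exact: exp_decay_scale.
  rewrite mulr0 sin0 mulr0 subrr => /eqP; rewrite addr_eq0 => /eqP h.
  by rewrite exprSr -mulrA -normrM h normrN.
- have [C hC] := IHe (antider_odd df pf); exists C => k.
  have [c1 c2 e1 e2] := trig_decay k cf ef; have [c1' c2' e1' e2'] := trig_decay k cf' ef'.
  have d : antider (fun x => f x * cos (k * x)) (fun x => - k * (f x * sin (k * x)) + f' x * cos (k * x)).
    by eapply antider_eq; [der | move=> y /=; ring].
  have c : continuous (fun x => - k * (f x * sin (k * x))) by cont.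
  have := half_integralE d (cont_add c c1') (exp_decay_elim l0 e1).
  have f0 : f 0 = 0 by have := pf 0; rewrite oppr0 => h; lra.
  rewrite (half_integral_add l0) ?(half_integral_scale _ l0) //; last exact: exp_decay_scale.
  rewrite f0 mul0r subrr mulNr => /eqP; rewrite addrC subr_eq0 => /eqP h.
  by rewrite exprSr -mulrA -normrM -h.
Qed.

Lemma norm_le_derive (F f : R -> R) (B : R) x y : antider F f -> (forall t, `|f t| <= B) ->
  `|F x - F y| <= B * `|x - y|.
Proof.
move=> dF hB.
have d : antider (fun t => B * t) (fun=> B) by eapply antider_eq; [der | move=> t /=; ring].
have key a b : a <= b -> `|F b - F a| <= B * `|b - a|.
  move=> ab; have := norm_le_of_derive_le ab (fun x _ => dF x) (fun x _ => d x) (fun x _ => hB x).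
  by rewrite -mulrBr [`|b - a|]ger0_norm // subr_ge0.
have [/key //|/ltW /key] := leP y x.
by rewrite distrC [`|y - x|]distrC.
Qed.

Lemma cos_lip (a b : R) : `|cos a - cos b| <= `|a - b|.
Proof.
rewrite -[leRHS]mul1r; apply: norm_le_derive (@antider_cos R) _ => t.
by rewrite normrN sin_max.
Qed.

Lemma sin_taylor (a h : R) : `|sin (a + h) - sin a - h * cos a| <= h ^+ 2.
Proof.
have key (b t : R) : 0 <= t -> `|sin (b + t) - sin b - t * cos b| <= t ^+ 2.
  move=> t0.
  have d1 : antider (fun t => sin (b + t) - t * cos b) (fun t => cos (b + t) - cos b).
    by eapply antider_eq; [der | move=> y /=; ring].
  have d2 : antider (fun t : R => t ^+ 2 / 2) (fun t => t).
    by eapply antider_eq; [der | move=> y /=; field].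
  have := norm_le_of_derive_le t0 (fun x _ => d1 x) (fun x _ => d2 x).
  rewrite addr0 mul0r subr0 expr0n /= mul0r subr0.
  have -> : sin (b + t) - t * cos b - sin b = sin (b + t) - sin b - t * cos b by ring.
  move=> h1; apply: (le_trans (h1 _)); last by have := sqr_ge0 t; lra.
  move=> x /andP[x0 _]; apply: (le_trans (cos_lip _ _)).
  by rewrite addrAC subrr add0r ger0_norm.
have [/key //|h0] := leP 0 h.
have := key (- a) (- h); rewrite oppr_ge0 => /(_ (ltW h0)).
rewrite -opprD !sinN cosN sqrrN.
by have -> : - sin (a + h) - - sin a - - h * cos a = - (sin (a + h) - sin a - h * cos a); [ring|rewrite normrN].
Qed.

(** Used to differentiate the sine transform in its parameter: [sin_taylor] under the integral gives
    such a quadratic remainder. *)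
Lemma is_derive_quadratic (G : R -> R) (k d C : R) :
  (forall h, `|G (k + h) - G k - h * d| <= C * h ^+ 2) -> is_derive k 1 G d.
Proof.
move=> hC.
have C0 : 0 <= C by have := hC 1; rewrite expr1n mulr1; apply: le_trans.
have lim : h^-1 *: ((G \o shift k) (h *: (1 : R)) - G k) @[h --> 0^'] --> d.
  apply/cvgrPdist_lt => e e0.
  have e1 : 0 < e / (C + 1) by rewrite divr_gt0 // ltr_wpDl.
  near=> h.
  have h0 : h != 0 by near: h; exact: nbhs_dnbhs_neq.
  have hs : `|h| < e / (C + 1) by near: h; apply: dnbhs0_lt.
  rewrite /= /GRing.scale /= mulr1 [h + k]addrC.
  have -> : d - h^-1 * (G (k + h) - G k) = - (h^-1 * (G (k + h) - G k - h * d)) by field.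
  rewrite normrN normrM normfV mulrC ltr_pdivrMr ?normr_gt0 //.
  apply: (le_lt_trans (hC h)); rewrite -[h ^+ 2]real_normK ?num_real // expr2 mulrA.
  rewrite ltr_pM2r ?normr_gt0 //.
  move: hs; rewrite ltr_pdivlMr ?ltr_wpDl // mulrDr mulr1 [_ * C]mulrC => hs.
  by apply: le_lt_trans hs; rewrite lerDl.
have dd : derivable G k 1 by apply/cvg_ex; exists d.
by apply: DeriveDef => //; apply/cvg_lim.
Unshelve. all: by end_near. Qed.

Lemma half_transform_lipschitz l f : 0 < l -> continuous f -> exp_decay l f ->
  exists C, forall k k', `|half_integral (fun x => f x * cos (k * x)) -
    half_integral (fun x => f x * cos (k' * x))| <= C * `|k - k'|.
Proof.
move=> l0 cf ef; have [K hK] := exp_decay_mulx l0 ef.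
have l2 : 0 < l / 2 by rewrite divr_gt0.
exists (K / (l / 2)) => k k'.
have [c1 c2 e1 e2] := trig_decay k cf ef; have [c1' c2' e1' e2'] := trig_decay k' cf ef.
have -> : half_integral (fun x => f x * cos (k * x)) -
    half_integral (fun x => f x * cos (k' * x)) =
  half_integral (fun x => f x * cos (k * x) + - 1 * (f x * cos (k' * x))).
  rewrite (half_integral_add l0) ?(half_integral_scale _ l0) ?mulN1r //; first by cont.
  exact: exp_decay_scale.
have -> : K / (l / 2) * `|k - k'| = K * `|k - k'| / (l / 2) by ring.
apply: half_integral_bound => //; first by cont.
move=> y y0; have -> : f y * cos (k * y) + -1 * (f y * cos (k' * y)) = f y * (cos (k * y) - cos (k' * y)) by ring.
rewrite normrM; apply: (@le_trans _ _ (`|f y| * (`|y| * `|k - k'|))).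
  rewrite ler_wpM2l // (le_trans (cos_lip _ _)) // -mulrBl normrM mulrC //.
rewrite mulrA -normrM [f y * y]mulrC [leRHS]mulrAC ler_wpM2r //.
exact: hK.
Qed.

End HalfLineIntegral.

(** * Sine transform of a quotient that is regular at 0 *)

Section SineTransform.
Variable R : realType.

(** Evenly extended so as to be continuous on the whole line. At 0 division by zero returns 0, which
    is the right value when [P] is quadratically small there. *)
Definition ratio (P : R -> R) (x : R) : R := P `|x| / `|x|.

Lemma elim_at_le (F : R -> R) (L B y0 : R) : elim_at F L -> 0 <= y0 ->
  (forall y, y0 <= y -> `|F y| <= B) -> `|L| <= B.
Proof.
move=> [l [K [l0 h]]] y00 hB; rewrite leNgt; apply/negP => BL.
have K0 : 0 <= K by exact: exp_bound_ge0 h.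
have e : `|L| - B = 0.
  apply: (@expR_small0 _ l K _ l0) => y yy.
  rewrite gtr0_norm ?subr_gt0 //.
  have h1 : y0 <= y0 + y by rewrite lerDl.
  apply: (@le_trans _ _ `|F (y0 + y) - L|).
    have := hB _ h1; have := ler_normB (F (y0 + y)) (F (y0 + y) - L).
    rewrite opprB addrCA subrr addr0; lra.
  apply: (le_trans (h _ (le_trans y00 h1))); rewrite ler_wpM2l // ler_expR lerN2.
  by rewrite ler_wpM2l ?(ltW l0) // lerDr.
by move: BL; rewrite -subr_gt0 e ltxx.
Qed.

Lemma ratio_continuous (P : R -> R) (C : R) : continuous P ->
  (forall x, 0 <= x -> `|P x| <= C * x ^+ 2) -> continuous (ratio P).
Proof.
move=> cP hC x.
have [x0|x0] := eqVneq x 0; last first.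
  have c1 : continuous (fun x : R => `|x|) by cont.
  have xn : `|x| != 0 by rewrite normr_eq0.
  have h1 : {for x, continuous (fun x => P `|x|)} := cont_comp c1 cP (x := x).
  have h2 : {for x, continuous (fun x : R => `|x|^-1)} by exact: (cvgV xn (c1 x)).
  have : {for x, continuous (fun x => P `|x| * `|x|^-1)} by exact: (cvgM h1 h2).
  by [].
have C0 : 0 <= C by have := hC 1 ler01; rewrite expr1n mulr1; apply: le_trans.
have bd (y : R) : `|ratio P y| <= C * `|y|.
  have [->|y0] := eqVneq y 0; first by rewrite /ratio normr0 invr0 mulr0 normr0 mulr0.
  have ny : 0 < `|y| by rewrite normr_gt0.
  rewrite /ratio normrM normfV normr_id ler_pdivrMr // -mulrA -expr2; exact: hC.
have r0 : ratio P 0 = 0 by rewrite /ratio normr0 invr0 mulr0.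
rewrite x0; apply/cvgrPdist_lt => e e0; rewrite r0.
have e1 : 0 < e / (C + 1) by rewrite divr_gt0 // ltr_wpDl.
near=> y; rewrite sub0r normrN; apply: (le_lt_trans (bd y)).
have : `|0 - y| < e / (C + 1).
  by near: y; have /cvgrPdist_lt /(_ _ e1) := @cont_id R 0; apply.
rewrite sub0r normrN ltr_pdivlMr ?ltr_wpDl // mulrDr mulr1 [_ * C]mulrC => hs.
by apply: le_lt_trans hs; rewrite lerDl.
Unshelve. all: by end_near. Qed.

(** Beyond 1 the division does no harm. Below 1 the quotient is at most [C], and the factor [exp l]
    compensates for the weight. *)
Lemma ratio_decay (P : R -> R) (C K l : R) : 0 < l ->
  (forall x, 0 <= x -> `|P x| <= C * x ^+ 2) ->
  (forall x, 0 <= x -> `|P x| <= K * expR (- (l * x))) -> exp_decay l (ratio P).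
Proof.
move=> l0 hC hK.
have C0 : 0 <= C by have := hC 1 ler01; rewrite expr1n mulr1; apply: le_trans.
have K0 : 0 <= K by exact: exp_bound_ge0 hK.
exists (K + C * expR l) => y y0; rewrite /ratio (ger0_norm y0).
have E0 := expR_ge0 (- (l * y)).
have [y1|y1] := leP 1 y.
  have yp : 0 < y by apply: lt_le_trans y1.
  rewrite normrM normfV (gtr0_norm yp) ler_pdivrMr //.
  apply: (le_trans (hK y y0)); rewrite mulrDl -[leLHS]mulr1.
  apply: ler_pM => //; first exact: mulr_ge0.
  by rewrite lerDl mulr_ge0 // mulr_ge0 // expR_ge0.
rewrite mulrDl; apply: (@le_trans _ _ (C * expR l * expR (- (l * y)))); last first.
  by rewrite lerDr mulr_ge0.
have [->|yn] := eqVneq y 0; first by rewrite invr0 mulr0 normr0 !mulr_ge0 ?expR_ge0.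
have yp : 0 < y by rewrite lt_neqAle eq_sym yn.
rewrite normrM normfV (gtr0_norm yp) ler_pdivrMr //.
apply: (le_trans (hC y y0)); rewrite expr2 mulrA ler_wpM2r //.
rewrite -mulrA -expRD ler_wpM2l //; apply: (@le_trans _ _ 1); first exact: ltW.
rewrite -expR0 ler_expR subr_ge0 -[leRHS]mulr1 ler_wpM2l ?(ltW l0) // ltW //.
Qed.

(* Riemann-Lebesgue: integrate by parts away from 0 only, where P / x is smooth. *)
Lemma ratio_riemann_lebesgue (P P' : R -> R) (C K l : R) : 0 < l ->
  antider P P' -> 
  (forall x, 0 <= x -> `|P x| <= C * x ^+ 2) ->
  (forall x, 0 <= x -> `|P x| <= K * expR (- (l * x)) /\ `|P' x| <= K * expR (- (l * x))) ->
  half_integral (fun x => ratio P x * sin (k * x)) @[k --> +oo] --> 0.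
Proof.
move=> l0 dP hC hK.
have C0 : 0 <= C by have := hC 1 ler01; rewrite expr1n mulr1; apply: le_trans.
have K0 : 0 <= K by have [+ _] := hK 0 (lexx _); rewrite mulr0 oppr0 expR0 mulr1; apply: le_trans.
have cP := antider_continuous dP.
have cr := ratio_continuous cP hC.
have er := ratio_decay l0 hC (fun x h => (hK x h).1).
have bd (y : R) : 0 <= y -> `|ratio P y| <= C * y.
  move=> y0; rewrite /ratio (ger0_norm y0).
  have [->|yn] := eqVneq y 0; first by rewrite invr0 mulr0 normr0 mulr0.
  have yp : 0 < y by rewrite lt_neqAle eq_sym yn.
  by rewrite normrM normfV (gtr0_norm yp) ler_pdivrMr // -mulrA -expr2 hC.
have [Kr hr] := er.
have Kr0 : 0 <= Kr by exact: exp_bound_ge0 hr.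
(* The interval from 0 to [d] contributes [C d] and the rest [D / k], with [D] depending on [d]; [d]
   is fixed before [k] is sent to infinity. *)
have key (d : R) : 0 < d -> d <= 1 -> exists2 D, 0 <= D &
    forall k, 0 < k -> `|half_integral (fun x => ratio P x * sin (k * x))| <= C * d + D / k.
  move=> d0 d1.
  pose Kd := K * (d^-1 + d^-1 ^+ 2).
  have Kd0 : 0 <= Kd by rewrite mulr_ge0 // addr_ge0 ?exprn_ge0 // invr_ge0 ltW.
  exists (2 * Kr + Kd / l); first by apply: addr_ge0; [exact: mulr_ge0 | rewrite divr_ge0 // ltW].
  move=> k k0; have kn : k != 0 by rewrite gt_eqF.
  have [c1 c2 e1 e2] := trig_decay k cr er.
  have hJ := half_integralP l0 c2 e2.
  have dJ := prim_antider c2.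
  set Q := prim _ in hJ dJ; set J := half_integral _ in hJ *.
  have Qd : `|Q d| <= C * d.
    have dd : antider (fun x => C * d * x) (fun=> C * d).
      by eapply antider_eq; [der | move=> t /=; ring].
    have := norm_le_of_derive_le (ltW d0) (fun x _ => dJ x) (fun x _ => dd x).
    rewrite /Q prim0 // !subr0 mulr0 subr0 => h; apply: (le_trans (h _)).
      move=> x /andP[x0 x1]; rewrite normrM -[leRHS]mulr1.
      apply: ler_pM => //; last exact: sin_max.
      by apply: (le_trans (bd x x0)); rewrite ler_wpM2l.
    by rewrite ler_piMr // mulr_ge0 // ltW.
  have rE (x : R) : 0 < x -> ratio P x = P x / x by move=> x0; rewrite /ratio gtr0_norm.
  (* Boundary term of the integration by parts; [g] is the derivative of [P / x], and [Q - F] has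
     the derivative [g cos (k x) / k], of size [1 / k]. *)
  pose F x := - (P x * x^-1 * (cos (k * x) / k)).
  pose g x := (P' x * x - P x) / x ^+ 2.
  have dF (x : R) : 0 < x -> is_derive x 1 F (- g x * cos (k * x) / k + P x / x * sin (k * x)).
    move=> x0; have xn : x != 0 by rewrite gt_eqF.
    have dx := is_derive_inv xn (@antider_id R x).
    have dk : antider (fun x => cos (k * x) / k) (fun x => - sin (k * x)).
      by eapply antider_eq; [der | move=> t /=; field].
    have h1 := is_derive_mul (is_derive_mul (dP x) dx) (dk x).
    have h2 := is_deriveN h1; apply: (is_derive_eq h2).
    by rewrite /g; field; rewrite xn.
  have Fb (x : R) : d <= x -> `|F x| <= Kr / k.
    move=> dx; have x0 : 0 < x by apply: lt_le_trans dx.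
    rewrite /F -rE // normrN normrM; apply: ler_pM => //.
      apply: (le_trans (hr x (ltW x0))); rewrite ler_piMr // expR_le1 oppr_le0.
      by rewrite mulr_ge0 // ltW.
    by rewrite normrM normfV (gtr0_norm k0) -[leRHS]mul1r ler_wpM2r ?invr_ge0 ?(ltW k0) // cos_max.
  have gb (x : R) : d <= x -> `|g x| <= Kd * expR (- (l * x)).
    move=> dx; have x0 : 0 < x by apply: lt_le_trans dx.
    have xn : x != 0 by rewrite gt_eqF.
    have [h1 h2] := hK x (ltW x0).
    have -> : g x = P' x * x^-1 - P x * x^-1 ^+ 2 by rewrite /g; field.
    have xi : x^-1 <= d^-1 by rewrite lef_pV2 ?posrE.
    have xi0 : 0 <= x^-1 by rewrite invr_ge0 ltW.
    have xi2 : x^-1 ^+ 2 <= d^-1 ^+ 2.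
      by rewrite ler_pXn2r ?nnegrE // invr_ge0 ltW.
    have -> : Kd * expR (- (l * x)) = K * expR (- (l * x)) * d^-1 + K * expR (- (l * x)) * d^-1 ^+ 2.
      by rewrite /Kd; ring.
    apply: (le_trans (ler_normB _ _)); rewrite (normrM (P' x)) (normrM (P x)).
    rewrite (ger0_norm xi0) (ger0_norm (exprn_ge0 2 xi0)).
    by apply: lerD; apply: ler_pM => //; exact: exprn_ge0.
  have Tb (y : R) : d <= y -> `|Q y| <= C * d + (2 * Kr + Kd / l) / k.
    move=> dy.
    have E : antider (fun x => Kd / k * (- expR (- (l * x)) / l)) (fun x => Kd / k * expR (- (l * x))).
      have En := antider_expN (lt0r_neq0 l0); eapply antider_eq; first der.
      by move=> x /=; ring.
    have dT (x : R) : d <= x <= y -> is_derive x 1 (fun x => Q x - F x) (g x * cos (k * x) / k).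
      move=> /andP[dx _]; have x0 : 0 < x by apply: lt_le_trans dx.
      have h := is_deriveB (dJ x) (dF x x0); apply: (is_derive_eq h).
      by rewrite rE //; ring.
    have := norm_le_of_derive_le dy dT (fun x _ => E x).
    have ge (x : R) : d <= x <= y -> `|g x * cos (k * x) / k| <= Kd / k * expR (- (l * x)).
      move=> /andP[dx _]; rewrite normrM normfV (gtr0_norm k0) [leRHS]mulrAC.
      rewrite ler_wpM2r ?invr_ge0 ?(ltW k0) // normrM -[leRHS]mulr1.
      by apply: ler_pM => //; [exact: gb | exact: cos_max].
    move=> /(_ ge) h.
    have h2 : Kd / k * (- expR (- (l * y)) / l) - Kd / k * (- expR (- (l * d)) / l) <= Kd / l / k.
      have -> : Kd / k * (- expR (- (l * y)) / l) - Kd / k * (- expR (- (l * d)) / l) =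
        Kd / l / k * (expR (- (l * d)) - expR (- (l * y))) by ring.
      rewrite ler_piMr //; first by rewrite divr_ge0 ?divr_ge0 // ltW.
      have := expR_ge0 (- (l * y)); have : expR (- (l * d)) <= 1.
        by rewrite expR_le1 oppr_le0 mulr_ge0 // ltW.
      lra.
    have h3 := Fb y dy; have h4 := Fb d (lexx _).
    have -> : Q y = (Q y - F y - (Q d - F d)) + (Q d + (F y - F d)) by ring.
    apply: (le_trans (ler_normD _ _)).
    have h5 := ler_normD (Q d) (F y - F d); have h6 := ler_normB (F y) (F d).
    have -> : (2 * Kr + Kd / l) / k = 2 * (Kr / k) + Kd / l / k by ring.
    move: (Kd / l / k) (Kr / k) h2 h3 h4 h => a b h2 h3 h4 h; lra.
  exact: (elim_at_le hJ (ltW d0) Tb).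
apply/cvgrPdist_lt => e e0.
pose d := Num.min 1 (e / (2 * (C + 1))).
have C1 : 0 < C + 1 by rewrite ltr_wpDl.
have d0 : 0 < d by rewrite lt_min ltr01 divr_gt0 // mulr_gt0.
have d1 : d <= 1 by rewrite ge_min lexx.
have d2 : C * d <= e / 2.
  have : d <= e / (2 * (C + 1)) by rewrite ge_min lexx orbT.
  rewrite ler_pdivlMr ?mulr_gt0 // => h.
  have -> : C * d = (d * (2 * (C + 1)) - 2 * d) / 2 by field.
  by rewrite ler_wpM2r ?invr_ge0 // lerBlDr (le_trans h) // lerDl mulr_ge0 // ltW.
have [D D0 hD] := key d d0 d1.
near=> k; rewrite sub0r normrN.
have k0 : 0 < k by near: k; exact: nbhs_pinfty_gt.
have kD : 2 * D / e < k by near: k; apply: nbhs_pinfty_gt; exact: num_real.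
apply: (le_lt_trans (hD k k0)).
have : D / k < e / 2.
  rewrite ltr_pdivrMr //; move: kD; rewrite ltr_pdivrMr // => kD.
  have -> : e / 2 * k = k * e / 2 by ring.
  by rewrite ltr_pdivlMr // mulrC.
lra.
Unshelve. all: by end_near. Qed.

End SineTransform.

(** * Inversion of the cosine transform at 0 *)

Section InversionAtZero.
Variable R : realType.

(** Needed because [ratio] involves [|x|]: the identity [P x = x * ratio P x] is available for
    [x >= 0]. *)
Lemma half_integral_ext (l : R) (f g : R -> R) : 0 < l -> continuous f -> continuous g ->
  exp_decay l f -> (forall y, 0 <= y -> f y = g y) -> half_integral f = half_integral g.
Proof.
move=> l0 cf cg ef fg.
have df := prim_antider cf; have dg := prim_antider cg.
rewrite (half_integralE dg cg (L := half_integral f)) ?prim0 ?subr0 //.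
apply: (elim_at_eq (half_integralP l0 cf ef)) => y y0.
have d : antider (fun x => prim f x - prim g x) (fun x => f x - g x) by exact: antider_sub.
have := norm_le_of_derive_le y0 (fun x _ => d x) (fun x _ => antider_cst 0 x).
rewrite !prim0 // !subr0 => h; apply/eqP; rewrite -subr_eq0 -normr_le0; apply: h.
by move=> x /andP[x0 _]; rewrite fg // subrr normr0.
Qed.

Lemma add1_exp_le1 (x : R) : 0 <= x -> `|(x - 1) * expR (- x)| <= 1.
Proof.
move=> x0; rewrite normrM [`|expR _|]ger0_norm ?expR_ge0 // expRN ler_pdivrMr ?expR_gt0 // mul1r.
apply: le_trans (expR_ge1Dx x); rewrite ler_norml; apply/andP; split; lra.
Qed.

Lemma add1_exp_decay : @exp_decay R 2^-1 (fun x => (1 + x) * expR (- x)).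
Proof.
exists 2 => x x0; rewrite ger0_norm ?mulr_ge0 ?expR_ge0 ?addr_ge0 //.
have -> : - x = - (2^-1 * x) + - (2^-1 * x) by field.
rewrite expRD mulrA ler_wpM2r ?expR_ge0 // expRN ler_pdivrMr ?expR_gt0 //.
have := expR_ge1Dx (2^-1 * x); lra.
Qed.

Lemma reference_transform (k : R) :
  half_integral (fun x => (1 + x) * expR (- x) * cos (k * x)) = 2 / (1 + k ^+ 2) ^+ 2.
Proof.
have q0 : 1 + k ^+ 2 != 0 by rewrite gt_eqF // ltr_wpDr // sqr_ge0.
(* Undetermined coefficients for an antiderivative of the same shape; its value at 0 is [a], so the
   integral is [- a]. *)
pose b := - (1 + k ^+ 2)^-1; pose a := - (2 / (1 + k ^+ 2) ^+ 2).
pose d := k / (1 + k ^+ 2); pose c := k / (1 + k ^+ 2) + 2 * k / (1 + k ^+ 2) ^+ 2.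
pose F x := expR (- x) * ((a + b * x) * cos (k * x) + (c + d * x) * sin (k * x)).
have dF : antider F (fun x => (1 + x) * expR (- x) * cos (k * x)).
  eapply antider_eq; [rewrite /F; der | move=> x /=].
  by rewrite /a /b /c /d; field.
have cf : continuous (fun x : R => (1 + x) * expR (- x) * cos (k * x)) by cont.
have lF : elim_at F 0.
  exists 2^-1, ((`|a| + `|b| + (`|c| + `|d|)) * 2); split; first by rewrite invr_gt0.
  move=> y y0; rewrite subr0 /F normrM [`|expR _|]ger0_norm ?expR_ge0 //.
  have [K hK] := add1_exp_decay.
  have h2 : (1 + y) * expR (- y) <= 2 * expR (- (2^-1 * y)).
    have -> : - y = - (2^-1 * y) + - (2^-1 * y) by field.
    rewrite expRD mulrA ler_wpM2r ?expR_ge0 // expRN ler_pdivrMr ?expR_gt0 //.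
    have := expR_ge1Dx (2^-1 * y); lra.
  have lin (s t : R) : `|s + t * y| <= (`|s| + `|t|) * (1 + y).
    apply: (le_trans (ler_normD _ _)); rewrite normrM (ger0_norm y0).
    have := mulr_ge0 (normr_ge0 s) y0; have := normr_ge0 t; nra.
  have h3 (a1 b1 c1 d1 : R) : `|(a1 + b1 * y) * cos (k * y) + (c1 + d1 * y) * sin (k * y)| <=
      (`|a1| + `|b1| + (`|c1| + `|d1|)) * (1 + y).
    apply: (le_trans (ler_normD _ _)); rewrite !normrM mulrDl; apply: lerD.
      by rewrite -[leRHS]mulr1; apply: ler_pM; rewrite ?lin ?cos_max.
    by rewrite -[leRHS]mulr1; apply: ler_pM; rewrite ?lin ?sin_max.
  apply: (@le_trans _ _ ((`|a| + `|b| + (`|c| + `|d|)) * ((1 + y) * expR (- y)))).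
    by rewrite mulrC mulrA ler_wpM2r // expR_ge0.
  by rewrite -mulrA ler_wpM2l // !addr_ge0.
rewrite (half_integralE dF cf lF) /F !mulr0 oppr0 expR0 cos0 sin0 /a; ring.
Qed.

Lemma even_transform_primitive (l : R) (F : R -> R) : 0 < l ->
  decaying_derivatives l 2 F -> (forall x, F (- x) = F x) ->
  exists A : R -> R, [/\ antider A (fun k => half_integral (fun x => F x * cos (k * x))),
    A 0 = 0 & A k @[k --> +oo] --> F 0 * (pi / 2)].
Proof.
move=> l0 [cF [eF [F' dF [cF' [eF' [F'' dF' [cF'' [eF'' _]]]]]]]] evF.
have [K2 hK2] := eF''.
pose lm := Num.min l 2^-1.
have lm0 : 0 < lm by rewrite lt_min l0 invr_gt0 ltr0n.
have lml : lm <= l by rewrite ge_min lexx.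
have lmh : lm <= 2^-1 by rewrite ge_min lexx orbT.
pose h (x : R) := (1 + x) * expR (- x).
have dh : antider h (fun x => - (x * expR (- x))).
  by eapply antider_eq; [rewrite /h; der | move=> x /=; ring].
have ch := antider_continuous dh.
(* As [h 0 = 1], [h' 0 = 0] and [F' 0 = 0] by evenness, both [P] and [P'] vanish at 0. *)
pose P x := F x - F 0 * h x; pose P' x := F' x + F 0 * (x * expR (- x)).
have dP : antider P P'.
  by eapply antider_eq; [rewrite /P; der | move=> x /=; rewrite /P'; ring].
have dP' : antider P' (fun x => F'' x - F 0 * ((x - 1) * expR (- x))).
  by eapply antider_eq; [rewrite /P'; der | move=> x /=; ring].
have cP := antider_continuous dP; have cP' := antider_continuous dP'.
have P0 : P 0 = 0 by rewrite /P /h oppr0 expR0; ring.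
have P'0 : P' 0 = 0.
  have odd0 (t : R) : t = - t -> t = 0 by move=> ?; lra.
  have := antider_even dF evF 0; rewrite oppr0 => /odd0 h0.
  by rewrite /P' h0 mul0r mulr0 addr0.
have K20 : 0 <= K2 by exact: exp_bound_ge0 hK2.
pose C := K2 + `|F 0|.
have C0 : 0 <= C by rewrite addr_ge0.
have bP'' x : 0 <= x -> `|F'' x - F 0 * ((x - 1) * expR (- x))| <= C.
  move=> x0; apply: (le_trans (ler_normB _ _)); apply: lerD.
    apply: (le_trans (hK2 x x0)); rewrite ler_piMr // expR_le1 oppr_le0.
    by rewrite mulr_ge0 // ltW.
  by rewrite normrM ler_piMr // add1_exp_le1.
have bP' x : 0 <= x -> `|P' x| <= C * x.
  move=> x0; have d : antider (fun x => C * x) (fun=> C) by eapply antider_eq; [der | move=> t /=; ring].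
  have := norm_le_of_derive_le x0 (fun x _ => dP' x) (fun x _ => d x).
  by rewrite P'0 mulr0 !subr0; apply=> t /andP[t0 _]; apply: bP''.
have bP x : 0 <= x -> `|P x| <= C * x ^+ 2.
  move=> x0; have d : antider (fun x => C * x ^+ 2 / 2) (fun x => C * x).
    by eapply antider_eq; [der | move=> t /=; field].
  have := norm_le_of_derive_le x0 (fun x _ => dP x) (fun x _ => d x).
  rewrite P0 expr0n /= mulr0 mul0r !subr0 => hh; apply: (le_trans (hh _)).
    by move=> t /andP[t0 _]; apply: bP'.
  by rewrite ler_pdivrMr // ler_peMr ?mulr_ge0 ?sqr_ge0 // (_ : 1 <= 2) // ler1n.
have eh : exp_decay lm h by apply: exp_decay_weaken lmh _; exact: add1_exp_decay.
have ex : exp_decay lm (fun x : R => x * expR (- x)).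
  apply: exp_decay_weaken lmh _; exists 2 => y y0.
  rewrite ger0_norm ?mulr_ge0 ?expR_ge0 //.
  by have := mul_exp_le ltr01 y0; rewrite mul1r divr1 div1r.
have eP : exp_decay lm P.
  apply: (@exp_decay_add _ _ F (fun x => - (F 0 * h x))); first exact: exp_decay_weaken lml _.
  by apply: exp_decay_opp; exact: exp_decay_scale.
have eP' : exp_decay lm P'.
  apply: (@exp_decay_add _ _ F' (fun x => (F 0 * (x * expR (- x))))); first exact: exp_decay_weaken lml _.
  exact: exp_decay_scale.
have [Ka hKa] := eP; have [Kb hKb] := eP'.
have Ka0 : 0 <= Ka by exact: exp_bound_ge0 hKa.
have Kb0 : 0 <= Kb by exact: exp_bound_ge0 hKb.
have hK x : 0 <= x -> `|P x| <= (Ka + Kb) * expR (- (lm * x)) /\ `|P' x| <= (Ka + Kb) * expR (- (lm * x)).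
  move=> x0; split; [apply: (le_trans (hKa x x0)) | apply: (le_trans (hKb x x0))];
  by rewrite ler_wpM2r ?expR_ge0 // ?lerDl ?lerDr.
have RL := ratio_riemann_lebesgue lm0 dP bP hK.
have cr := ratio_continuous cP bP.
have er := ratio_decay lm0 bP (fun x h => (hK x h).1).
pose G k := half_integral (fun x => ratio P x * sin (k * x)).
(* Each of the two factors [x] in the quadratic Taylor remainder halves the rate. *)
have l4 : 0 < lm / 2 / 2 by rewrite !divr_gt0.
have l42 : lm / 2 / 2 <= lm by lra.
have er4 := exp_decay_weaken l42 er.
have [K4 hK4] := exp_decay_mulx (divr_gt0 lm0 (ltr0Sn _ 1)) (exp_decay_mulx lm0 er).
have xr x : 0 <= x -> P x = x * ratio P x.
  move=> x0; rewrite /ratio ger0_norm //.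
  by have [->|xn] := eqVneq x 0; [rewrite P0 mul0r | rewrite mulrC divfK].
have cxr : continuous (fun x : R => x * ratio P x) by cont.
have exr4 : exp_decay (lm / 2 / 2) (fun x => x * ratio P x).
  by apply: exp_decay_weaken (exp_decay_mulx lm0 er); lra.
have dG : antider G (fun k => half_integral (fun x => P x * cos (k * x))).
  move=> k; apply: (@is_derive_quadratic _ _ _ _ (K4 / (lm / 2 / 2))) => t.
  have [c1 c2 e1 e2] := trig_decay k cr er4.
  have [c1' c2' e1' e2'] := trig_decay (k + t) cr er4.
  have [c1x c2x e1x e2x] := trig_decay k cxr exr4.
  have [c1P c2P e1P e2P] := trig_decay k cP eP.
  have -> : half_integral (fun x => P x * cos (k * x)) =
    half_integral (fun x => x * ratio P x * cos (k * x)).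
    by apply: (half_integral_ext lm0) => // y y0; rewrite xr.
  have -> : G (k + t) - G k - t * half_integral (fun x => x * ratio P x * cos (k * x)) =
    half_integral (fun x => ratio P x * sin ((k + t) * x) +
       (- 1 * (ratio P x * sin (k * x)) + - t * (x * ratio P x * cos (k * x)))).
    have s1 : exp_decay (lm / 2 / 2) (fun x => - 1 * (ratio P x * sin (k * x))) by exact: exp_decay_scale.
    have s2 : exp_decay (lm / 2 / 2) (fun x => - t * (x * ratio P x * cos (k * x))) by exact: exp_decay_scale.
    have c3 : continuous (fun x : R => - 1 * (ratio P x * sin (k * x))) by cont.
    have c4 : continuous (fun x : R => - t * (x * ratio P x * cos (k * x))) by cont.
    have c5 := cont_add c3 c4; have e5 := exp_decay_add s1 s2.
    rewrite (half_integral_add l4 c2' c5 e2' e5) (half_integral_add l4 c3 c4 s1 s2).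
    rewrite (half_integral_scale _ l4 c2 e2) (half_integral_scale _ l4 c1x e1x) /G.
    by rewrite mulN1r mulNr addrA.
  rewrite [leRHS]mulrAC; apply: half_integral_bound => //; first by cont.
  move=> y y0.
  have -> : ratio P y * sin ((k + t) * y) + (- 1 * (ratio P y * sin (k * y)) + - t * (y * ratio P y * cos (k * y))) =
    ratio P y * (sin (k * y + t * y) - sin (k * y) - t * y * cos (k * y)).
    by rewrite -mulrDl; ring.
  rewrite normrM; apply: (@le_trans _ _ (`|ratio P y| * (t * y) ^+ 2)).
    by rewrite ler_wpM2l // sin_taylor.
  have h4 := hK4 y y0; rewrite [leRHS]mulrAC.
  have -> : `|ratio P y| * (t * y) ^+ 2 = `|y * (y * ratio P y)| * t ^+ 2.
    by rewrite !normrM (ger0_norm y0); ring.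
  by rewrite ler_wpM2r ?sqr_ge0.
have q0 (k : R) : 1 + k ^+ 2 != 0 by rewrite gt_eqF // ltr_wpDr // sqr_ge0.
have dat : antider (@atan R) (fun x => (1 + x ^+ 2)^-1) by move=> x; exact: is_derive1_atan.
have dq := antiderV q0 (antiderD (antider_cst 1) (antiderX 2 (@antider_id R))).
(* [k / (1 + k^2) + atan k] is a primitive of [2 / (1 + k^2)^2]; its limit is [pi / 2], while [G]
   tends to 0. *)
exists (fun k => G k + F 0 * (k * (1 + k ^+ 2)^-1 + atan k)); split.
- eapply antider_eq; first der.
  move=> k /=.
  have [c1P c2P e1P e2P] := trig_decay k cP eP.
  have [c1h c2h e1h e2h] := trig_decay k ch eh.
  have -> : half_integral (fun x => F x * cos (k * x)) =
    half_integral (fun x => P x * cos (k * x) + F 0 * (h x * cos (k * x))).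
    by congr half_integral; apply/funext => x; rewrite /P; ring.
  have c3 : continuous (fun x => F 0 * (h x * cos (k * x))) by cont.
  rewrite (half_integral_add lm0 c1P c3 e1P) ?(half_integral_scale _ lm0) //; last exact: exp_decay_scale.
  by rewrite reference_transform; field; exact: q0.
- rewrite /G mul0r atan0 addr0 mulr0 addr0.
  rewrite (_ : (fun x => _) = fun=> 0); last by apply/funext => x; rewrite mul0r sin0 mulr0.
  by rewrite (half_integralE (antider_cst 0) (cont_cst (c:=0)) (elim_at_cst 0)) subrr.
- have lim1 : (k * (1 + k ^+ 2)^-1) @[k --> +oo] --> (0 : R).
    apply/cvgrPdist_lt => e e0; near=> k.
    have k0 : 0 < k by near: k; exact: nbhs_pinfty_gt.
    have ke : e^-1 < k by near: k; apply: nbhs_pinfty_gt; exact: num_real.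
    have q1 : 0 < 1 + k ^+ 2 by rewrite ltr_wpDr // sqr_ge0.
    rewrite sub0r normrN ger0_norm; last by rewrite divr_ge0 // ltW.
    rewrite ltr_pdivrMr //.
    have : e * e^-1 < e * k by rewrite ltr_pM2l.
    rewrite mulfV ?gt_eqF // => h1.
    apply: (@lt_le_trans _ _ (e * k * k)); first by rewrite ltr_pMl.
    by rewrite -mulrA -expr2 ler_wpM2l ?(ltW e0) // lerDr.
  have := cvgD RL (cvgM (@cvg_cst _ (F 0) _ (pinfty_nbhs R) _) (cvgD lim1 (@cvgy_atan R))).
  rewrite !add0r; exact.
Unshelve. all: by end_near. Qed.

End InversionAtZero.

(** * Lebesgue integrals over the line computed from primitives *)

Section WholeLineIntegral.
Variable R : realType.
Local Notation mu := (@lebesgue_measure R).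

Lemma ge0_integral_reflect (f : R -> R) : (forall x, 0 <= f x) -> continuous f ->
  (\int[mu]_x (f x)%:E = \int[mu]_(x in `[0%R : R, +oo[) (f x + f (- x))%:E)%E.
Proof.
move=> f0 cf.
have mf : measurable_fun [set: R] f by exact: continuous_measurable_fun.
have cfN : continuous (fun x => f (- x)).
  by apply: (cont_comp (f := fun x : R => - x)) => //; cont.
have mfN : measurable_fun [set: R] (fun x => f (- x)) by exact: continuous_measurable_fun.
rewrite -(setUv [set` `[0%R : R, +oo[]) ge0_integral_setU//= ; last 4 first.
- exact: measurableC.
- by apply/measurable_EFinP; rewrite setUv.
- by move=> x _; rewrite lee_fin.
- exact/disj_setPCl.
rewrite [RHS](_ : _ = \int[mu]_(x in `[0%R : R, +oo[) ((f x)%:E + (f (- x)%R)%:E))%E; last first.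
  by apply: eq_integral => x _; rewrite EFinD.
rewrite ge0_integralD//=; last 4 first.
- by move=> x _; rewrite lee_fin.
- exact/measurable_EFinP/measurable_funTS.
- by move=> x _; rewrite lee_fin.
- exact/measurable_EFinP/measurable_funTS.
congr (_ + _)%E.
rewrite setCitvr integral_itv_bndo_bndc; last exact/measurable_EFinP/measurable_funTS.
rewrite -{1}oppr0 ge0_integration_by_substitutionNy//.
exact: continuous_subspaceT.
Qed.

Lemma integral_primitive (g G : R -> R) (L : R) : (forall x, 0 <= g x) -> continuous g ->
  antider G g -> G x @[x --> +oo] --> L ->
  (\int[mu]_(x in `[0%R : R, +oo[) (g x)%:E = (L - G 0)%:E)%E.
Proof.
move=> g0 cg dG hL; rewrite EFinB; apply: ge0_continuous_FTC2y => //.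
- exact: continuous_subspaceT.
- by move=> x _; have [] := dG x.
- have := antider_continuous dG (x := 0); exact: cvg_at_right_filter.
- by move=> x _; rewrite derive1E; have dx := dG x; rewrite derive_val.
Qed.

(** The fundamental theorem on a half-line is applied to nonnegative integrands. Adding
    [C / (1 + x^2)] makes [f] nonnegative, and the same computation with 0 in place of [f] gives the
    amount to subtract. *)
Lemma Rintegral_primitive (f A : R -> R) (C L : R) : continuous f ->
  (forall x, `|f x| <= C / (1 + x ^+ 2)) ->
  antider A (fun x => f x + f (- x)) -> A 0 = 0 -> A x @[x --> +oo] --> L ->
  mu.-integrable setT (EFin \o f) /\ Rintegral mu setT f = L.
Proof.
have C0 (h : R -> R) D : (forall x, `|h x| <= D / (1 + x ^+ 2)) -> 0 <= D.
  by move=> /(_ 0); rewrite expr0n /= addr0 divr1; exact: le_trans.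
have q1 (x : R) : 0 < 1 + x ^+ 2 by rewrite ltr_wpDr // sqr_ge0.
have q0 (x : R) : 1 + x ^+ 2 != 0 by rewrite gt_eqF.
have cg (D : R) : continuous (fun x : R => D * (1 + x ^+ 2)^-1).
  have cq : continuous (fun x : R => (1 + x ^+ 2)^-1) by apply: (cont_inv q0); cont.
  by cont.
have dat : antider (@atan R) (fun x => (1 + x ^+ 2)^-1) by move=> x; exact: is_derive1_atan.
have pos (h B : R -> R) (D M : R) : continuous h ->
    (forall x, `|h x| <= D / (1 + x ^+ 2)) -> antider B (fun x => h x + h (- x)) ->
    B 0 = 0 -> B x @[x --> +oo] --> M ->
    (\int[mu]_x (h x + D * (1 + x ^+ 2)^-1)%:E = (M + D * pi)%:E)%E.
  move=> ch hD dB B0 hM; have D0 := C0 _ _ hD; have cD := cg D.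
  have p x : 0 <= h x + D * (1 + x ^+ 2)^-1.
    by have := hD x; rewrite ler_norml => /andP[]; rewrite lerNl -subr_ge0 opprK addrC.
  have cp : continuous (fun x => h x + D * (1 + x ^+ 2)^-1) by cont.
  rewrite ge0_integral_reflect //.
  have d : antider (fun x => B x + 2 * D * atan x)
      (fun x => h x + D * (1 + x ^+ 2)^-1 + (h (- x) + D * (1 + (- x) ^+ 2)^-1)).
    by eapply antider_eq; [der | move=> x /=; rewrite sqrrN; ring].
  have pp x : 0 <= h x + D * (1 + x ^+ 2)^-1 + (h (- x) + D * (1 + (- x) ^+ 2)^-1).
    by rewrite addr_ge0.
  have cN : continuous (fun x => h (- x) + D * (1 + (- x) ^+ 2)^-1).
    by apply: (cont_comp (f := fun x : R => - x) (g := fun x => h x + D * (1 + x ^+ 2)^-1)) => //; cont.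
  have lim : (B x + 2 * D * atan x) @[x --> +oo] --> M + 2 * D * (pi / 2).
    exact: cvgD hM (cvgM (@cvg_cst _ (2 * D) _ (pinfty_nbhs R) _) (@cvgy_atan R)).
  rewrite (integral_primitive pp (cont_add cp cN) d lim) atan0 mulr0 addr0 B0 subr0.
  by congr EFin; field.
move=> cf hC dA A0 hL; have CC0 := C0 _ _ hC; have cC := cg C.
have h0 (x : R) : `|(0 : R)| <= C / (1 + x ^+ 2) by rewrite normr0 divr_ge0 // ltW.
have dz : antider (fun _ : R => 0 : R) (fun x => 0 + 0) by apply: antider_eq (antider_cst 0) _ => x; rewrite addr0.
have hz : (fun _ : R => (0 : R)) x @[x --> +oo] --> (0 : R) by exact: cvg_cst.
have I1 := pos f A C L cf hC dA A0 hL.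
have I2 := pos (fun=> 0) (fun=> 0) C 0 (cont_cst (c:=0)) h0 dz erefl hz.
have int (h : R -> R) (M : R) : continuous h -> (forall x, 0 <= h x) ->
    (\int[mu]_x (h x)%:E = M%:E)%E -> mu.-integrable setT (EFin \o h).
  move=> ch hp hi; apply/integrableP; split.
    by apply/measurable_EFinP; exact: continuous_measurable_fun.
  under eq_integral => x _ do rewrite /= ger0_norm //.
  by rewrite hi ltry.
have cp : continuous (fun x => f x + C * (1 + x ^+ 2)^-1) by cont.
have p x : 0 <= f x + C * (1 + x ^+ 2)^-1.
  by have := hC x; rewrite ler_norml => /andP[]; rewrite lerNl -subr_ge0 opprK addrC.
have c0 : continuous (fun x : R => 0 + C * (1 + x ^+ 2)^-1).
  by have c00 := @cont_cst R 0; cont.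
have p0 x : 0 <= 0 + C * (1 + x ^+ 2)^-1 by rewrite add0r divr_ge0 // ltW.
have i1 := int _ _ cp p I1; have i2 := int _ _ c0 p0 I2.
have fE : f = (fun x => f x + C * (1 + x ^+ 2)^-1 - (0 + C * (1 + x ^+ 2)^-1)).
  by apply/funext => x; ring.
pose f1 (x : R) := f x + C * (1 + x ^+ 2)^-1; pose f2 (x : R) := 0 + C * (1 + x ^+ 2)^-1.
have f12 : f = (fun x => f1 x - f2 x) by exact: fE.
have E12 : EFin \o f = ((EFin \o f1) \- (EFin \o f2))%E.
  by apply/funext => x; rewrite /= {1}f12 EFinB.
split; first by rewrite E12; exact: integrableB.
by rewrite {1}f12 RintegralB // /Rintegral I1 I2 /=; ring.
Qed.

End WholeLineIntegral.

(** * Inversion of the cosine transform at every point *)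

Section CosineInversion.
Variable R : realType.
Local Notation mu := (@lebesgue_measure R).

Definition cos_transform (f : R -> R) (k : R) : R :=
  2 * half_integral (fun x => f x * cos (k * x)).

Lemma shift_decay (l K x : R) (g : R -> R) : 0 < l ->
  (forall t, `|g t| <= K * expR (- (l * `|t|))) ->
  exp_decay l (fun y => g (x + y)) /\ exp_decay l (fun y => g (x - y)).
Proof.
move=> l0 hg.
have K0 : 0 <= K by have := hg 0; rewrite normr0 mulr0 oppr0 expR0 mulr1; apply: le_trans.
have bd t y : 0 <= y -> y - `|x| <= `|t| -> `|g t| <= K * expR (l * `|x|) * expR (- (l * y)).
  move=> y0 h; apply: (le_trans (hg t)); rewrite -mulrA ler_wpM2l // -expRD ler_expR.
  have -> : l * `|x| + - (l * y) = - (l * (y - `|x|)) by ring.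
  by rewrite lerN2 ler_wpM2l // ltW.
split; exists (K * expR (l * `|x|)) => y y0; apply: bd => //.
  have := ler_normB (x + y) x; rewrite addrAC subrr add0r (ger0_norm y0); lra.
have := ler_normB x (x - y); rewrite opprB addrCA subrr addr0 (ger0_norm y0); lra.
Qed.

Lemma even_average_decaying (l x : R) (f : R -> R) : 0 < l ->
  (forall y, f (- y) = f y) -> decaying_derivatives l 2 f ->
  decaying_derivatives l 2 (fun y => (f (x + y) + f (x - y)) / 2).
Proof.
move=> l0 ef [cf [[K hK] [f' df [cf' [[K' hK'] [f'' df' [cf'' [[K'' hK''] _]]]]]]]].
have of' := antider_even df ef; have ef'' := antider_odd df' of'.
have h0 := even_norm_bound (fun y => congr1 (fun t => `|t|) (ef y)) hK.
have h1 : forall y, `|f' y| <= K' * expR (- (l * `|y|)).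
  by apply: even_norm_bound hK' => y; rewrite of' normrN.
have h2 := even_norm_bound (fun y => congr1 (fun t => `|t|) (ef'' y)) hK''.
have [a0 b0] := shift_decay x l0 h0; have [a1 b1] := shift_decay x l0 h1.
have [a2 b2] := shift_decay x l0 h2.
have ip : antider (fun y => x + y) (fun=> 1) by eapply antider_eq; [der | move=> y /=; ring].
have im : antider (fun y => x - y) (fun=> - 1) by eapply antider_eq; [der | move=> y /=; ring].
have cp (g : R -> R) : continuous g -> continuous (fun y => g (x + y)).
  by move=> cg; apply: (cont_comp (f := fun y => x + y)) => //; cont.
have cm (g : R -> R) : continuous g -> continuous (fun y => g (x - y)).
  by move=> cg; apply: (cont_comp (f := fun y => x - y)) => //; cont.
have half (g : R -> R) : exp_decay l g -> exp_decay l (fun y => g y / 2).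
  move=> eg; rewrite (_ : (fun y => g y / 2) = fun y => 2^-1 * g y); first exact: exp_decay_scale.
  by apply/funext => y; rewrite mulrC.
have p0 := cp _ cf; have p1 := cp _ cf'; have p2 := cp _ cf''.
have m0 := cm _ cf; have m1 := cm _ cf'; have m2 := cm _ cf''.
have dp := antider_comp ip df; have dm := antider_comp im df.
have dp' := antider_comp ip df'; have dm' := antider_comp im df'.
split; first by cont.
split; first by apply: half; exact: exp_decay_add.
exists (fun y => (f' (x + y) - f' (x - y)) / 2).
  by eapply antider_eq; [der | move=> y /=; ring].
split; first by cont.
split; first by apply: half; apply: exp_decay_add => //; exact: exp_decay_opp.
exists (fun y => (f'' (x + y) + f'' (x - y)) / 2).
  by eapply antider_eq; [der | move=> y /=; ring].
split; first by cont.
by split=> //; apply: half; exact: exp_decay_add.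
Qed.

(** The average of the two translates is even in [y] and equals [f x] at [y = 0]; with its transform
    being [cos (k x)] times that of [f], inversion at 0 for the average is inversion at [x] for
    [f]. *)
Lemma cos_transform_average (l x k : R) (f : R -> R) : 0 < l ->
  (forall y, f (- y) = f y) -> continuous f -> exp_decay l f ->
  half_integral (fun y => (f (x + y) + f (x - y)) / 2 * cos (k * y)) =
  cos (k * x) * half_integral (fun y => f y * cos (k * y)).
Proof.
move=> l0 ef cf edf.
have [c1 c2 e1 e2] := trig_decay k cf edf.
have hC := half_integralP l0 c1 e1; have hS := half_integralP l0 c2 e2.
have dC := prim_antider c1; have dS := prim_antider c2.
have cC := antider_continuous dC; have cS := antider_continuous dS.
have oC : forall y, prim (fun x => f x * cos (k * x)) (- y) = - prim (fun x => f x * cos (k * x)) y.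
  by apply: (prim_even_odd c1) => y; rewrite ef mulrN cosN.
have eS : forall y, prim (fun x => f x * sin (k * x)) (- y) = prim (fun x => f x * sin (k * x)) y.
  by apply: (prim_odd_even c2) => y; rewrite ef mulrN sinN; ring.
set C := prim _ in hC dC cC oC; set S := prim _ in hS dS cS eS.
have ip : antider (fun y => x + y) (fun=> 1) by eapply antider_eq; [der | move=> y /=; ring].
have im : antider (fun y => - x + y) (fun=> 1) by eapply antider_eq; [der | move=> y /=; ring].
have dCp := antider_comp ip dC; have dCm := antider_comp im dC.
have dSp := antider_comp ip dS; have dSm := antider_comp im dS.
pose c := cos (k * x); pose s := sin (k * x).
(* An antiderivative by the addition formulas. At infinity the two [S] terms cancel and the [C]
   terms add up; at [y = 0] everything cancels, since [C] is odd and [S] even. *)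
pose B y := 2^-1 * c * (C (x + y) + C (- x + y)) + 2^-1 * s * (S (x + y) + -1 * S (- x + y)).
have dB : antider B (fun y => (f (x + y) + f (x - y)) / 2 * cos (k * y)).
  eapply antider_eq; [rewrite /B; der | move=> y /=].
  have -> : f (x - y) = f (- x + y) by rewrite -ef opprB addrC.
  have E1 : cos (k * y) = c * cos (k * (x + y)) + s * sin (k * (x + y)).
    by rewrite /c /s -cosB -[LHS]cosN; congr cos; ring.
  have E2 : cos (k * y) = c * cos (k * (- x + y)) - s * sin (k * (- x + y)).
    by rewrite /c /s -cosD; congr cos; ring.
  transitivity ((f (x + y) * (c * cos (k * (x + y)) + s * sin (k * (x + y))) +
    f (- x + y) * (c * cos (k * (- x + y)) - s * sin (k * (- x + y)))) / 2); first by ring.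
  by rewrite -E1 -E2; ring.
have cp : continuous (fun y => f (x + y)) by apply: (cont_comp (f := fun y => x + y)) => //; cont.
have cm : continuous (fun y => f (x - y)) by apply: (cont_comp (f := fun y => x - y)) => //; cont.
have cF : continuous (fun y => (f (x + y) + f (x - y)) / 2 * cos (k * y)) by cont.
have lB := elim_at_add
  (elim_at_scale (2^-1 * c) (elim_at_add (elim_at_shift x cC hC) (elim_at_shift (- x) cC hC)))
  (elim_at_scale (2^-1 * s) (elim_at_add (elim_at_shift x cS hS)
     (elim_at_scale (-1) (elim_at_shift (- x) cS hS)))).
rewrite (half_integralE dB cF lB) /B !addr0 oC eS.
by rewrite /c; field.
Qed.

Theorem cosine_inversion (l : R) (f : R -> R) : 0 < l -> (forall y, f (- y) = f y) ->
  (forall j, decaying_derivatives l j f) ->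
  [/\ continuous (cos_transform f),
      (forall j, exists C, forall k, `|k| ^+ j * `|cos_transform f k| <= C),
      (forall x, Rintegral mu setT (fun k => cos_transform f k * cos (k * x)) = 2 * pi * f x) &
      (forall x, Rintegral mu setT (fun k => cos_transform f k * sin (k * x)) = 0)].
Proof.
move=> l0 ef hf.
have [cf [edf _]] := hf 0%N.
have ct : continuous (cos_transform f).
  have [C hC] := half_transform_lipschitz l0 cf edf.
  have c : continuous (fun k : R => half_integral (fun x => f x * cos (k * x))).
    have C0 : 0 <= C by have := hC 1 0; rewrite subr0 normr1 mulr1; apply: le_trans.
    move=> k; apply/cvgrPdist_lt => e e0.
    have e1 : 0 < e / (C + 1) by rewrite divr_gt0 // ltr_wpDl.
    near=> k'; apply: (le_lt_trans (hC k k')).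
    have : `|k - k'| < e / (C + 1).
      by near: k'; have /cvgrPdist_lt /(_ _ e1) := @cont_id R k; apply.
    rewrite ltr_pdivlMr ?ltr_wpDl // mulrDr mulr1 [_ * C]mulrC => hs.
    by apply: le_lt_trans hs; rewrite lerDl.
  by rewrite /cos_transform; cont.
have bd j : exists C, forall k, `|k| ^+ j * `|cos_transform f k| <= C.
  have [/(_ ef) [C hC] _] := decaying_transform l0 (hf j).
  exists (2 * C) => k; rewrite /cos_transform normrM (ger0_norm (_ : 0 <= 2 :> R)) // mulrCA.
  by rewrite ler_wpM2l.
have ev k : cos_transform f (- k) = cos_transform f k.
  by rewrite /cos_transform; congr (_ * half_integral _); apply/funext => x; rewrite mulNr cosN.
have [C0 hC0] := bd 0%N; have [C2 hC2] := bd 2%N.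
have q1 (x : R) : 0 < 1 + x ^+ 2 by rewrite ltr_wpDr // sqr_ge0.
have dom (t : R -> R) k : (forall k, `|t k| <= 1) -> `|cos_transform f k * t k| <= (C0 + C2) / (1 + k ^+ 2).
  move=> ht; rewrite ler_pdivlMr // normrM.
  apply: (@le_trans _ _ (`|cos_transform f k| * (1 + k ^+ 2))).
    by rewrite ler_wpM2r ?(ltW (q1 _)) // ler_piMr.
  rewrite mulrDr mulr1; apply: lerD; first by have := hC0 k; rewrite expr0 mul1r.
  by have := hC2 k; rewrite -normrX (ger0_norm (sqr_ge0 k)) mulrC.
split=> // x.
- have avg := even_average_decaying x l0 ef (hf 2%N).
  have evF y : (f (x + - y) + f (x - - y)) / 2 = (f (x + y) + f (x - y)) / 2.
    by rewrite opprK addrC.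
  have [A [dA A0 hA]] := even_transform_primitive l0 avg evF.
  have c : continuous (fun k : R => cos_transform f k * cos (k * x)) by cont.
  (* A factor 2 from the definition of [cos_transform] and a factor 2 from folding the line. *)
  have d : antider (fun k => 4 * A k) (fun k => cos_transform f k * cos (k * x) +
      cos_transform f (- k) * cos (- k * x)).
    eapply antider_eq; [der | move=> k /=].
    rewrite ev mulNr cosN (cos_transform_average x k l0 ef cf edf) /cos_transform.
    by ring.
  have h : (4 * A k) @[k --> +oo] --> 4 * (f x * (pi / 2)).
    have F0 : (f (x + 0) + f (x - 0)) / 2 = f x by rewrite addr0 subr0; field.
    by rewrite F0 in hA; exact: cvgM (@cvg_cst _ (4 : R) _ (pinfty_nbhs R) _) hA.
  have A4 : 4 * A 0 = 0 by rewrite A0 mulr0.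
  have [_ ->] := Rintegral_primitive c (fun k => dom _ k (fun k => cos_max _)) d A4 h.
  by field.
- have c : continuous (fun k : R => cos_transform f k * sin (k * x)) by cont.
  have d : antider (fun=> 0) (fun k => cos_transform f k * sin (k * x) +
      cos_transform f (- k) * sin (- k * x)).
    by apply: antider_eq (antider_cst 0) _ => k /=; rewrite ev mulNr sinN; ring.
  have hz : (fun _ : R => (0 : R)) x @[x --> +oo] --> (0 : R) by exact: cvg_cst.
  by have [] := Rintegral_primitive c (fun k => dom _ k (fun k => sin_max _)) d erefl hz.
Unshelve. all: by end_near. Qed.

End CosineInversion.

(** * Persistence of the homoclinic orbit *)

Section WeightedCorrection.
Variable R : realType.

Lemma exp_half (t : R) : expR t = expR (t / 2) ^+ 2.
Proof. by rewrite -expRM_natl; congr expR; field. Qed.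

Lemma norm_le_sqrt (x r K l y : R) : 0 < K -> x ^+ 2 <= r ->
  r <= K * expR (- (2 * l * y)) -> `|x| <= Num.sqrt K * expR (- (l * y)).
Proof.
move=> K0 h1 h2; rewrite -(@ler_pXn2r _ 2) ?nnegrE ?mulr_ge0 ?sqrtr_ge0 ?expR_ge0 //.
rewrite real_normK ?num_real // exprMn sqr_sqrtr ?(ltW K0) //.
apply: (le_trans h1); apply: (le_trans h2); rewrite [expR (- (2 * l * y))]exp_half.
by have -> : - (2 * l * y) / 2 = - (l * y) by field.
Qed.

(* The linearisation of the averaged system along the homoclinic orbit, framed
   by the tangent vector of the orbit. *)
Lemma homoclinic_frame (n al ga be kappa : R) (u v : R -> R) :
  0 < n -> 0 < al -> 0 < ga -> 0 < be -> 0 < kappa ->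
  (n * kappa) ^+ 2 = al * ga ->
  averaged_orbit n al ga be u v -> zero_energy al ga be u v ->
  (forall y, 0 < u y ^+ 2 + v y ^+ 2) ->
  (forall y, u (- y) = u y) -> (forall y, v (- y) = - v y) ->
  exists K c K0, [/\ decaying_frame
     (fun y => (al + be * (u y ^+ 2 + v y ^+ 2)) * v y / n)
     (fun y => (ga - be * (u y ^+ 2 + v y ^+ 2)) * u y / n)
     (fun y => 2 * be * u y * v y / n)
     (fun y => (al + be * (u y ^+ 2 + v y ^+ 2) + 2 * be * v y ^+ 2) / n)
     (fun y => (ga - be * (u y ^+ 2 + v y ^+ 2) - 2 * be * u y ^+ 2) / n)
     kappa K c,
     0 < K0 & forall y, `|u y| <= K0 * expR (- (kappa * `|y|)) /\
                        `|v y| <= K0 * expR (- (kappa * `|y|))].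
Proof.
move=> n0 al0 ga0 be0 ka0 kaE [du dv] en r0 ue vo.
have nn0 : n != 0 by rewrite gt_eqF.
have v0 : v 0 = 0.
  by have := vo 0; rewrite oppr0 => h; lra.
have [c [Kr [c0 Kr0 rb]]] := radius_bounds n0 al0 ga0 ka0 kaE (conj du dv) en r0 v0.
have rle y := radius_le al0 ga0 be0 en (r0 y).
pose r y := u y ^+ 2 + v y ^+ 2.
have rE y : u y ^+ 2 + v y ^+ 2 = r y by [].
pose K0 := Num.sqrt Kr.
have K00 : 0 < K0 by rewrite sqrtr_gt0.
have ub y : 0 <= y -> `|u y| <= K0 * expR (- (kappa * y)) /\ `|v y| <= K0 * expR (- (kappa * y)).
  move=> y0; have /andP[_ h] := rb y y0.
  by split; apply: (norm_le_sqrt Kr0 _ h); rewrite ?lerDl ?lerDr sqr_ge0.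
have uball y : `|u y| <= K0 * expR (- (kappa * `|y|)) /\ `|v y| <= K0 * expR (- (kappa * `|y|)).
  split; apply: even_norm_bound => [t|t /ub[]//]; first by rewrite ue.
  by rewrite vo normrN.
(* Bounds every coefficient of the linearisation, because [be * r <= 2 * ga]. *)
pose S := al + 2 * ga + be + 4 * ga.
have S0 : 0 < S by rewrite /S !addr_gt0 ?mulr_gt0.
have sq_r y : 0 <= u y ^+ 2 <= r y /\ 0 <= v y ^+ 2 <= r y.
  by rewrite !sqr_ge0 /r lerDl lerDr !sqr_ge0.
pose K := S / n * (K0 + 1).
have Sn0 : 0 < S / n by rewrite divr_gt0.
have SK : S / n * K0 <= K by rewrite /K ler_wpM2l ?(ltW Sn0) // lerDl.
have SK1 : S / n <= K by rewrite /K -[leLHS]mulr1 ler_wpM2l ?(ltW Sn0) // lerDr ltW.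
pose mn := Num.min al ga.
have mn0 : 0 < mn by rewrite lt_min al0.
have dnorm (x : R) : `|x / n| = `|x| / n by rewrite normrM normfV (gtr0_norm n0).
have cu := antider_continuous du; have cv := antider_continuous dv.
(* On the zero energy level the squared length of the tangent vector is
   [r (al ga + (ga - al) be r / 2) / n^2]. As [be r / 2] runs from 0 to [ga], the bracket runs from
   [al ga] to [ga^2], so it is at least [ga * mn]. *)
exists K, (c * (ga * mn) / n ^+ 2), K0; split; [|exact: K00|exact: uball].
split; first exact: ka0.
- by rewrite /K mulr_gt0 // addr_gt0.
- by rewrite divr_gt0 ?exprn_gt0 // mulr_gt0 // mulr_gt0.
- by eapply antider_eq; [der | move=> y /=; field].
- by eapply antider_eq; [der | move=> y /=; field].
- by move=> y; rewrite ue vo; ring.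
- by move=> y; rewrite ue vo; ring.
- by cont.
- by cont.
- by cont.
- by move=> y; rewrite ue vo; ring.
- by move=> y; rewrite ue vo; ring.
- by move=> y; rewrite ue vo; ring.
- move=> y y0; have [h1 h2] := ub y y0.
  have E0 := expR_ge0 (- (kappa * y)); have := rle y; have := r0 y; rewrite rE => ry rl.
  have br0 : 0 < be * r y by rewrite mulr_gt0.
  have fin (A t : R) : `|A| <= S -> `|t| <= K0 * expR (- (kappa * y)) ->
      `|A * t / n| <= K * expR (- (kappa * y)).
    move=> hA ht; rewrite dnorm normrM.
    apply: (@le_trans _ _ (S * (K0 * expR (- (kappa * y))) / n)).
      by rewrite ler_wpM2r ?invr_ge0 ?(ltW n0) //; apply: ler_pM.
    have -> : S * (K0 * expR (- (kappa * y))) / n = S / n * K0 * expR (- (kappa * y)) by ring.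
    by rewrite ler_wpM2r.
  by split; apply: fin => //; clear -ry rl br0 al0 ga0 be0; rewrite ler_norml /S; apply/andP; split; lra.
- move=> y y0; have /andP[rlo _] := rb y y0; rewrite rE in rlo.
  have := rle y; have := r0 y; have := en y; rewrite !rE => ey ry rl.
  have E : ((al + be * r y) * v y / n) ^+ 2 + ((ga - be * r y) * u y / n) ^+ 2 =
     r y * (al * ga + (ga - al) * (be * r y / 2)) / n ^+ 2.
    have h1 : (al + ga) * u y ^+ 2 = al * r y + be / 2 * r y ^+ 2 by rewrite -ey /r; ring.
    have h2 : (al + ga) * v y ^+ 2 = ga * r y - be / 2 * r y ^+ 2 by rewrite -ey /r; ring.
    have ag : al + ga != 0 by rewrite gt_eqF // addr_gt0.
    apply: (mulIf ag).
    transitivity (((al + be * r y) ^+ 2 * ((al + ga) * v y ^+ 2) +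
      (ga - be * r y) ^+ 2 * ((al + ga) * u y ^+ 2)) / n ^+ 2); first by field.
    by rewrite h1 h2; field.
  rewrite E [leLHS]mulrAC ler_wpM2r ?invr_ge0 ?exprn_ge0 ?(ltW n0) //.
  have m1 : ga * mn <= al * ga + (ga - al) * (be * r y / 2).
    have mal : mn <= al by rewrite ge_min lexx.
    have mga : mn <= ga by rewrite ge_min lexx orbT.
    have t0 : 0 <= be * r y / 2 by rewrite divr_ge0 // mulr_ge0 ?ltW.
    have t1 : be * r y / 2 <= ga by lra.
    move: (be * r y / 2) t0 t1 => t t0 t1; nra.
  have -> : c * (ga * mn) * expR (- (2 * kappa * y)) = c * expR (- (2 * kappa * y)) * (ga * mn) by ring.
  by apply: ler_pM; rewrite ?mulr_ge0 ?expR_ge0 // ltW.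
- move=> y y0; have := rle y; have := r0 y; rewrite rE => ry rl.
  have [/andP[u1 u2] /andP[v1 v2]] := sq_r y.
  have br0 : 0 < be * r y by rewrite mulr_gt0.
  have bu1 : 0 <= be * u y ^+ 2 by rewrite mulr_ge0 // ltW.
  have bv1 : 0 <= be * v y ^+ 2 by rewrite mulr_ge0 // ltW.
  have bu2 : be * u y ^+ 2 <= be * r y by rewrite ler_wpM2l // ltW.
  have bv2 : be * v y ^+ 2 <= be * r y by rewrite ler_wpM2l // ltW.
  have uv : `|2 * be * u y * v y| <= be * r y.
    have -> : 2 * be * u y * v y = be * (2 * u y * v y) by ring.
    rewrite normrM (gtr0_norm be0) ler_wpM2l ?(ltW be0) // ler_norml /r.
    have := sqr_ge0 (u y + v y); have := sqr_ge0 (u y - v y); lra.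
  have fin (A : R) : `|A| <= S -> `|A / n| <= K.
    move=> hA; rewrite dnorm; apply: le_trans SK1.
    by rewrite ler_wpM2r ?invr_ge0 // ltW.
  split; apply: fin.
  + by apply: (le_trans uv); rewrite /S; lra.
  + by clear -ry rl br0 al0 ga0 be0 bu1 bu2 bv1 bv2; rewrite ler_norml /S; apply/andP; split; lra.
  + by clear -ry rl br0 al0 ga0 be0 bu1 bu2 bv1 bv2; rewrite ler_norml /S; apply/andP; split; lra.
Qed.

End WeightedCorrection.

(** * Solutions of the exact slow system near the homoclinic orbit *)

Section SlowOrbit.
Variable R : realType.

(** The part of the mean field at [(u + a, v + b)] that is at least quadratic in [(a, b)]. *)
Definition nonlin1 (n be : R) (u v : R -> R) (y a b : R) : R :=
  be / n * ((a ^+ 2 + b ^+ 2) * (v y + b) + 2 * (u y * a + v y * b) * b).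
Definition nonlin2 (n be : R) (u v : R -> R) (y a b : R) : R :=
  - (be / n * ((a ^+ 2 + b ^+ 2) * (u y + a) + 2 * (u y * a + v y * b) * a)).

(* Rescaling (a, b) by delta turns the quadratic vanishing at 0 into a
   Lipschitz constant of order delta. *)
Lemma nonlin_lipschitz (n be : R) (u v : R -> R) (K0 : R) :
  (forall y, `|u y| <= K0) -> (forall y, `|v y| <= K0) ->
  exists d1 B, [/\ 0 < d1, 0 <= B &
    forall delta y a b a' b', 0 < delta < d1 ->
     `|a| <= delta -> `|b| <= delta -> `|a'| <= delta -> `|b'| <= delta ->
     `|nonlin1 n be u v y a b - nonlin1 n be u v y a' b'| <=
        B * delta * (`|a - a'| + `|b - b'|) /\
     `|nonlin2 n be u v y a b - nonlin2 n be u v y a' b'| <=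
        B * delta * (`|a - a'| + `|b - b'|)].
Proof.
move=> hu hv.
pose f1 (e y a b : R) := be / n * ((a ^+ 2 + b ^+ 2) * (v y + e * b) + 2 * (u y * a + v y * b) * b).
pose f2 (e y a b : R) := - (be / n * ((a ^+ 2 + b ^+ 2) * (u y + e * a) + 2 * (u y * a + v y * b) * a)).
have uu := ulip_coef (1 : R) hu; have uv := ulip_coef (1 : R) hv.
have [e1 [B1 [e10 B10 h1]]] : unif_lipschitz 1 f1 by rewrite /f1; ulip.
have [e2 [B2 [e20 B20 h2]]] : unif_lipschitz 1 f2 by rewrite /f2; ulip.
exists (Num.min e1 e2), (B1 + B2); split; first by rewrite lt_min e10.
  exact: addr_ge0.
move=> d y a b a' b' /andP[d0]; rewrite lt_min => /andP[de1 de2] ha hb ha' hb'.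
have nz : d != 0 by rewrite gt_eqF.
have sc (t : R) : `|t| <= d -> `|t / d| <= 1.
  by move=> ht; rewrite normrM normfV (gtr0_norm d0) ler_pdivrMr // mul1r.
have d01 : 0 < d < e1 by rewrite d0.
have d02 : 0 < d < e2 by rewrite d0.
have [_ l1] := h1 d y _ _ _ _ d01 (sc _ ha) (sc _ hb) (sc _ ha') (sc _ hb').
have [_ l2] := h2 d y _ _ _ _ d02 (sc _ ha) (sc _ hb) (sc _ ha') (sc _ hb').
have s1 s t : nonlin1 n be u v y s t = d ^+ 2 * f1 d y (s / d) (t / d).
  by rewrite /nonlin1 /f1; move: (be / n) => q; field.
have s2 s t : nonlin2 n be u v y s t = d ^+ 2 * f2 d y (s / d) (t / d).
  by rewrite /nonlin2 /f2; move: (be / n) => q; field.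
have sum : `|a / d - a' / d| + `|b / d - b' / d| = (`|a - a'| + `|b - b'|) / d.
  by rewrite -!mulrBl !normrM !normfV (gtr0_norm d0) mulrDl.
have nd (t : R) : `|d ^+ 2 * t| = d ^+ 2 * `|t|.
  by rewrite normrM (ger0_norm (exprn_ge0 2 (ltW d0))).
have t1 : nonlin1 n be u v y a b - nonlin1 n be u v y a' b' =
  d ^+ 2 * (f1 d y (a / d) (b / d) - f1 d y (a' / d) (b' / d)) by rewrite !s1 mulrBr.
have t2 : nonlin2 n be u v y a b - nonlin2 n be u v y a' b' =
  d ^+ 2 * (f2 d y (a / d) (b / d) - f2 d y (a' / d) (b' / d)) by rewrite !s2 mulrBr.
rewrite t1 t2 !nd.
rewrite sum in l1 l2.
set L := `|a - a'| + `|b - b'| in l1 l2 *; have L0 : 0 <= L by rewrite addr_ge0.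
have fin (Bi X : R) : Bi <= B1 + B2 -> X <= Bi * (L / d) -> d ^+ 2 * X <= (B1 + B2) * d * L.
  move=> hB hX; apply: (@le_trans _ _ (d ^+ 2 * (Bi * (L / d)))).
    by rewrite ler_wpM2l // exprn_ge0 // ltW.
  have -> : d ^+ 2 * (Bi * (L / d)) = Bi * (d * L) by field.
  by rewrite -mulrA ler_wpM2r // mulr_ge0 // ltW.
split; [apply: (fin B1); [by rewrite lerDl|] | apply: (fin B2); [by rewrite lerDr|]].
  exact: l1.
exact: l2.
Qed.

Lemma le_sum5 (a b c d e : R) : 0 <= a -> 0 <= b -> 0 <= c -> 0 <= d -> 0 <= e ->
  let s := a + b + c + d + e in [/\ a <= s, b <= s, c <= s, d <= s & e <= s].
Proof. by move=> h1 h2 h3 h4 h5 /=; split; lra. Qed.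

(** The source [e rem] has order [e], and in a ball of radius [Kd e] so does the Lipschitz constant.
    Hence [Kd] is fixed by the source alone, and small [e] then secures the contraction. *)
Lemma slow_orbit (k : fast_data R) (nu B : R) (u v : R -> R) :
  fast_spec k nu B ->
  0 < fwn k - fOm k -> 0 < fwn k + fOm k -> 0 < fsig k ->
  averaged_orbit (fn k) (fwn k - fOm k) (fwn k + fOm k) (3 * fsig k) u v ->
  zero_energy (fwn k - fOm k) (fwn k + fOm k) (3 * fsig k) u v ->
  (forall y, 0 < u y ^+ 2 + v y ^+ 2) ->
  (forall y, u (- y) = u y) -> (forall y, v (- y) = - v y) ->
  exists e1 C mu, [/\ 0 < e1, 0 < C, 0 < mu &
    forall e, 0 < e < e1 -> exists z1 z2 : R -> R,
      [/\ antider z1 (fun y => slow1 k (y / e) (z1 y) (z2 y)),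
          antider z2 (fun y => slow2 k (y / e) (z1 y) (z2 y)),
          (forall y, z1 (- y) = z1 y /\ z2 (- y) = - z2 y),
          (forall y, `|z1 y - u y| <= C * e /\ `|z2 y - v y| <= C * e) &
          (forall y, `|z1 y| <= C * expR (- (mu * `|y|)) /\
                     `|z2 y| <= C * expR (- (mu * `|y|)))]].
Proof.
move=> S al0 ga0 sg0 orb en r0 ue vo.
have n0 := fast_n S; have nn0 : fn k != 0 by rewrite gt_eqF.
have be0 : 0 < 3 * fsig k by rewrite mulr_gt0.
pose al := fwn k - fOm k; pose ga := fwn k + fOm k; pose be := 3 * fsig k.
pose kappa := Num.sqrt (al * ga) / fn k.
have ka0 : 0 < kappa by rewrite divr_gt0 // sqrtr_gt0 mulr_gt0.
have kaE : (fn k * kappa) ^+ 2 = al * ga.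
  rewrite /kappa mulrC divfK // sqr_sqrtr // ltW // mulr_gt0 //.
have [K [c [K0 [F K00 ub]]]] := homoclinic_frame n0 al0 ga0 be0 ka0 kaE orb en r0 ue vo.
have [du dv] := orb.
have cu := antider_continuous du; have cv := antider_continuous dv.
pose mu := kappa / 2.
have mu0 : 0 < mu by rewrite divr_gt0.
have muk : mu < kappa by rewrite /mu; lra.
have ub' y : `|u y| <= K0 * expR (- (mu * `|y|)) /\ `|v y| <= K0 * expR (- (mu * `|y|)).
  have [h1 h2] := ub y.
  have E : expR (- (kappa * `|y|)) <= expR (- (mu * `|y|)).
    by apply: expR_mono_rate => //; exact: ltW.
  by split; [apply: (le_trans h1)|apply: (le_trans h2)]; rewrite ler_wpM2l // ltW.
have w01 := expR_weight_bounds mu0.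
have ub0 y : `|u y| <= K0 /\ `|v y| <= K0.
  have [h1 h2] := ub' y; have /andP[w0 w1] := w01 y.
  by split; [apply: (le_trans h1)|apply: (le_trans h2)]; rewrite ler_piMr // ltW.
have [dN [BN [dN0 BN0 hN]]] := nonlin_lipschitz (fn k) be (fun y => (ub0 y).1) (fun y => (ub0 y).2).
(* Contains the orbit together with corrections of size [delta <= 1]. *)
pose M := K0 + 1.
have M0 : 0 <= M by rewrite addr_ge0 // ltW.
have [[er1 [Br1 [er10 Br10 hr1]]] [er2 [Br2 [er20 Br20 hr2]]]
  [ec1 [Bc1 [ec10 Bc10 hc1]]] [ec2 [Bc2 [ec20 Bc20 hc2]]] hdd] := rem_lipschitz S M0.
have [ed ed0 hd] := unif_near_one hdd.
pose BB := BN + Br1 + Br2 + Bc1 + Bc2.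
have BB0 : 0 <= BB by rewrite !addr_ge0.
pose Lam := frame_rate kappa K c mu.
have Lam0 : 0 <= Lam.
  have K0' := ltW (frame_K F); have c0' := ltW (frame_c F); have ka0' := ltW ka0.
  have km : 0 <= kappa - mu by rewrite subr_ge0 ltW.
  rewrite /Lam /frame_rate; apply: addr_ge0; last by rewrite !mulr_ge0 ?invr_ge0.
  by rewrite mulr_ge0 // divr_ge0 // addr_ge0 // !mulr_ge0 ?invr_ge0.
(* Chosen so that the source takes at most half of the radius: [Lam * d0 <= delta / 2]. *)
pose Kd := 4 * Lam * BB * K0 + 1.
have Kd0 : 0 < Kd by rewrite /Kd ltr_wpDl // !mulr_ge0 // ltW.
(* The condition [e * X <= 1] bounds the contraction factor [Lam * (2 * l)] by 1/2. *)
pose X := 4 * Lam * BB * (Kd + 1) + 1.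
have X0 : 0 < X by rewrite /X ltr_wpDl // !mulr_ge0 // addr_ge0 // ltW.
pose e1 := Num.min (Num.min (Num.min er1 er2) (Num.min ec1 ec2))
  (Num.min (Num.min ed X^-1) (Num.min (dN / Kd) (Num.min Kd^-1 1))).
have e10 : 0 < e1 by rewrite /e1 !lt_min er10 er20 ec10 ec20 ed0 invr_gt0 X0 divr_gt0 // invr_gt0 Kd0 ltr01.
(* Covers both the distance to the orbit, [Kd + 2 BB (K0 + 1)], and the decay,
   [K0 + 1 + 2 BB (K0 + 1)]. *)
pose C := Kd + 2 * BB * (K0 + 1) + (K0 + 1) + BB.
have C0 : 0 < C.
  have h : 0 <= 2 * BB * (K0 + 1) by rewrite !mulr_ge0 // addr_ge0 // ltW.
  have K1 : 0 <= K0 + 1 by rewrite addr_ge0 // ltW.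
  by rewrite /C ltr_wpDr // ltr_wpDr // ltr_wpDr.
exists e1, C, mu; split=> // e /andP[e0].
rewrite /e1 !lt_min => /andP[/andP[/andP[l1 l2] /andP[l3 l4]] /andP[/andP[l5 l6] /andP[l7 /andP[l8 l9]]]].
have e0' := ltW e0.
have i1 : 0 < e < er1 by rewrite e0.
have i2 : 0 < e < er2 by rewrite e0.
have i3 : 0 < e < ec1 by rewrite e0.
have i4 : 0 < e < ec2 by rewrite e0.
have i5 : 0 < e < ed by rewrite e0.
have eX : e * X <= 1 by rewrite -ler_pdivlMr // div1r ltW.
have eN : Kd * e < dN by rewrite mulrC -ltr_pdivlMr.
have e1' : Kd * e <= 1 by rewrite mulrC -ler_pdivlMr // div1r ltW.
pose delta := Kd * e.
have de0 : 0 < delta by rewrite mulr_gt0.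
have deN : 0 < delta < dN by rewrite de0.
pose l := BB * (delta + e).
have l0 : 0 <= l by rewrite mulr_ge0 // addr_ge0 // ltW.
pose d0 := 2 * BB * K0 * e.
have inball (t f : R) : `|f| <= K0 -> `|t| <= delta -> `|f + t| <= M.
  by move=> hf ht; rewrite (le_trans (ler_normD _ _)) // lerD // (le_trans ht).
pose f1 y a b := nonlin1 (fn k) be u v y a b + e * rem1 k e (y / e) (u y + a) (v y + b).
pose f2 y a b := nonlin2 (fn k) be u v y a b + e * rem2 k e (y / e) (u y + a) (v y + b).
have Kb (y : R) : `|u y| <= M /\ `|v y| <= M.
  by have [h1 h2] := ub0 y; split; [apply: (le_trans h1)|apply: (le_trans h2)]; rewrite lerDl.
have z0M : `|0 : R| <= M by rewrite normr0.
have contr : Lam * (2 * l) <= 2^-1.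
  have -> : Lam * (2 * l) = (4 * Lam * BB * (Kd + 1)) * e / 2 by rewrite /l /delta; field.
  rewrite -[leRHS]mul1r ler_wpM2r ?invr_ge0 //.
  by apply: le_trans eX; rewrite mulrC ler_wpM2l // /X lerDl.
have inv : Lam * (d0 + 2 * l * delta) <= delta.
  have h1 : Lam * d0 <= delta / 2.
    have -> : Lam * d0 = (4 * Lam * BB * K0) * e / 2 by rewrite /d0; field.
    rewrite ler_wpM2r ?invr_ge0 // /delta ler_wpM2r // /Kd lerDl //.
  have h2 : Lam * (2 * l * delta) <= delta / 2.
    have -> : Lam * (2 * l * delta) = (Lam * (2 * l)) * delta by ring.
    by rewrite [delta / 2]mulrC ler_wpM2r // ltW.
  by rewrite mulrDr [leRHS]splitr lerD.
have [BNle Br1le Br2le Bc1le Bc2le] := le_sum5 BN0 Br10 Br20 Bc10 Bc20.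
have pf1 y a b : f1 (- y) a (- b) = - f1 y a b.
  have [p1 _] := rem_parity S e (y / e) (u y + a) (v y + b).
  rewrite /f1 vo ue mulNr -opprD p1 /nonlin1 ue vo; ring.
have pf2 y a b : f2 (- y) a (- b) = f2 y a b.
  have [_ p1] := rem_parity S e (y / e) (u y + a) (v y + b).
  rewrite /f2 vo ue mulNr -opprD p1 /nonlin2 ue vo; ring.
have nz1 y : nonlin1 (fn k) be u v y 0 0 = 0 by rewrite /nonlin1; ring.
have nz2 y : nonlin2 (fn k) be u v y 0 0 = 0 by rewrite /nonlin2; ring.
have fb0 y : 0 <= y -> `|f1 y 0 0| <= d0 * expR (- (mu * y)) /\ `|f2 y 0 0| <= d0 * expR (- (mu * y)).
  move=> y0; have [k1 k2] := Kb y; have [q1 q2] := ub' y; rewrite (ger0_norm y0) in q1 q2.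
  have [_ b1] := hr1 e (y / e) _ _ 0 0 i1 k1 k2 z0M z0M.
  have [_ b2] := hr2 e (y / e) _ _ 0 0 i2 k1 k2 z0M z0M.
  have [rz1 rz2] := rem_zero k e (y / e).
  rewrite rz1 !subr0 in b1; rewrite rz2 !subr0 in b2.
  rewrite /f1 /f2 nz1 nz2 !add0r !addr0 !(normrM e) !(gtr0_norm e0).
  have fin (Bi Y : R) : 0 <= Bi -> Bi <= BB -> Y <= Bi * (`|u y| + `|v y|) -> e * Y <= d0 * expR (- (mu * y)).
    move=> B0i hB hY.
    have -> : d0 * expR (- (mu * y)) = e * (BB * (K0 * expR (- (mu * y)) + K0 * expR (- (mu * y)))).
      by rewrite /d0; ring.
    rewrite ler_wpM2l // (le_trans hY) //; apply: ler_pM => //; exact: lerD.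
  by split; [exact: (fin _ _ Br10 Br1le b1) | exact: (fin _ _ Br20 Br2le b2)].
have flip y a b a' b' : `|a| <= delta -> `|b| <= delta -> `|a'| <= delta -> `|b'| <= delta ->
     `|f1 y a b - f1 y a' b'| <= l * (`|a - a'| + `|b - b'|) /\
     `|f2 y a b - f2 y a' b'| <= l * (`|a - a'| + `|b - b'|).
  move=> ha hb ha' hb'; have [k1 k2] := ub0 y.
  have [n1 n2] := hN delta y _ _ _ _ deN ha hb ha' hb'.
  have m1 := inball _ _ k1 ha; have m2 := inball _ _ k2 hb.
  have m3 := inball _ _ k1 ha'; have m4 := inball _ _ k2 hb'.
  have [_ b1] := hr1 e (y / e) _ _ _ _ i1 m1 m2 m3 m4.
  have [_ b2] := hr2 e (y / e) _ _ _ _ i2 m1 m2 m3 m4.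
  have ea : u y + a - (u y + a') = a - a' by ring.
  have eb : v y + b - (v y + b') = b - b' by ring.
  rewrite ea eb in b1 b2.
  set L := `|a - a'| + `|b - b'| in n1 n2 b1 b2 *; have L0 : 0 <= L by rewrite addr_ge0.
  have fin (X1 X2 Y1 Y2 Bi : R) : Bi <= BB -> `|X1 - X2| <= BN * delta * L -> `|Y1 - Y2| <= Bi * L ->
      `|X1 + e * Y1 - (X2 + e * Y2)| <= l * L.
    move=> hB hX hY.
    have -> : X1 + e * Y1 - (X2 + e * Y2) = (X1 - X2) + e * (Y1 - Y2) by ring.
    have -> : l * L = BB * (delta * L) + e * (BB * L) by rewrite /l; ring.
    apply: (le_trans (ler_normD _ _)); apply: lerD.
      by apply: (le_trans hX); rewrite -mulrA ler_wpM2r // mulr_ge0 // ltW.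
    rewrite normrM (gtr0_norm e0) ler_wpM2l // (le_trans hY) // ler_wpM2r //.
  by split; [exact: (fin _ _ _ _ _ Br1le n1 b1) | exact: (fin _ _ _ _ _ Br2le n2 b2)].
have det0 (w1 w2 : R -> R) : (forall y, `|w1 y| <= delta /\ `|w2 y| <= delta) ->
    forall y, 1 + e * ddet k e (y / e) (u y + w1 y) (v y + w2 y) != 0.
  move=> h y; have [h1 h2] := h y; have [k1 k2] := ub0 y.
  have := hd e (y / e) _ _ i5 (inball _ _ k1 h1) (inball _ _ k2 h2).
  by move=> h3; rewrite gt_eqF //; apply: lt_le_trans h3; rewrite invr_gt0.
have fcont z1 z2 : continuous z1 -> continuous z2 ->
     (forall y, `|z1 y| <= delta /\ `|z2 y| <= delta) ->
     continuous (fun y => f1 y (z1 y) (z2 y)) /\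
     continuous (fun y => f2 y (z1 y) (z2 y)).
  move=> cz1 cz2 hz.
  have cw1 : continuous (fun y => u y + z1 y) by cont.
  have cw2 : continuous (fun y => v y + z2 y) by cont.
  have [cr1 cr2] := rem_continuous S cw1 cw2 (det0 _ _ hz).
  by split; rewrite /f1 /f2 /nonlin1 /nonlin2; cont.
have [z1 [z2 [[dz1 dz2 ez oz] hz]]] :=
  fixed_point F mu0 muk de0 l0 contr inv pf1 pf2 fb0 flip fcont.
have hz' y : `|z1 y| <= delta /\ `|z2 y| <= delta.
  have [h1 h2] := hz y; have /andP[w0 w1] := w01 y.
  by split; [apply: (le_trans h1)|apply: (le_trans h2)]; rewrite ler_piMr // ltW.
pose w1 y := u y + z1 y; pose w2 y := v y + z2 y.
have dw1 : antider w1 (fun y => mean1 k (w1 y) (w2 y) + e * rem1 k e (y / e) (w1 y) (w2 y)).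
  eapply antider_eq; first by rewrite /w1; der.
  by move=> y /=; rewrite /f1 /nonlin1 /mean1 -/(w1 y) -/(w2 y) /w1 /w2 /be; field.
have dw2 : antider w2 (fun y => mean2 k (w1 y) (w2 y) + e * rem2 k e (y / e) (w1 y) (w2 y)).
  eapply antider_eq; first by rewrite /w2; der.
  by move=> y /=; rewrite /f2 /nonlin2 /mean2 -/(w1 y) -/(w2 y) /w1 /w2 /be; field.
have en0 : e != 0 by rewrite gt_eqF.
have [ds1 ds2] := slow_equation S en0 (det0 _ _ hz') dw1 dw2.
exists (fun y => w1 y + e * corr1 k (y / e) (w1 y) (w2 y)).
exists (fun y => w2 y + e * corr2 k (y / e) (w1 y) (w2 y)).
have wM y : `|w1 y| <= M /\ `|w2 y| <= M.
  by have [h1 h2] := hz' y; have [k1 k2] := ub0 y; split; apply: inball.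
have ww y : `|w1 y| <= (K0 + 1) * expR (- (mu * `|y|)) /\ `|w2 y| <= (K0 + 1) * expR (- (mu * `|y|)).
  have [h1 h2] := hz y; have [k1 k2] := ub' y; have := expR_ge0 (- (mu * `|y|)) => E0.
  have dE : delta * expR (- (mu * `|y|)) <= expR (- (mu * `|y|)).
    by rewrite -[leRHS]mul1r ler_wpM2r.
  by split; apply: (le_trans (ler_normD _ _)); rewrite mulrDl mul1r; apply: lerD => //;
    [exact: le_trans h1 _ | exact: le_trans h2 _].
have cb y : `|corr1 k (y / e) (w1 y) (w2 y)| <= BB * (`|w1 y| + `|w2 y|) /\
            `|corr2 k (y / e) (w1 y) (w2 y)| <= BB * (`|w1 y| + `|w2 y|).
  have [m1 m2] := wM y.
  have [_ b1] := hc1 e (y / e) _ _ 0 0 i3 m1 m2 z0M z0M.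
  have [_ b2] := hc2 e (y / e) _ _ 0 0 i4 m1 m2 z0M z0M.
  have [cz1 cz2] := corr_zero k (y / e).
  rewrite cz1 !subr0 in b1; rewrite cz2 !subr0 in b2.
  by split; [apply: (le_trans b1) | apply: (le_trans b2)]; rewrite ler_wpM2r // addr_ge0.
split=> //.
- move=> y; have [p1 p2] := corr_parity S (y / e) (w1 y) (w2 y).
  have e1w : w1 (- y) = w1 y by rewrite /w1 ue ez.
  have e2w : w2 (- y) = - w2 y by rewrite /w2 vo oz opprD.
  by rewrite e1w e2w mulNr p1 p2; split; ring.
- move=> y; have [h1 h2] := hz' y; have [c1 c2] := cb y; have [m1 m2] := wM y.
  have fin (f t s : R) : `|t| <= delta -> `|s| <= BB * (`|w1 y| + `|w2 y|) ->
      `|f + t + e * s - f| <= C * e.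
    move=> ht hs; have -> : f + t + e * s - f = t + e * s by ring.
    apply: (le_trans (ler_normD _ _)); rewrite normrM (gtr0_norm e0).
    have hs' : `|s| <= BB * (M + M).
      by apply: (le_trans hs); rewrite ler_wpM2l // lerD.
    apply: (@le_trans _ _ (delta + e * (BB * (M + M)))).
      by rewrite lerD // ler_wpM2l.
    have -> : delta + e * (BB * (M + M)) = (Kd + 2 * BB * (K0 + 1)) * e.
      by rewrite /delta /M; ring.
    by rewrite ler_wpM2r // /C -[leRHS]addrA lerDl !addr_ge0 // ltW.
  by split; apply: fin.
- move=> y; have [c1 c2] := cb y; have [m1 m2] := ww y.
  have E0 := expR_ge0 (- (mu * `|y|)).
  have fin (f s : R) : `|f| <= (K0 + 1) * expR (- (mu * `|y|)) ->
     `|s| <= BB * (`|w1 y| + `|w2 y|) -> `|f + e * s| <= C * expR (- (mu * `|y|)).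
    move=> hf hs; apply: (le_trans (ler_normD _ _)); rewrite normrM (gtr0_norm e0).
    have hs' : `|s| <= BB * ((K0 + 1) * expR (- (mu * `|y|)) + (K0 + 1) * expR (- (mu * `|y|))).
      by apply: (le_trans hs); rewrite ler_wpM2l // lerD.
    have hs2 : e * `|s| <= 2 * BB * (K0 + 1) * expR (- (mu * `|y|)).
      rewrite -[leLHS]mulr1 mulrAC; apply: (@le_trans _ _ (1 * `|s|)).
        by rewrite mulr1 ler_wpM2r // ltW.
      by rewrite mul1r (le_trans hs') // le_eqVlt; apply/orP; left; apply/eqP; ring.
    apply: (@le_trans _ _ ((K0 + 1 + 2 * BB * (K0 + 1)) * expR (- (mu * `|y|)))).
      by rewrite mulrDl lerD.
    have -> : C = K0 + 1 + 2 * BB * (K0 + 1) + (Kd + BB) by rewrite /C; ring.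
    by rewrite ler_wpM2r // lerDl addr_ge0 // ltW.
  by split; apply: fin.
Qed.

End SlowOrbit.

(** * Passage to complex-valued functions *)

Section ComplexLimits.
Variable R : realType.
Local Open Scope complex_scope.
Local Notation Re := (@complex.Re R).
Local Notation Im := (@complex.Im R).

Lemma ltcR_exists (e : R[i]) : 0 < e -> exists2 r : R, 0 < r & e = r%:C.
Proof.
case: e => a b; rewrite ltcE /= => /andP[/eqP b0 a0].
by exists a => //; rewrite b0.
Qed.

Lemma normr_realC (x : R) : `|x%:C| = `|x|%:C.
Proof. by rewrite normc_def /= expr0n /= addr0 sqrtr_sqr. Qed.

Lemma cmod_realC (x : R) : cmod x%:C = `|x|.
Proof. by rewrite /cmod normr_realC. Qed.

Lemma norm_Re_le (z : R[i]) : `|Re z|%:C <= `|z|.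
Proof.
by case: z => a b; rewrite normc_def /= lecR -sqrtr_sqr ler_wsqrtr // lerDl sqr_ge0.
Qed.

Lemma norm_Im_le (z : R[i]) : `|Im z|%:C <= `|z|.
Proof.
by case: z => a b; rewrite normc_def /= lecR -sqrtr_sqr ler_wsqrtr // lerDr sqr_ge0.
Qed.

Lemma cvgC_Re (T : Type) (F : set_system T) {FF : Filter F} (f : T -> R[i]) (l : R[i]) :
  ((f x : R[i]^o) @[x --> F] --> (l : R[i]^o)) -> Re (f x) @[x --> F] --> Re l.
Proof.
move=> /cvgrPdist_lt h; apply/cvgrPdist_lt => e e0.
have e0' : 0 < e%:C :> R[i] by rewrite ltcR.
apply: filterS (h _ e0') => x /= hx.
have := le_lt_trans (norm_Re_le (l - f x)) hx; rewrite ltcR.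
by case: (l) (f x) => [a b] [c d].
Qed.

Lemma cvgC_Im (T : Type) (F : set_system T) {FF : Filter F} (f : T -> R[i]) (l : R[i]) :
  ((f x : R[i]^o) @[x --> F] --> (l : R[i]^o)) -> Im (f x) @[x --> F] --> Im l.
Proof.
move=> /cvgrPdist_lt h; apply/cvgrPdist_lt => e e0.
have e0' : 0 < e%:C :> R[i] by rewrite ltcR.
apply: filterS (h _ e0') => x /= hx.
have := le_lt_trans (norm_Im_le (l - f x)) hx; rewrite ltcR.
by case: (l) (f x) => [a b] [c d].
Qed.

Lemma cvg_realC (T : Type) (F : set_system T) {FF : Filter F} (f : T -> R) (l : R) :
  f x @[x --> F] --> l -> ((f x)%:C : R[i]^o) @[x --> F] --> (l%:C : R[i]^o).
Proof.
move=> /cvgrPdist_lt h; apply/cvgrPdist_lt => e /ltcR_exists[r r0 ->].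
apply: filterS (h _ r0) => x /= hx.
by rewrite -rmorphB /= normr_realC ltcR.
Qed.

End ComplexLimits.

(** * Real form of the hypotheses on the potential and the orbit *)

Section Hypotheses.
Variable R : realType.
Local Open Scope complex_scope.
Local Notation Re := (@complex.Re R).
Local Notation Im := (@complex.Im R).

Lemma esum_term_le (T : choiceType) (a : T -> \bar R) (t : T) :
  (forall t, 0 <= a t)%E -> (a t <= \esum_(s in [set: T]) a s)%E.
Proof.
move=> a0; rewrite -(esum_set1 (a0 t)) (esum_mkcond [set t]).
by apply: le_esum => s _; case: ifP.
Qed.

(** A single term is at most the sum, and the exponent 2 yields the summable decay that
    [cos_sum_tail] requires. *)
Lemma sobolev_coefficient_bound (w : int -> R[i]) :
  (sobolev_sum w 2 < +oo)%E ->
  exists A, forall m : nat, cmod (w m%:Z) <= A / (1 + m%:R ^+ 2).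
Proof.
move=> hs.
have q1 (x : R) : 0 < 1 + x ^+ 2 by rewrite ltr_wpDr // sqr_ge0.
have cm0 z : 0 <= cmod z :> R by case: z => a b; rewrite /cmod normc_def /= sqrtr_ge0.
have t0 (m : int) : (0 <= ((1 + m%:~R ^+ 2) `^ 2 * cmod (w m) ^+ 2)%R%:E :> \bar R)%E.
  by rewrite lee_fin mulr_ge0 // ?powR_ge0 // sqr_ge0.
have : (sobolev_sum w 2 \is a fin_num)%E.
  by rewrite ge0_fin_numE //; apply: esum_ge0 => m _; exact: t0.
case E : (sobolev_sum w 2) => [B||//] // _.
exists (Num.sqrt B) => m; rewrite ler_pdivlMr //.
have := esum_term_le m%:Z t0; rewrite -/(sobolev_sum w 2) E lee_fin => h.
have q0 := ltW (q1 (m%:R)).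
have e : (1 + (m%:Z)%:~R ^+ 2 : R) `^ 2 * cmod (w m%:Z) ^+ 2 =
    (cmod (w m%:Z) * (1 + m%:R ^+ 2)) ^+ 2.
  by rewrite -pmulrn powR_mulrn // exprMn mulrC.
rewrite e in h; rewrite -[leLHS]ger0_norm ?mulr_ge0 // -sqrtr_sqr.
exact: ler_wsqrtr.
Qed.

Lemma cos_sum_of_fourier (w : int -> R[i]) (c : nat -> R) (N : nat) (x : R) :
  (forall m : nat, w m%:Z = (c m)%:C) -> (forall m, w m = w (- m)) ->
  Re (\sum_(0 <= j < N.*2.+1)
        w (j%:Z - N%:Z) * expi ((j%:Z - N%:Z)%:~R * x)) = cos_sum c N x.
Proof.
move=> hc hw.
have reM (r t : R) : Re (r%:C * expi t) = r * cos t by rewrite /expi /=; ring.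
elim: N => [|N IH].
  by rewrite big_nat1 subr0 hc reM /cos_sum mul0r cos0 mulr1 big_geq // addr0.
rewrite cos_sumS -IH doubleS big_nat_recl // big_nat_recr //=.
rewrite 2!(raddfD (@complex.Re R)) /= addrCA; congr (_ + _).
  congr Re; apply: eq_bigr => j _.
  by have -> : j.+1%:Z - N.+1%:Z = j%:Z - N%:Z by rewrite !intS; ring.
have -> : (0%N : int) - N.+1%:Z = - N.+1%:Z by rewrite sub0r.
have -> : (N.*2.+2)%:Z - N.+1%:Z = N.+1%:Z.
  by rewrite -addnn -addSn -addnS PoszD addrK.
rewrite -hw hc !reM mulrNz mulNr cosN pmulrn; ring.
Qed.

Record potential (W : R -> R) (c : nat -> R) (A : R) : Prop := {
  pot_smooth : smooth W;
  pot_periodic : forall x, W (x + 2 * pi) = W x;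
  pot_even : forall x, W (- x) = W x;
  pot_c0 : c 0%N = 0;
  pot_decay : forall m, `|c m| <= A / (1 + m%:R ^+ 2);
  pot_series : forall x, cos_sum c N x @[N --> \oo] --> W x }.

Lemma admissible_potential_real (W : R -> R) (w : int -> R[i]) :
  admissible_potential W w ->
  (forall m : nat, w m%:Z = (Re (w m%:Z))%:C) /\
  exists A, potential W (fun m => Re (w m%:Z)) A.
Proof.
move=> [[sW pW _ eW] [fW hs w0 ww]].
have wr (m : nat) : w m%:Z = (Re (w m%:Z))%:C.
  have [_] := ww m%:Z; case: (w m%:Z) => a b /= [] h.
  by congr (_ +i* _); lra.
have s2 : 1 / 2 < 2 :> R by lra.
split=> //; have [A hA] := sobolev_coefficient_bound (hs 2 s2).
exists A; split=> //.
- by rewrite w0.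
- by move=> m; have := hA m; rewrite wr cmod_realC.
- move=> x; rewrite (_ : (fun N => _) = fun N : nat => Re (\sum_(0 <= j < N.*2.+1)
        w (j%:Z - N%:Z) * expi ((j%:Z - N%:Z)%:~R * x))); first exact: cvgC_Re (fW x).
  apply/funext => N; rewrite (cos_sum_of_fourier (c := fun m => Re (w m%:Z))) //.
  by move=> m; have [] := ww m.
Qed.

(** Multiplying the imaginary part by [tau] replaces [w_{2n}], [Omega], [sigma] by their products
    with [tau], so the coupling becomes positive and exceeds [|Omega|]. *)
Lemma homoclinic_real (n : nat) (Om sg wr tau : R) (a b : R -> R[i]) :
  (0 < n)%N -> tau ^+ 2 = 1 -> `|Om| < tau * wr ->
  reversible_homoclinic n Om sg wr%:C a b ->
  let u y := Re (a y) in let v y := tau * Im (a y) in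
  [/\ averaged_orbit n%:R (tau * wr - tau * Om) (tau * wr + tau * Om) (3 * (tau * sg)) u v,
      zero_energy (tau * wr - tau * Om) (tau * wr + tau * Om) (3 * (tau * sg)) u v,
      (forall y, 0 < u y ^+ 2 + v y ^+ 2),
      (forall y, u (- y) = u y) /\ (forall y, v (- y) = - v y) &
      0 < tau * sg].
Proof.
move=> n0 tau2 hOm [hcm hne va _ sym] u v.
have nR : 0 < n%:R :> R by rewrite ltr0n.
have nn0 : n%:R != 0 :> R by rewrite gt_eqF.
have tn0 : tau != 0 by apply/eqP => t0; move: tau2; rewrite t0 expr0n /= => /esym/eqP; rewrite oner_eq0.
have tauOm : `|tau * Om| = `|Om|.
  rewrite normrM; have -> : `|tau| = 1; last by rewrite mul1r.
  by apply/eqP; rewrite -sqrp_eq1 // real_normK ?num_real // tau2.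
have al0 : 0 < tau * wr - tau * Om.
  by move: hOm; rewrite -tauOm ltr_norml => /andP[_]; rewrite subr_gt0.
have ga0 : 0 < tau * wr + tau * Om.
  by move: hOm; rewrite -tauOm ltr_norml => /andP[+ _]; rewrite ltrNl -subr_gt0 opprK addrC.
have bE y : b y = (a y)^* by have [_ ->] := sym y; rewrite conjcK.
have ue y : u (- y) = u y by rewrite /u; have [-> _] := sym (- y); rewrite opprK; case: (a y).
have vo y : v (- y) = - v y.
  by rewrite /v; have [-> _] := sym (- y); rewrite opprK; case: (a y) => s t /=; ring.
have [du0 dv0] : (antider (fun y => Re (a y)) (fun y =>
    (wr - Om + 3 * sg * (Re (a y) ^+ 2 + Im (a y) ^+ 2)) * Im (a y) / n%:R)) /\
  (antider (fun y => Im (a y)) (fun y =>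
    (Om + wr - 3 * sg * (Re (a y) ^+ 2 + Im (a y) ^+ 2)) * Re (a y) / n%:R)).
  have key y : derive1 (fun t => Re (a t)) y =
    (wr - Om + 3 * sg * (Re (a y) ^+ 2 + Im (a y) ^+ 2)) * Im (a y) / n%:R /\
    derive1 (fun t => Im (a t)) y =
    (Om + wr - 3 * sg * (Re (a y) ^+ 2 + Im (a y) ^+ 2)) * Re (a y) / n%:R.
    have [_ _ + _] := hcm y; rewrite bE /cderiv.
    move: (derive1 _ y) (derive1 _ y) => p q.
    case: (a y) => s t.
    have nrm : forall s t : R, `|s +i* t| ^+ 2 = (s ^+ 2 + t ^+ 2)%:C.
      by move=> s1 t1; rewrite normc_def -rmorphXn /= sqr_sqrtr // addr_ge0 ?sqr_ge0.
    have nC : n%:R = (n%:R : R)%:C by rewrite rmorph_nat.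
    rewrite /= !nrm nC sqrrN.
    have -> : 2 = (2 : R)%:C by rewrite rmorph_nat.
    move=> [h1 h2]; split; apply: (mulIf nn0); rewrite divfK //; lra.
  split=> y; have [k1 k2] := key y; have [[dr di] _ _ _] := hcm y.
  - by rewrite -k1 derive1E; exact: DeriveDef.
  - by rewrite -k2 derive1E; exact: DeriveDef.
have sq y : v y ^+ 2 = Im (a y) ^+ 2 by rewrite /v exprMn tau2 mul1r.
have orb : averaged_orbit n%:R (tau * wr - tau * Om) (tau * wr + tau * Om) (3 * (tau * sg)) u v.
  split.
    apply: antider_eq du0 _ => y; rewrite sq /u /v.
    have -> : tau * wr - tau * Om + 3 * (tau * sg) * (Re (a y) ^+ 2 + Im (a y) ^+ 2) =
      tau * (wr - Om + 3 * sg * (Re (a y) ^+ 2 + Im (a y) ^+ 2)) by ring.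
    have -> : forall s : R, tau * s * (tau * Im (a y)) = tau ^+ 2 * (s * Im (a y)) by move=> s; ring.
    by rewrite tau2 mul1r.
  eapply antider_eq; first by rewrite /v; der.
  by move=> y /=; rewrite -/(v y) sq /u; ring.
have small e : 0 < e -> exists y, `|u y| < e /\ `|v y| < e.
  move=> e0; have [vp _] := va.
  have h1 : Re (a x) @[x --> +oo] --> Re (0 : R[i]) by exact: cvgC_Re vp.
  have h2 : Im (a x) @[x --> +oo] --> Im (0 : R[i]) by exact: cvgC_Im vp.
  move/cvgrPdist_lt: h1 => /(_ _ e0) h1; move/cvgrPdist_lt: h2 => /(_ _ e0) h2.
  have [y [hy1 hy2]] : exists y, `|Re (0 : R[i]) - Re (a y)| < e /\ `|Im (0 : R[i]) - Im (a y)| < e.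
    by near (pinfty_nbhs R) => y; exists y; split; near: y.
  exists y; split; first by move: hy1; rewrite /= sub0r normrN.
  by rewrite -sqrtr_sqr sq sqrtr_sqr; move: hy2; rewrite /= sub0r normrN.
have en := energy_zero nR al0 ga0 orb small.
have r0 : forall y, 0 < u y ^+ 2 + v y ^+ 2.
  have [y hy] := hne.
  apply: (radius_gt0 (y0 := y) nR al0 ga0 orb).
  rewrite sq /u lt_neqAle addr_ge0 ?sqr_ge0 // andbT eq_sym paddr_eq0 ?sqr_ge0 // !sqrf_eq0.
  move: hy; rewrite bE conjc_eq0 orbb; apply: contra => /andP[/eqP h1 /eqP h2].
  by move: h1 h2; case: (a y) => s t /= -> ->.
have v0 : v 0 = 0 by have := vo 0; rewrite oppr0 => h; lra.
split=> //.
(* Where [v] vanishes the energy relation reads [gamma u^2 = beta / 2 * u^4] with [u] nonzero, which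
   forces [beta > 0]. *)
have := en 0; have := r0 0; rewrite v0 expr0n /= mulr0 subr0 addr0 => u0 e.
have : 0 < 3 * (tau * sg) / 2 * (u 0 ^+ 2) ^+ 2 by rewrite -e mulr_gt0.
rewrite (pmulr_lgt0 _ (exprn_gt0 2 u0)) => h.
lra.
Unshelve. all: by end_near. Qed.

End Hypotheses.

(** * Smoothness of the solution *)

Section Regularity.
Variable R : realType.

Fixpoint bounded_derivatives (j : nat) (f : R -> R) : Prop :=
  continuous f /\ (exists B, forall y, 0 <= y -> `|f y| <= B) /\
  if j is j'.+1 then exists2 f', antider f f' & bounded_derivatives j' f' else True.

Lemma decaying_derivatives_weaken l j f : decaying_derivatives l j.+1 f -> @decaying_derivatives R l j f.
Proof.
elim: j f => [|j IH] f [cf [ef [f' df hf']]]; first by split.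
by split=> //; split=> //; exists f' => //; exact: IH.
Qed.

Lemma bounded_derivatives_weaken j f : bounded_derivatives j.+1 f -> bounded_derivatives j f.
Proof.
elim: j f => [|j IH] f [cf [ef [f' df hf']]]; first by split.
by split=> //; split=> //; exists f' => //; exact: IH.
Qed.

Lemma decaying_bounded l j f : 0 < l -> decaying_derivatives l j f -> bounded_derivatives j f.
Proof.
move=> l0; have key g : exp_decay l g -> exists B, forall y, 0 <= y -> `|g y| <= B.
  move=> [K hK]; exists K => y y0; apply: (le_trans (hK y y0)).
  have K0 : 0 <= K by exact: exp_bound_ge0 hK.
  by rewrite ler_piMr // expR_le1 oppr_le0 mulr_ge0 // ltW.
elim: j f => [|j IH] f [cf [ef h]]; first by split=> //; split=> //; exact: key.
split=> //; split; first exact: key.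
by have [f' df hf'] := h; exists f' => //; exact: IH.
Qed.

Lemma decaying_add l j (f g : R -> R) : decaying_derivatives l j f -> decaying_derivatives l j g ->
  decaying_derivatives l j (fun x => f x + g x).
Proof.
elim: j f g => [|j IH] f g [cf [ef hf]] [cg [eg hg]].
  by split; [exact: cont_add | split=> //; exact: exp_decay_add].
split; first exact: cont_add.
split; first exact: exp_decay_add.
have [f' df hf'] := hf; have [g' dg hg'] := hg.
by exists (fun x => f' x + g' x); [exact: antiderD | exact: IH].
Qed.

Lemma decaying_mul l j (f g : R -> R) : decaying_derivatives l j f -> bounded_derivatives j g ->
  decaying_derivatives l j (fun x => f x * g x).
Proof.
elim: j f g => [|j IH] f g hf hg.
  move: (hf) (hg) => [cf [ef _]] [cg [[B hB] _]].
  by split; [exact: cont_mul | split=> //; exact: exp_decay_mul_bounded hB].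
move: (hf) (hg) => [cf [ef [f' df hf']]] [cg [[B hB] [g' dg hg']]].
split; first exact: cont_mul.
split; first exact: exp_decay_mul_bounded hB.
exists (fun x => f' x * g x + f x * g' x); first exact: antiderM.
apply: decaying_add; apply: IH => //.
  exact: bounded_derivatives_weaken.
exact: decaying_derivatives_weaken.
Qed.

Lemma bounded_cst j (c : R) : bounded_derivatives j (fun=> c).
Proof.
elim: j c => [|j IH] c; split; try exact: cont_cst; split=> //; try by exists `|c|.
by exists (fun=> 0); [exact: antider_cst | exact: IH].
Qed.

Lemma smooth_bounded (W : R -> R) (T : R) (j : nat) : 0 < T -> smooth W ->
  (forall x, W (x + T) = W x) -> bounded_derivatives j W.
Proof.
move=> T0 sW pW.
have d i : antider (derive1n i W) (derive1n i.+1 W).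
  by move=> x; rewrite derive1nS derive1E; exact: DeriveDef.
have p i x : derive1n i W (x + T) = derive1n i W x.
  elim: i x => [|i IH] x; first by rewrite derive1n0.
  have id : antider (fun y : R => y + T) (fun=> 1).
    by eapply antider_eq; [der | move=> y /=; ring].
  have := antider_comp id (d i) x; rewrite mulr1.
  rewrite (_ : (fun x => derive1n i W (x + T)) = derive1n i W); last by apply/funext.
  by move=> h; exact: derive_unique h (d i x).
have c i := antider_continuous (d i).
have b i : exists B, forall y, 0 <= y -> `|derive1n i W y| <= B.
  by have [B hB] := periodic_bounded T0 (c i) (p i); exists B.
suff h i : bounded_derivatives j (derive1n i W) by have := h 0%N; rewrite derive1n0.
elim: j i => [|j IH] i; (split; first exact: c); (split; first exact: b) => //.
by exists (derive1n i.+1 W).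
Qed.

(** Bootstrap: the equation writes [U''] as a polynomial in [U] with bounded smooth coefficients, so
    decay of [j] derivatives of [U] passes to one more. *)
Lemma solution_decaying (l E sg eps : R) (W U U1 : R -> R) : 0 < l ->
  (forall j, bounded_derivatives j W) ->
  antider U U1 -> antider U1 (fun x => - (E + eps * W x) * U x + sg * U x ^+ 3) ->
  exp_decay l U -> exp_decay l U1 -> forall j, decaying_derivatives l j U.
Proof.
move=> l0 hW dU dU1 eU eU1.
have cU := antider_continuous dU; have cU1 := antider_continuous dU1.
suff h j : decaying_derivatives l j U /\ decaying_derivatives l j U1.
  by move=> j; have [] := h j.
elim: j => [|j [IH IH1]]; first by split; split.
split; first by split=> //; split=> //; exists U1.
split=> //; split=> //; exists (fun x => - (E + eps * W x) * U x + sg * U x ^+ 3) => //.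
have bU := decaying_bounded l0 IH.
have s (c : R) f : decaying_derivatives l j f -> decaying_derivatives l j (fun x => f x * c).
  by move=> hf; apply: decaying_mul => //; exact: bounded_cst.
rewrite (_ : (fun x => _) = fun x => (U x * (- E) + U x * W x * (- eps)) + U x * U x * U x * sg).
  apply: decaying_add; last by do !(apply: s || apply: decaying_mul).
  by apply: decaying_add; [exact: s | apply: s; exact: decaying_mul].
by apply/funext => x; ring.
Qed.

(** Variation of constants for the oscillator of frequency [|nu| / 2]. The identity
    [slow1 fc = slow2 fs] cancels the amplitude derivatives in [U'], and [fc^2 + fs^2 = 1] collects
    the forcing in [U1']. *)
Lemma fast_solution (k : fast_data R) (nu B tau e : R) (z1 z2 : R -> R) :
  fast_spec k nu B -> 0 < e -> tau ^+ 2 = 1 -> nu = tau * fn k ->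
  antider z1 (fun y => slow1 k (y / e) (z1 y) (z2 y)) ->
  antider z2 (fun y => slow2 k (y / e) (z1 y) (z2 y)) ->
  let U x := 2 * Num.sqrt e * (z1 (e * x) * fc k x - z2 (e * x) * fs k x) in
  let U1 x := - nu * Num.sqrt e * (z1 (e * x) * fs k x + z2 (e * x) * fc k x) in
  antider U U1 /\
  antider U1 (fun x => - (fn k ^+ 2 / 4 + e * (tau * fOm k) + e * (tau * fW k x)) * U x +
     tau * fsig k * U x ^+ 3).
Proof.
move=> S e0 t2 nuE dz1 dz2 U U1.
have en0 : e != 0 by rewrite gt_eqF.
have nn0 : fn k != 0 by rewrite gt_eqF // (fast_n S).
have ds := fast_ds S; have dc := fast_dc S; have cs := fast_cs S.
have ie : antider (fun x => e * x) (fun=> e) by eapply antider_eq; [der | move=> x /=; ring].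
have d1 := antider_comp ie dz1; have d2 := antider_comp ie dz2.
have r2 : Num.sqrt e ^+ 2 = e by rewrite sqr_sqrtr // ltW.
have ee x : e * x / e = x by rewrite mulrAC mulfV // mul1r.
split.
  eapply antider_eq; [rewrite /U; der | move=> x /=].
  by rewrite /slow1 /slow2 /U1 ee; field.
eapply antider_eq; [rewrite /U1; der | move=> x /=].
rewrite /slow1 /slow2 /U ee.
have -> : z1 (e * x) * fc k x - z2 (e * x) * fs k x = carrier k x (z1 (e * x)) (z2 (e * x)) by [].
set g := carrier _ _ _ _.
have h := cs x.
transitivity (- nu * Num.sqrt e * ((forcing k x g / fn k * e) * (fc k x ^+ 2 + fs k x ^+ 2) +
  nu / 2 * g)).
  by move: (forcing k x g) => Fg; rewrite /g /carrier; ring.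
rewrite h mulr1 nuE /forcing.
have -> : (2 * Num.sqrt e * g) ^+ 3 = 8 * Num.sqrt e * g ^+ 3 * Num.sqrt e ^+ 2 by ring.
rewrite r2.
transitivity (- (tau ^+ 2) * fn k ^+ 2 / 2 * Num.sqrt e * g - tau * Num.sqrt e * e *
  (2 * (fOm k + fW k x) * g - 8 * fsig k * g ^+ 3)); first by field.
by rewrite t2; field.
Qed.

End Regularity.

(** * Transfer of the real solution and its transform to the complex-valued statement *)

Section Conclusions.
Variable R : realType.
Local Open Scope complex_scope.
Local Notation Re := (@complex.Re R).
Local Notation Im := (@complex.Im R).
Local Notation mu := (@lebesgue_measure R).

Lemma expn_le_pow (k : R) (m : nat) : (1 + k ^+ 2) ^+ m <= 2 ^+ m * (1 + `|k| ^+ (2 * m)).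
Proof.
have k2 : 0 <= k ^+ 2 := sqr_ge0 k.
have km : 0 <= `|k| ^+ (2 * m) by exact: exprn_ge0.
have [k1|/ltW k1] := leP (k ^+ 2) 1.
  apply: (@le_trans _ _ (2 ^+ m)); last by rewrite ler_peMr ?exprn_ge0 // lerDl.
  by apply: lerXn2r; rewrite ?nnegrE //; lra.
apply: (@le_trans _ _ ((2 * k ^+ 2) ^+ m)).
  by apply: lerXn2r; rewrite ?nnegrE //; lra.
by rewrite exprMn exprM real_normK ?num_real // ler_wpM2l ?exprn_ge0 // lerDr.
Qed.

Lemma in_L1q_real (f : R -> R) : continuous f ->
  (forall j, exists C, forall k, `|k| ^+ j * `|f k| <= C) ->
  forall q : R, 0 <= q -> in_L1q q (fun k => (f k)%:C).
Proof.
move=> cf hf q q0.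
have q1 (x : R) : 0 < 1 + x ^+ 2 by rewrite ltr_wpDr // sqr_ge0.
(* The power [m] dominates the weight, and one more factor [1 + k^2] is kept for integrability. *)
pose m := Num.bound q.
have qm : q / 2 <= m%:R.
  have := archi_boundP q0; rewrite -/m; move: (m%:R) => t; lra.
have [C0 hC0] := hf 0%N; have [C1 hC1] := hf (2 * m.+1)%N.
pose C := 2 ^+ m.+1 * (C0 + C1).
have dom k : (1 + k ^+ 2) `^ (q / 2) * `|f k| <= C / (1 + k ^+ 2).
  rewrite ler_pdivlMr // mulrAC.
  have h1 : (1 + k ^+ 2) `^ (q / 2) * (1 + k ^+ 2) <= (1 + k ^+ 2) ^+ m.+1.
    rewrite (exprSr (1 + k ^+ 2)) ler_wpM2r ?(ltW (q1 _)) // -(@powR_mulrn _ (1 + k ^+ 2) m) ?(ltW (q1 _)) //.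
    by apply: ler_powR => //; rewrite lerDl sqr_ge0.
  apply: (@le_trans _ _ (2 ^+ m.+1 * (1 + `|k| ^+ (2 * m.+1)) * `|f k|)).
    by rewrite ler_wpM2r // (le_trans h1) // expn_le_pow.
  rewrite -mulrA /C ler_wpM2l ?exprn_ge0 // mulrDl mul1r; apply: lerD => //.
  by have := hC0 k; rewrite expr0 mul1r.
split.
- exact: continuous_measurable_fun.
- exact: measurable_cst.
have cg : continuous (fun k : R => C * (1 + k ^+ 2)^-1).
  have cq : continuous (fun x : R => (1 + x ^+ 2)^-1).
    by apply: cont_inv => [x|]; [rewrite gt_eqF | cont].
  by cont.
have CC0 : 0 <= C.
  have := dom 0; rewrite expr0n /= addr0 divr1; apply: le_trans.
  by rewrite mulr_ge0 // powR_ge0.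
have bg (k : R) : `|C * (1 + k ^+ 2)^-1| <= C / (1 + k ^+ 2).
  by rewrite ger0_norm // divr_ge0 // ltW.
have dat : antider (fun x => 2 * C * @atan R x) (fun x => C * (1 + x ^+ 2)^-1 + C * (1 + (- x) ^+ 2)^-1).
  have d0 : antider (@atan R) (fun x => (1 + x ^+ 2)^-1) by move=> x; exact: is_derive1_atan.
  by eapply antider_eq; [der | move=> x /=; rewrite sqrrN; ring].
have lat : (2 * C * atan x) @[x --> +oo] --> 2 * C * (pi / 2).
  exact: cvgM (@cvg_cst _ (2 * C) _ (pinfty_nbhs R) _) (@cvgy_atan R).
have a0 : 2 * C * atan (0 : R) = 0 by rewrite atan0 mulr0.
have [ig _] := Rintegral_primitive cg bg dat a0 lat.
have /integrableP[mg hfin] := ig.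
rewrite /L1q_norm; apply: le_lt_trans hfin.
apply: ge0_le_integral => //.
- by move=> k _; rewrite lee_fin mulr_ge0 // ?powR_ge0 // cmod_realC.
- apply/measurable_EFinP; apply: continuous_measurable_fun.
  rewrite (_ : (fun k => _) = fun k => (1 + k ^+ 2) `^ (q / 2) * `|f k|); last first.
    by apply/funext => k; rewrite cmod_realC.
  have cp : continuous (fun k : R => (1 + k ^+ 2) `^ (q / 2)).
    have ln_cont : continuous (fun k : R => ln (1 + k ^+ 2)).
      have cq : continuous (fun k : R => 1 + k ^+ 2) by cont.
      by move=> k; exact: (continuous_comp (cq k) (continuous_ln (q1 k))).
    rewrite (_ : (fun k => _) = fun k : R => expR (q / 2 * ln (1 + k ^+ 2))); first by cont.
    by apply/funext => k; rewrite /powR gt_eqF.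
  by cont.
- exact: measurableT_comp.
- by move=> k _; rewrite /= lee_fin cmod_realC (le_trans (dom k)) ?ler_norm.
Qed.

Lemma fourier_form_real (eps : R) (f g : R -> R) (x : R) : 0 < eps ->
  Rintegral mu setT (fun k => f k * cos (k * x)) = 2 * pi * ((Num.sqrt eps * Num.sqrt (2 * pi))^-1 * g x) ->
  Rintegral mu setT (fun k => f k * sin (k * x)) = 0 ->
  fourier_form eps (fun k => (f k)%:C) x = (g x)%:C.
Proof.
move=> e0 hc hs.
have pi0 : 0 < 2 * pi :> R by rewrite mulr_gt0 // pi_gt0.
have s1 : Num.sqrt eps != 0 by rewrite gt_eqF // sqrtr_gt0.
have s2 : Num.sqrt (2 * pi) != 0 :> R by rewrite gt_eqF // sqrtr_gt0.
have s3 : Num.sqrt (2 * pi) ^+ 2 = 2 * pi :> R by rewrite sqr_sqrtr // ltW.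
rewrite /fourier_form /cintegral.
rewrite (_ : (fun k : R => Re ((f k)%:C * expi (k * x))) = fun k => f k * cos (k * x)); last first.
  by apply/funext => k; rewrite /expi /=; ring.
rewrite (_ : (fun k : R => Im ((f k)%:C * expi (k * x))) = fun k => f k * sin (k * x)); last first.
  by apply/funext => k; rewrite /expi /=; ring.
rewrite hc hs; move: (Num.sqrt (2 * pi)) s2 s3 => r s2 <-.
apply/eqP; rewrite eq_complex /=; apply/andP; split; apply/eqP; last by ring.
by field; rewrite s1 s2.
Qed.

Lemma elliptic_solution_real (omega2 eps sigma : R) (W U U1 : R -> R) :
  antider U U1 ->
  antider U1 (fun x => - (omega2 + eps * W x) * U x + sigma * U x ^+ 3) ->
  elliptic_solution omega2 eps sigma W (fun x => (U x)%:C).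
Proof.
move=> dU dU1 x.
have d0 y : derivable (fun _ : R => (0 : R)) y 1 by exact: derivable_cst.
have dz y : derive1 (fun _ : R => (0 : R)) y = 0 by rewrite derive1_cst.
have E1 : cderiv (fun x => (U x)%:C) = fun x => (U1 x)%:C.
  apply/funext => y; rewrite /cderiv /= dz; congr (_ +i* _).
  by rewrite derive1E; have h := dU y; rewrite derive_val.
have E2 : cderiv (fun x => (U1 x)%:C) x = (- (omega2 + eps * W x) * U x + sigma * U x ^+ 3)%:C.
  rewrite /cderiv /= dz; congr (_ +i* _).
  by rewrite derive1E; have h := dU1 x; rewrite derive_val.
split.
- by split=> //=; have [] := dU x.
- by rewrite E1; split=> //=; have [] := dU1 x.
- rewrite E1 E2 normr_realC -!rmorphM -!rmorphXn -!rmorphM -!rmorphD /=.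
  congr (_ %:C); rewrite real_normK ?num_real //; ring.
Qed.

Lemma ccontinuous_real (f : R -> R) : continuous f -> ccontinuous (fun x => (f x)%:C).
Proof. by move=> cf x; apply: cvg_realC; exact: cf. Qed.

Lemma exp_decay_vanishes (l : R) (f : R -> R) : 0 < l -> (forall y, f (- y) = f y) ->
  exp_decay l f -> vanishes_at_infinity (fun x => (f x)%:C).
Proof.
move=> l0 ef [K hK].
have lim : f x @[x --> +oo] --> 0.
  apply/cvgrPdist_lt => e e0; near=> x.
  have x0 : 0 < x by near: x; exact: nbhs_pinfty_gt.
  have K0 : 0 <= K by exact: exp_bound_ge0 hK.
  have xe : K / (l * e) < x by near: x; apply: nbhs_pinfty_gt; exact: num_real.
  rewrite sub0r normrN; apply: (le_lt_trans (hK x (ltW x0))).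
  rewrite expRN ltr_pdivrMr ?expR_gt0 //.
  have h1 : K < x * (l * e) by rewrite -ltr_pdivrMr // mulr_gt0.
  have h2 := expR_ge1Dx (l * x).
  have h3 : e * (1 + l * x) <= e * expR (l * x) by rewrite ler_wpM2l // ltW.
  apply: lt_le_trans h3; apply: (lt_trans h1).
  have -> : e * (1 + l * x) = e + x * (l * e) by ring.
  by rewrite ltrDr.
have limN : f x @[x --> -oo] --> 0.
  apply/cvgNy_compNP; rewrite (_ : f \o -%R = f) //.
  by apply/funext => y; rewrite /= ef.
by split; apply: cvg_realC.
Unshelve. all: by end_near. Qed.

End Conclusions.

Section Final.
Variable R : realType.
Local Open Scope complex_scope.
Local Notation Re := (@complex.Re R).
Local Notation Im := (@complex.Im R).

(** The sign [tau] enters as the frequency [tau * n]: the cosine does not see it, and the sine is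
    multiplied by it, which matches the factor [tau] in [v]. *)
Lemma exists_potential_data (W : R -> R) (c : nat -> R) (A Om sg tau : R) (n : nat) :
  potential W c A -> (0 < n)%N -> tau ^+ 2 = 1 ->
  exists (k : fast_data R) (B : R), [/\ fast_spec k (tau * n%:R) B,
    [/\ fn k = n%:R, fOm k = tau * Om, fsig k = tau * sg & fwn k = tau * c n] &
    [/\ fs k = (fun x => tau * sin (n%:R * x / 2)),
        fc k = (fun x => cos (n%:R * x / 2)) & fW k = (fun x => tau * W x)]].
Proof.
move=> [sW pW eW c0 hc hW] n0 t2.
have nR : 0 < n%:R :> R by rewrite ltr0n.
have tn0 : tau != 0 by apply/eqP => t0; move: t2; rewrite t0 expr0n /= => /esym/eqP; rewrite oner_eq0.
have tcases : tau = 1 \/ tau = -1.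
  by move/eqP: t2; rewrite sqrf_eq1 => /orP[/eqP ->|/eqP ->]; [left|right].
have cosT (t : R) : cos (tau * t) = cos t.
  by case: tcases => ->; rewrite ?mulN1r ?cosN ?mul1r.
have sinT (t : R) : sin (tau * t) = tau * sin t.
  by case: tcases => ->; rewrite ?mulN1r ?sinN ?mul1r.
have cW : continuous W.
  move=> x; have := sW 0%N x; rewrite derive1n0 => dx.
  by apply: differentiable_continuous; exact/derivable1_diffP.
have cW' : continuous (fun x => tau * W x) by cont.
have pi0 : 0 < 2 * pi :> R by rewrite mulr_gt0 // pi_gt0.
have ccos : continuous (fun x : R => cos (n%:R * x)) by cont.
have csin : continuous (fun x : R => sin (n%:R * x)) by cont.
have c1 := @cont_cst R 1.
(* Zero mean of [W], with 1 as an arbitrary index: the constant test function pairs to 0 with every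
   cosine mode, so [q = 0]. *)
have i1 : prim (fun x => W x * 1) (2 * pi) = 2 * c 1%N * 0.
  apply: (fourier_coefficient pi0 (ltn0Sn 0) c0 cW c1 _ hc hW) => [x|m m0].
    by rewrite normr1.
  by rewrite prim_cos //; case: ifP.
have i2 : prim (fun x => W x * cos (n%:R * x)) (2 * pi) = 2 * c n * pi.
  apply: (fourier_coefficient pi0 n0 c0 cW ccos _ hc hW) => [x|m m0]; first exact: cos_max.
  by rewrite prim_cos_cos.
have i3 : prim (fun x => W x * sin (n%:R * x)) (2 * pi) = 2 * c n * 0.
  apply: (fourier_coefficient pi0 n0 c0 cW csin _ hc hW) => [x|m m0]; first exact: sin_max.
  by rewrite prim_cos_sin //; case: ifP.
have [cn sn] := trig_2pin R n.
have pc (x : R) : cos (tau * n%:R * (x + 2 * pi)) = cos (tau * n%:R * x).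
  by rewrite -!mulrA !cosT mulrDr cosD cn sn; ring.
have ps (x : R) : sin (tau * n%:R * (x + 2 * pi)) = sin (tau * n%:R * x).
  by rewrite -!mulrA !sinT mulrDr sinD cn sn; ring.
have cWc : continuous (fun x => W x * cos (n%:R * x)) by cont.
have cWs : continuous (fun x => W x * sin (n%:R * x)) by cont.
have nu0 : tau * n%:R != 0 by rewrite mulf_neq0 // gt_eqF.
have [|||||k [B [S [h1 h2 h3 h4] [h5 h6 h7]]]] := @exists_fast_data R n%:R (tau * n%:R) (tau * Om) (tau * sg)
    (tau * c n) (fun x => tau * W x) nR nu0 cW' _ _ pc ps.
- by move=> x; rewrite pW.
- by move=> x; rewrite eW.
- rewrite prim_scale //; rewrite (_ : W = fun x => W x * 1); last by apply/funext => x; rewrite mulr1.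
  by rewrite i1 !mulr0.
- rewrite (_ : (fun x => _) = fun x => tau * (W x * cos (n%:R * x))); last first.
    by apply/funext => x; rewrite -!mulrA cosT.
  by rewrite prim_scale // i2; ring.
- rewrite (_ : (fun x => _) = fun x => tau * (tau * (W x * sin (n%:R * x)))); last first.
    by apply/funext => x; rewrite -!mulrA sinT; ring.
  have cc : continuous (fun x => tau * (W x * sin (n%:R * x))) by cont.
  by rewrite !prim_scale // i3; ring.
exists k, B; split=> //; split=> //.
  rewrite h5; apply/funext => x.
  by have -> : tau * n%:R / 2 * x = tau * (n%:R * x / 2) by ring.
rewrite h6; apply/funext => x.
by have -> : tau * n%:R / 2 * x = tau * (n%:R * x / 2) by ring.
Qed.

Lemma two_mode_approx_real (n : nat) (eps tau : R) (a : R -> R[i]) (x : R) : tau ^+ 2 = 1 ->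
  two_mode_approx n eps a x = (2 * Num.sqrt eps * (Re (a (eps * x)) * cos (n%:R * x / 2) -
    tau * Im (a (eps * x)) * (tau * sin (n%:R * x / 2))))%:C.
Proof.
move=> t2; rewrite /two_mode_approx /expi cosN sinN.
have -> : tau * Im (a (eps * x)) * (tau * sin (n%:R * x / 2)) =
  Im (a (eps * x)) * sin (n%:R * x / 2).
  by rewrite -[RHS]mul1r -t2; ring.
case: (a _) => p q; apply/eqP; rewrite eq_complex /=; apply/andP; split; apply/eqP; ring.
Qed.

Lemma Cb0_norm_real_le (f : R -> R) (M : R) : (forall x, `|f x| <= M) ->
  (Cb0_norm (fun x => (f x)%:C) <= M%:E)%E.
Proof.
by move=> h; apply: ge_ereal_sup => _ [x _ <-]; rewrite lee_fin cmod_realC.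
Qed.

End Final.

Theorem theorem2 (R : realType) (W : R -> R) (w : int -> R[i])
  (hW : admissible_potential W w)
  (n : nat) (hn : (0 < n)%N) (hwn : w n%:Z != 0)
  (sigma Omega : R) (hOmega : `|Omega| < cmod (w n%:Z))
  (a b : R -> R[i])
  (hab : reversible_homoclinic n Omega sigma (w n%:Z) a b) :
  exists eps0 C : R, 0 < eps0 /\ 0 < C /\
    forall eps omega2 : R, 0 < eps < eps0 ->
      omega2 = n%:R ^+ 2 / 4 + eps * Omega ->
      exists (Uhat U : R -> R[i]),
        (forall q : R, 0 <= q -> in_L1q q Uhat) /\
        (forall x : R, U x = fourier_form eps Uhat x) /\
        (exists x : R, U x != 0) /\
        elliptic_solution omega2 eps sigma W U /\
        in_Cb0 (fun x => U x - two_mode_approx n eps a x) /\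
        (Cb0_norm (fun x => (U x - two_mode_approx n eps a x)%R)
           <= (C * eps `^ (5 / 6))%R%:E)%E /\
        (forall x : R, complex.Im (U x) = 0) /\
        ccontinuous U /\
        vanishes_at_infinity U.
Proof.
have [wr [A pot]] := admissible_potential_real hW.
set c := (fun m : nat => complex.Re (w m%:Z)) in pot.
have wE : w n%:Z = (c n)%:C%C by exact: wr.
rewrite wE in hwn hOmega hab; rewrite cmod_realC in hOmega.
have cn0 : c n != 0 by apply: contra hwn => /eqP ->.
pose tau := Num.sg (c n).
have t2 : tau ^+ 2 = 1 by rewrite sqr_sg cn0.
have tcn : tau * c n = `|c n| by rewrite normrEsg.
rewrite -tcn in hOmega.
have [orb en r0 [ue vo] sg0] := homoclinic_real hn t2 hOmega hab.
pose u y := complex.Re (a y); pose v y := tau * complex.Im (a y).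
have {}r0 : forall y, 0 < u y ^+ 2 + v y ^+ 2 by exact: r0.
have {}ue : forall y, u (- y) = u y by exact: ue.
have {}vo : forall y, v (- y) = - v y by exact: vo.
have [k [B [S [h1 h2 h3 h4] [h5 h6 h7]]]] := exists_potential_data Omega sigma pot hn t2.
have al0 : 0 < tau * c n - tau * Omega.
  rewrite subr_gt0; apply: le_lt_trans hOmega; rewrite (le_trans (ler_norm _)) // normrM.
  by rewrite normr_sg cn0 mul1r.
have ga0 : 0 < tau * c n + tau * Omega.
  rewrite -[tau * Omega]opprK subr_gt0; apply: le_lt_trans hOmega.
  by rewrite (le_trans (ler_norm _)) // normrN normrM normr_sg cn0 mul1r.
have al1 : 0 < fwn k - fOm k by rewrite h4 h2.
have ga1 : 0 < fwn k + fOm k by rewrite h4 h2.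
have sg1 : 0 < fsig k by rewrite h3.
have orb1 : averaged_orbit (fn k) (fwn k - fOm k) (fwn k + fOm k) (3 * fsig k) u v.
  by rewrite h1 h2 h3 h4.
have en1 : zero_energy (fwn k - fOm k) (fwn k + fOm k) (3 * fsig k) u v.
  by rewrite h2 h3 h4.
have [e1 [C [mu [e10 C0 mu0 sol]]]] := slow_orbit S al1 ga1 sg1 orb1 en1 r0 ue vo.
have odd0 (t : R) : t = - t -> t = 0 by move=> ?; lra.
have v0 : v 0 = 0 by have := vo 0; rewrite oppr0 => /odd0.
have u00 : u 0 != 0.
  by apply/eqP => u0; have := r0 0; rewrite u0 v0 expr0n /= addr0 ltxx.
(* The bound 1 serves the comparison of powers of [eps]. The last one keeps [C eps] below
   [|u 0| / 2], so [z1 0], and with it [U 0], cannot vanish. *)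
pose eps0 := Num.min (Num.min e1 1) (`|u 0| / (2 * C)).
exists eps0, (4 * C); split.
  by rewrite !lt_min e10 ltr01 divr_gt0 ?normr_gt0 // mulr_gt0.
split; first by rewrite mulr_gt0.
move=> eps omega2 /andP[ep0]; rewrite !lt_min => /andP[/andP[l1 l2] l3] omE.
have ee1 : 0 < eps < e1 by rewrite ep0.
have [z1 [z2 [dz1 dz2 par near0 dec]]] := sol eps ee1.
have nuE : tau * n%:R = tau * fn k by rewrite h1.
have [dU dU1] := fast_solution S ep0 t2 nuE dz1 dz2.
set U := (fun x => 2 * _ * _) in dU dU1; set U1 := (fun x => - _ * _ * _) in dU dU1.
have sq0 : 0 <= Num.sqrt eps by exact: sqrtr_ge0.
have bs x : `|fs k x| <= 1.
  by rewrite h5 normrM normr_sg cn0 mul1r sin_max.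
have bc x : `|fc k x| <= 1 by rewrite h6 cos_max.
pose l := mu * eps; have l0 : 0 < l by rewrite mulr_gt0.
have E x : 0 <= x -> expR (- (mu * `|eps * x|)) = expR (- (l * x)).
  by move=> x0; rewrite ger0_norm ?mulr_ge0 ?(ltW ep0) // mulrA.
have eU : exp_decay l U.
  exists (2 * Num.sqrt eps * (2 * C)) => x x0; rewrite -(E x x0) /U.
  have [d1 d2] := dec (eps * x).
  rewrite normrM ger0_norm ?mulr_ge0 // -[leRHS]mulrA ler_wpM2l ?mulr_ge0 //.
  apply: (le_trans (ler_normB _ _)); rewrite (normrM (z1 _)) (normrM (z2 _)).
  have q1 := ler_pM (normr_ge0 _) (normr_ge0 _) d1 (bc x).
  have q2 := ler_pM (normr_ge0 _) (normr_ge0 _) d2 (bs x).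
  move: q1 q2; rewrite !mulr1; lra.
have eU1 : exp_decay l U1.
  exists (`|- (tau * n%:R) * Num.sqrt eps| * (2 * C)) => x x0; rewrite -(E x x0) /U1.
  have [d1 d2] := dec (eps * x).
  rewrite normrM -[leRHS]mulrA ler_wpM2l //.
  apply: (le_trans (ler_normD _ _)); rewrite (normrM (z1 _)) (normrM (z2 _)).
  have q1 := ler_pM (normr_ge0 _) (normr_ge0 _) d1 (bs x).
  have q2 := ler_pM (normr_ge0 _) (normr_ge0 _) d2 (bc x).
  move: q1 q2; rewrite !mulr1; lra.
have evU x : U (- x) = U x.
  have fse : fs k (- x) = - fs k x by rewrite h5 mulrN mulNr sinN mulrN.
  have fce : fc k (- x) = fc k x by rewrite h6 mulrN mulNr cosN.
  by rewrite /U mulrN; have [-> ->] := par (eps * x); rewrite fse fce; ring.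
have dU1' : antider U1 (fun x => - (omega2 + eps * W x) * U x + sigma * U x ^+ 3).
  apply: antider_eq dU1 _ => x; rewrite h1 h2 h3 h7 omE.
  have t3 (t : R) : tau * (tau * t) = t by rewrite mulrA -expr2 t2 mul1r.
  by rewrite !t3.
have bW j : bounded_derivatives j W.
  apply: (@smooth_bounded _ _ (2 * pi)); [|exact: pot_smooth pot|exact: pot_periodic pot].
  by rewrite mulr_gt0 // pi_gt0.
have DU := solution_decaying l0 bW dU dU1' eU eU1.
(* Cancels the prefactor of [fourier_form] against the [2 pi] of the inversion formula. *)
pose cf : R := (Num.sqrt eps * Num.sqrt (2 * pi))^-1.
pose f x := cf * U x.
have Df j : decaying_derivatives l j f.
  rewrite (_ : f = fun x => U x * cf); last by apply/funext => x; rewrite /f mulrC.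
  by apply: decaying_mul (DU j) _; exact: bounded_cst.
have evf x : f (- x) = f x by rewrite /f evU.
have [cT bT hc hs] := cosine_inversion l0 evf Df.
have cU := antider_continuous dU.
have [du dv] := orb.
have cu := antider_continuous du; have cv := antider_continuous dv.
pose D x := U x - 2 * Num.sqrt eps * (u (eps * x) * cos (n%:R * x / 2) -
    v (eps * x) * (tau * sin (n%:R * x / 2))).
have DE x : (U x)%:C%C - two_mode_approx n eps a x = (D x)%:C%C.
  by rewrite (two_mode_approx_real n eps a x t2) -rmorphB.
have DEf : (fun x => (U x)%:C%C - two_mode_approx n eps a x) = (fun x => (D x)%:C%C).
  by apply/funext.
(* The difference is at most [2 sqrt(eps) * 2 C eps]; then [sqrt(eps) <= 1] and [eps] is at most its
   power 5/6. *)
have Db x : `|D x| <= 4 * C * eps `^ (5 / 6).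
  have -> : D x = 2 * Num.sqrt eps * ((z1 (eps * x) - u (eps * x)) * fc k x -
      (z2 (eps * x) - v (eps * x)) * fs k x).
    by rewrite /D /U h5 h6; ring.
  have [d1 d2] := near0 (eps * x).
  have q1 := ler_pM (normr_ge0 _) (normr_ge0 _) d1 (bc x).
  have q2 := ler_pM (normr_ge0 _) (normr_ge0 _) d2 (bs x).
  rewrite normrM ger0_norm ?mulr_ge0 //.
  have q3 : `|(z1 (eps * x) - u (eps * x)) * fc k x - (z2 (eps * x) - v (eps * x)) * fs k x| <= 2 * C * eps.
    apply: (le_trans (ler_normB _ _)); rewrite (normrM (_ - u _)) (normrM (_ - v _)).
    move: q1 q2; rewrite !mulr1; lra.
  have s1 : Num.sqrt eps <= 1 by rewrite -sqrtr1 ler_wsqrtr // ltW.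
  have s2 : eps <= eps `^ (5 / 6).
    apply: ger1_powR; first by rewrite ep0 ltW.
    by rewrite ler_pdivrMr // mul1r ler_nat.
  apply: (@le_trans _ _ (2 * 1 * (2 * C * eps `^ (5 / 6)))); last first.
    by rewrite le_eqVlt; apply/orP; left; apply/eqP; ring.
  apply: ler_pM; [exact: mulr_ge0 | exact: normr_ge0 | by rewrite ler_wpM2l |].
  by apply: (le_trans q3); rewrite ler_wpM2l ?mulr_ge0 ?(ltW C0).
have cD : continuous D.
  have ie : continuous (fun x : R => eps * x) by cont.
  have cue : continuous (fun x => u (eps * x)) := cont_comp ie cu.
  have cve : continuous (fun x => v (eps * x)) := cont_comp ie cv.
  by rewrite /D; cont.
exists (fun k => (cos_transform f k)%:C%C), (fun x => (U x)%:C%C); split; last split; last split; last split; last split; last split; last split; last split.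
- exact: in_L1q_real cT bT.
- by move=> x; rewrite (fourier_form_real (g := U) ep0 (hc x) (hs x)).
- exists 0.
  have z10 : z1 0 != 0.
    apply/eqP => z0; have [+ _] := near0 0; rewrite z0 sub0r normrN => h.
    move: l3; rewrite ltr_pdivlMr ?mulr_gt0 // => h'.
    have : 0 < `|u 0| by rewrite normr_gt0.
    lra.
  have z20 : z2 0 = 0 by have [_ +] := par 0; rewrite oppr0 => /odd0.
  rewrite /U mulr0 z20 mul0r subr0 h6 mulr0 mul0r cos0 mulr1.
  apply/eqP => -[] /eqP; rewrite mulf_eq0 (negbTE z10) orbF mulf_eq0 pnatr_eq0 /=.
  by rewrite gt_eqF // sqrtr_gt0.
- exact: elliptic_solution_real dU dU1'.
- rewrite DEf; split; first exact: ccontinuous_real.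
  by exists (4 * C * eps `^ (5 / 6)) => x; rewrite cmod_realC.
- by rewrite DEf; exact: Cb0_norm_real_le.
- by [].
- exact: ccontinuous_real.
- exact: exp_decay_vanishes l0 evU eU.
Qed.
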